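(* Let $\{x_k\}$ be the sequence generated by the noise-tolerant Byrd–Omojokun algorithm described in the context. All regions and constants are those defined in the context, for an arbitrary fixed anchor iterate $k'$ (a non-negative integer) and arbitrary fixed constants $\mu>0$, $\hat\mu>0$. If Assumptions 1, 2 and 3 are satisfied, the following two results hold: (i) The sequence $\{x_k\}$ visits infinitely often the critical region $C_{Ac}^{I}(k')$, where the stationarity measure of feasibility is small up to noise level: $\|A(x)^Tc(x)\|\le \mathcal{E}_{Ac}^{I}$. (ii) Once an iterate enters $C_{Ac}^{I}(k')$, the rest of the iterates remain in the larger (up to scaling of noise level) critical region $C_{Ac}^{II}(k')$, where $\Phi(x,\nu)\le E_{Ac}^{II}$. If, in addition, Assumptions 4 and 5 hold, then the sequence of merit parameters $\{\nu_k\}$ remains bounded, and: (iii) Once the sequence $\{x_k\}$ enters $C_{Ac}^{II}(k')$, it visits infinitely often the critical region $C_{gZ}^{I}$, where the projected gradient is small up to noise level: $\|g(x)^TZ(x)\|\le \mathcal{E}_{gZ}^{I}+\varepsilon_{gZ}$. (iv) After the iterates enter $C_{gZ}^{I}$ for the first time, they remain in the larger (up to scaling of noise level) critical region $C_{gZ}^{II}$, where $\phi(x,\nu)\le E_{gZ}^{II}$.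
   Context: **Setting.** $f:\mathbb{R}^n\to\mathbb{R}$ and $c:\mathbb{R}^n\to\mathbb{R}^m$ are smooth, $g(x)=\nabla f(x)$, and $A(x)\in\mathbb{R}^{m\times n}$ is the Jacobian of $c$. The problem is $\min f(x)$ s.t. $c(x)=0$, but only the noisy quantities $\tilde f=f+\delta_f$, $\tilde c=c+\delta_c$, $\tilde g=g+\delta_g$, $\tilde A=A+\delta_A$ are available. A subscript $k$ means evaluation at $x_k$; $\|\cdot\|$ is the $\ell_2$ (operator) norm. **Algorithm.** Constants $\pi_0,\pi_1,\zeta\in(0,1)$, $\tau>1$, $\xi=2/(1-\pi_0)$, noise levels $\epsilon_f,\epsilon_c$; initial $x_0$, $\nu_{-1}>0$, $\Delta_0>0$. At iteration $k$, a symmetric matrix $\tilde W_k$ (approximating the Hessian of the Lagrangian) is given. Let $v_k$ minimize $\|\tilde A_kv+\tilde c_k\|$ s.t. $\|v\|\le\zeta\Delta_k$, with $v_k$ in the range of $\tilde A_k^T$; let $p_k$ minimize $\tilde g_k^Tp+\frac12p^T\tilde W_kp$ s.t. $\tilde A_kp+\tilde c_k=\tilde A_kv_k+\tilde c_k$, $\|p\|\le\Delta_k$. Put $\mathrm{vpred}_k=\|\tilde c_k\|-\|\tilde A_kp_k+\tilde c_k\|$ and, for a penalty value $\nu$, $\mathrm{pred}_k=-\tilde g_k^Tp_k-\frac12p_k^T\tilde W_kp_k+\nu\,\mathrm{vpred}_k$. Starting from $\nu=\nu_{k-1}$, multiply $\nu$ by $\tau$ as long as $\mathrm{pred}_k\le\pi_1\nu\,\mathrm{vpred}_k$;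 the final value is the merit (penalty) parameter $\nu_k$, and $\mathrm{pred}_k$ is evaluated with $\nu_k$. With $\tilde\phi(x,\nu)=\tilde f(x)+\nu\|\tilde c(x)\|$, let $\mathrm{ared}_k=\tilde\phi(x_k,\nu_k)-\tilde\phi(x_k+p_k,\nu_k)$ and $\rho_k=\dfrac{\mathrm{ared}_k+\xi(\epsilon_f+\nu_k\epsilon_c)}{\mathrm{pred}_k+\xi(\epsilon_f+\nu_k\epsilon_c)}$. If $\rho_k>\pi_0$ the step is accepted: $x_{k+1}=x_k+p_k$, $\Delta_{k+1}=\tau\Delta_k$. Otherwise $x_{k+1}=x_k$, $\Delta_{k+1}=\Delta_k/\tau$. The algorithm is run indefinitely. **Assumption 1.** $f$ and $c$ are $L_f$- and $L_c$-smoothly differentiable, respectively (i.e. $\nabla f$ and the Jacobian of $c$ are Lipschitz with constants $L_f$ and $L_c$). **Assumption 2.** For all $k$: $\|\tilde A_k\|\le M_A$, $\|\tilde W_k\|\le M_W$, $\|\tilde c_k\|\le M_c$ for some constants $M_A,M_W,M_c$; and $\{\tilde f_k\}$ is bounded below. (By adding a constant to the objective, which affects neither the problem nor the algorithm, it is arranged that $\tilde f(x_k)>0$ for all $k$.) **Assumption 3.** For all $x$: $|\delta_f(x)|\le\epsilon_f$, $\|\delta_c(x)\|\le\epsilon_c$, $\|\delta_g(x)\|\le\epsilon_g$, $\|\delta_A(x)\|\le\epsilon_A$. **Assumption 4.** The singular values of the Jacobians $\{\tilde A_k\}$ are bounded below by $\sigma_{\min}>0$. **Assumption 5.** $Z(x)$,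 $\tilde Z(x)$ are orthonormal bases of the null spaces of $A(x)$, $\tilde A(x)$, and there is a constant $\epsilon_Z$ with $\|\tilde Z(x)-Z(x)\|\le\epsilon_Z$. **Feasibility constants and regions** (suprema are taken in the extended reals). $\Phi(x,\nu)=\frac1\nu f(x)+\|c(x)\|$; $M=\max\left[\frac{L_f+M_W}{\nu_0},L_c,M_A^2\right]$; $\chi=\dfrac{\pi_0\pi_1^2\zeta^2}{2\tau\xi M_c\max(1,M_c)M}$; $\mathcal E_v(k')=\dfrac{\xi M_c}{\pi_1\zeta}(\epsilon_g/\nu_{k'}+\epsilon_A)$; $e_{k'}=\epsilon_f/\nu_{k'}+\epsilon_c$; $\gamma_{k'}=\frac12\left(-\mathcal E_v(k')+\sqrt{\mathcal E_v(k')^2+8e_{k'}/\chi}\right)+\mu$. $\mathcal E_{Ac}^I=\mathcal E_v(k')+\epsilon_AM_c+\epsilon_cM_A+\epsilon_A\epsilon_c+\gamma_{k'}$ and $C_{Ac}^I(k')=\{x:\|A(x)^Tc(x)\|\le\mathcal E_{Ac}^I\}$. $\bar\Phi_{Ac}^I(k')=\sup_{x\in C_{Ac}^I(k'),\,\nu\ge\nu_{k'}}\Phi(x,\nu)$; $\bar G_{Ac}^I(k')=\sup_{x\in C_{Ac}^I(k')}\|g(x)\|$. $\mathcal P_{Ac}^{II}(k')=\left[\dfrac{\bar G_{Ac}^I(k')}{\nu_{k'}}+\mathcal E_{Ac}^I+\dfrac{\pi_1\tau\zeta(L_f/\nu_{k'}+L_c)}{\xi(\tau-1)\max(1,M_c)M}\gamma_{k'}\right]\dfrac{\pi_1\tau\zeta}{\xi(\tau-1)\max(1,M_c)M}\gamma_{k'}$.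 $E_{Ac}^{II}=\bar\Phi_{Ac}^I(k')+\max(\mathcal P_{Ac}^{II}(k'),2e_{k'})+2e_{k'}$ and $C_{Ac}^{II}(k')=\{x:\Phi(x,\nu)\le E_{Ac}^{II}\}$, where $\nu$ is the merit parameter in use: that the iterate $x_k$ lies in this region means $\Phi(x_k,\nu_k)\le E_{Ac}^{II}$; in suprema over the region, $x$ ranges over the points with $\Phi(x,\nu)\le E_{Ac}^{II}$ for some $\nu$ among the generated values $\nu_k$. **Optimality constants and regions.** $k''$ (the settling iterate) is an integer such that $\nu_k=\nu_{k''}$ for all $k\ge k''$; it exists when $\{\nu_k\}$ is bounded. $M_g$ denotes a bound on $\|\tilde g_k\|$ over all $k$, and $\sigma_{\max}$ an upper bound on the singular values of the $\tilde A_k$. $\kappa=\sigma_{\max}/\sigma_{\min}$; $\Gamma_1=\dfrac{2}{\sigma_{\min}\min(1,\kappa^{-2}/2)}$; $\Gamma_2=\left[1+\left(M_g+\frac{M_WM_c\Gamma_1}{2}\right)\frac{\Gamma_1}{\pi_1\nu_0}\right]^{-1}$; $\bar\nu=\dfrac{\tau\Gamma_1}{1-\pi_1}\left(M_g+\frac{M_WM_c\Gamma_1}{2}\right)$; $M_L(\nu)=\max(L_f+M_W,\nu L_c)$; $\Theta=\dfrac{\pi_0\Gamma_2^2(1-\zeta)^2}{2\tau\xi M_L(\bar\nu)}$; $\mathcal E_h=\dfrac{\xi}{\Gamma_2(1-\zeta)}(\epsilon_g+\bar\nu\epsilon_A)$; $\bar\varepsilon=\epsilon_f+\bar\nu\epsilon_c$;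 $\bar\gamma=\frac12\left(-\mathcal E_h+\sqrt{\mathcal E_h^2+8(\epsilon_f+\bar\nu\epsilon_c)/\Theta}\right)+\hat\mu$. $\bar G_{Ac}^{II}(k')=\sup_{x\in C_{Ac}^{II}(k')}\|g(x)\|$; $\varepsilon_{gZ}=\epsilon_g+\epsilon_Z\bar G_{Ac}^{II}(k')+\epsilon_g\epsilon_Z$; $\mathcal E_{Ac}^{II}=\sup_{x\in C_{Ac}^{II}(k')}\|\tilde A(x)^T\tilde c(x)\|$. $\mathcal E_{gZ}^I=\mathcal E_h+\dfrac{\Gamma_1M_W\mathcal E_{Ac}^{II}}{\sigma_{\min}}+\varepsilon_{gZ}+\bar\gamma$ and $C_{gZ}^I=\{x:\|g(x)^TZ(x)\|\le\mathcal E_{gZ}^I\}$. $\phi(x,\nu)=f(x)+\nu\|c(x)\|$; $\bar\phi_{gZ}^I=\sup_{x\in C_{gZ}^I}\phi(x,\nu_{k''})$; $\bar G_{gZ}^I=\sup_{x\in C_{gZ}^I}\|g(x)\|$. $\mathcal P_{gZ}^{II}=\left[\bar G_{gZ}^I+\nu_{k''}\mathcal E_{Ac}^{II}+\dfrac{\tau\Gamma_2(1-\zeta)}{(\tau-1)\xi M_L(\bar\nu)}\bar\gamma\right]\dfrac{\tau\Gamma_2(1-\zeta)}{(\tau-1)\xi M_L(\bar\nu)}\bar\gamma$. $E_{gZ}^{II}=\bar\phi_{gZ}^I+\max(\mathcal P_{gZ}^{II},2\bar\varepsilon)+2\bar\varepsilon$ and $C_{gZ}^{II}=\{x:\phi(x,\nu)\le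 E_{gZ}^{II}\}$, where again $\nu$ is the merit parameter in use: that the iterate $x_k$ lies in this region means $\phi(x_k,\nu_k)\le E_{gZ}^{II}$.
   Formalization: Added: in (ii) the entry occurs at or after iterate k'; in (iii),(iv) ν_{-1} ≤ ν̄; in (iv) the entry occurs at or after the settling iterate k''; denominators M_c, M, M_L(ν̄) are positive. Without these the claims fail or are undefined. *)

(* Defs.v *)
From HB Require Import structures.
From mathcomp Require Import all_boot all_order all_algebra.
From mathcomp Require Import all_classical all_reals all_analysis.

Set Implicit Arguments.
Unset Strict Implicit.
Unset Printing Implicit Defensive.

Import Order.TTheory GRing.Theory Num.Theory.
Import numFieldNormedType.Exports.

Local Open Scope classical_set_scope.
Local Open Scope ring_scope.

(* Points of R^n are column vectors.  The library norm `|_| on matrices is the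
   sup norm: it only serves to define derivatives
   (which do not depend on it); all estimates use norm2 and opnorm. *)

Section LinearAlgebra.
Variable R : realType.

Definition norm2 d (v : 'cV[R]_d) : R := Num.sqrt (\sum_i v i 0 ^+ 2).

Definition opnorm p q (B : 'M[R]_(p, q)) : R :=
  sup [set norm2 (B *m v) | v in [set v : 'cV[R]_q | norm2 v <= 1]].

(* The p singular values of a p x q matrix, as square roots of the eigenvalues
   of B B^T.  A positive lower bound on them means full row rank. *)
Definition singular_value p q (B : 'M[R]_(p, q)) (s : R) : Prop :=
  0 <= s /\ eigenvalue (B *m B^T) (s ^+ 2).

(* kermx is the left kernel: the rows of kermx B^T span {u^T | B u = 0}. *)
Definition orthonormal_kernel_basis p q d (B : 'M[R]_(p, q)) (Z : 'M[R]_(q, d))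
    : Prop :=
  Z^T *m Z = 1%:M /\ (Z^T == kermx B^T)%MS.

Definition grad n (f : 'cV[R]_n -> R) (x : 'cV[R]_n) : 'cV[R]_n :=
  \col_j 'D_(delta_mx j 0) f x.

(* Usual convention: row i is the gradient of the i-th component. *)
Definition jac n m (c : 'cV[R]_n -> 'cV[R]_m) (x : 'cV[R]_n) : 'M[R]_(m, n) :=
  \matrix_(i, j) 'D_(delta_mx j 0) (fun y => c y i 0) x.

End LinearAlgebra.

Record noisy_problem (R : realType) (n m : nat) := NoisyProblem {
  obj    : 'cV[R]_n -> R;
  con    : 'cV[R]_n -> 'cV[R]_m;
  deltaf : 'cV[R]_n -> R;
  deltac : 'cV[R]_n -> 'cV[R]_m;
  deltag : 'cV[R]_n -> 'cV[R]_n;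
  deltaA : 'cV[R]_n -> 'M[R]_(m, n) }.

Record parameters (R : realType) := AlgoParameters {
  pi0 : R; pi1 : R; zeta : R; tau : R; epsf : R; epsc : R }.

Definition xi (R : realType) (a : parameters R) : R := 2 / (1 - pi0 a).

Record run (R : realType) (n m : nat) := Run {
  iterate : nat -> 'cV[R]_n;
  radius  : nat -> R;
  nu_init : R;                     (* nu_{-1} *)
  nu      : nat -> R;
  hess    : nat -> 'M[R]_n;
  nstep   : nat -> 'cV[R]_n;
  step    : nat -> 'cV[R]_n }.
Arguments Run {R n} m.

(* Lipschitz constants, bounds along the run, noise levels and the positive
   offsets mu, muhat of the critical regions. *)
Record constants (R : realType) := Constants {
  Lf : R; Lc : R; MA : R; MW : R; Mc : R; epsg : R; epsA : R;
  mu : R; muhat : R }.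

(* Constants that only enter the optimality regions. *)
Record opt_constants (R : realType) := OptConstants {
  epsZ : R; Mg : R; sigma_min : R; sigma_max : R }.

Section NoisyProblem.
Variables (R : realType) (n m : nat) (P : noisy_problem R n m).

Definition g (x : 'cV[R]_n) := grad (obj P) x.
Definition A (x : 'cV[R]_n) := jac (con P) x.
Definition ftilde (x : 'cV[R]_n) := obj P x + deltaf P x.
Definition ctilde (x : 'cV[R]_n) := con P x + deltac P x.
Definition gtilde (x : 'cV[R]_n) := g x + deltag P x.
Definition Atilde (x : 'cV[R]_n) := A x + deltaA P x.

Definition phi (x : 'cV[R]_n) (v : R) : R := obj P x + v * norm2 (con P x).
Definition phitilde (x : 'cV[R]_n) (v : R) : R :=
  ftilde x + v * norm2 (ctilde x).
Definition Phi (x : 'cV[R]_n) (v : R) : R :=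
  v^-1 * obj P x + norm2 (con P x).

End NoisyProblem.

Section Algorithm.
Variables (R : realType) (n m : nat).

Definition is_normal_step (At : 'M[R]_(m, n)) (ct : 'cV[R]_m) (D : R)
    (v : 'cV[R]_n) : Prop :=
  [/\ norm2 v <= D,
      exists w : 'cV[R]_m, v = At^T *m w &
      forall u : 'cV[R]_n, norm2 u <= D ->
        norm2 (At *m v + ct) <= norm2 (At *m u + ct)].

Definition qmodel (gt : 'cV[R]_n) (W : 'M[R]_n) (p : 'cV[R]_n) : R :=
  (gt^T *m p) 0 0 + 2^-1 * (p^T *m W *m p) 0 0.

Definition is_full_step (At : 'M[R]_(m, n)) (ct : 'cV[R]_m)
    (gt : 'cV[R]_n) (W : 'M[R]_n) (v : 'cV[R]_n) (D : R) (p : 'cV[R]_n) : Prop :=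
  [/\ At *m p + ct = At *m v + ct,
      norm2 p <= D &
      forall u : 'cV[R]_n, At *m u + ct = At *m v + ct -> norm2 u <= D ->
        qmodel gt W p <= qmodel gt W u].

Variables (P : noisy_problem R n m) (a : parameters R) (r : run R n m).

Definition At_ k := Atilde P (iterate r k).
Definition ct_ k := ctilde P (iterate r k).
Definition gt_ k := gtilde P (iterate r k).
Definition ft_ k := ftilde P (iterate r k).

Definition vpred (k : nat) : R :=
  norm2 (ct_ k) - norm2 (At_ k *m step r k + ct_ k).

Definition pred_at (k : nat) (v : R) : R :=
  - qmodel (gt_ k) (hess r k) (step r k) + v * vpred k.

Definition nu_prev (k : nat) : R :=
  if k is k1.+1 then nu r k1 else nu_init r.

(* nu_k is the value at which the updating loop stops; a run for which some
   loop never stops does not generate an infinite sequence. *)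
Definition merit_update (k : nat) : Prop :=
  exists j : nat,
    [/\ nu r k = nu_prev k * tau a ^+ j,
        pi1 a * nu r k * vpred k < pred_at k (nu r k) &
        forall i : nat, (i < j)%N ->
          pred_at k (nu_prev k * tau a ^+ i)
            <= pi1 a * (nu_prev k * tau a ^+ i) * vpred k].

Definition ared (k : nat) : R :=
  phitilde P (iterate r k) (nu r k)
    - phitilde P (iterate r k + step r k) (nu r k).

Definition rho (k : nat) : R :=
  (ared k + xi a * (epsf a + nu r k * epsc a))
    / (pred_at k (nu r k) + xi a * (epsf a + nu r k * epsc a)).

Definition iterate_update (k : nat) : Prop :=
  if pi0 a < rho k then
    iterate r k.+1 = iterate r k + step r k
      /\ radius r k.+1 = tau a * radius r k
  else
    iterate r k.+1 = iterate r k /\ radius r k.+1 = radius r k / tau a.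

Definition valid_parameters : Prop :=
  [/\ 0 < pi0 a < 1, 0 < pi1 a < 1, 0 < zeta a < 1 & 1 < tau a].

Definition generated : Prop :=
  [/\ 0 < nu_init r, 0 < radius r 0%N &
      forall k : nat,
        [/\ (hess r k)^T = hess r k,
            is_normal_step (At_ k) (ct_ k) (zeta a * radius r k) (nstep r k),
            is_full_step (At_ k) (ct_ k) (gt_ k) (hess r k) (nstep r k)
              (radius r k) (step r k),
            merit_update k &
            iterate_update k]].

Variables (b : constants R) (o : opt_constants R).

Definition smoothness : Prop :=
  [/\ 0 <= Lf b, 0 <= Lc b,
      (forall x, differentiable (obj P) x)
        /\ (forall x y, norm2 (g P x - g P y) <= Lf b * norm2 (x - y)) &
      (forall x, differentiable (con P) x)
        /\ (forall x y, opnorm (A P x - A P y) <= Lc b * norm2 (x - y))].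

(* The lower bound on the noisy objective values is normalized to 0. *)
Definition iterate_bounds : Prop :=
  forall k : nat,
    [/\ opnorm (At_ k) <= MA b, opnorm (hess r k) <= MW b,
        norm2 (ct_ k) <= Mc b & 0 < ft_ k].

Definition noise_bounds : Prop :=
  forall x : 'cV[R]_n,
    [/\ `|deltaf P x| <= epsf a, norm2 (deltac P x) <= epsc a,
        norm2 (deltag P x) <= epsg b & opnorm (deltaA P x) <= epsA b].

Definition jacobians_bounded_below : Prop :=
  0 < sigma_min o
    /\ forall (k : nat) (s : R), singular_value (At_ k) s -> sigma_min o <= s.

(* The common number q x of columns may vary with x, with the rank of A x. *)
Definition kernel_bases (q : 'cV[R]_n -> nat)
    (Z Ztilde : forall x : 'cV[R]_n, 'M[R]_(n, q x)) : Prop :=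
  forall x : 'cV[R]_n,
    [/\ orthonormal_kernel_basis (A P x) (Z x),
        orthonormal_kernel_basis (Atilde P x) (Ztilde x) &
        opnorm (Ztilde x - Z x) <= epsZ o].

(* 0 < sigma_max only matters for m = 0, where there are no singular values. *)
Definition gradient_and_singular_value_bounds : Prop :=
  [/\ forall k : nat, norm2 (gt_ k) <= Mg o,
      0 < sigma_max o &
      forall (k : nat) (s : R), singular_value (At_ k) s -> s <= sigma_max o].

End Algorithm.

Section FeasibilityRegions.
Variables (R : realType) (n m : nat).
Variables (P : noisy_problem R n m) (a : parameters R) (r : run R n m).
Variables (b : constants R) (k' : nat).

Let nuk := nu r k'.

Definition Mbig : R :=
  Num.max ((Lf b + MW b) / nu r 0%N) (Num.max (Lc b) (MA b ^+ 2)).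

Definition chi : R :=
  pi0 a * pi1 a ^+ 2 * zeta a ^+ 2
    / (2 * tau a * xi a * Mc b * Num.max 1 (Mc b) * Mbig).

Definition Ev : R :=
  xi a * Mc b / (pi1 a * zeta a) * (epsg b / nuk + epsA b).

Definition e_noise : R := epsf a / nuk + epsc a.

Definition gamma_feas : R :=
  2^-1 * (- Ev + Num.sqrt (Ev ^+ 2 + 8 * e_noise / chi)) + mu b.

Definition EAcI : R :=
  Ev + epsA b * Mc b + epsc a * MA b + epsA b * epsc a + gamma_feas.

Definition CAcI : set 'cV[R]_n :=
  [set x | norm2 ((A P x)^T *m con P x) <= EAcI].

Definition PhibarAcI : \bar R :=
  ereal_sup [set (Phi P z.1 z.2)%:E
            | z in [set z : 'cV[R]_n * R | CAcI z.1 /\ nuk <= z.2]].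

Definition GbarAcI : \bar R := ereal_sup [set (norm2 (g P x))%:E | x in CAcI].

Definition dAc : R :=
  pi1 a * tau a * zeta a / (xi a * (tau a - 1) * Num.max 1 (Mc b) * Mbig)
    * gamma_feas.

Definition PAcII : \bar R :=
  ((GbarAcI * (nuk^-1)%:E + EAcI%:E + ((Lf b / nuk + Lc b) * dAc)%:E)
     * dAc%:E)%E.

Definition EAcII : \bar R :=
  (PhibarAcI + Order.max PAcII (2 * e_noise)%:E + (2 * e_noise)%:E)%E.

Definition in_CAcII (k : nat) : Prop :=
  ((Phi P (iterate r k) (nu r k))%:E <= EAcII)%E.

(* The region as a set of points, used in suprema. *)
Definition CAcII : set 'cV[R]_n :=
  [set x | exists j : nat, ((Phi P x (nu r j))%:E <= EAcII)%E].

End FeasibilityRegions.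

Section OptimalityRegions.
Variables (R : realType) (n m : nat).
Variables (P : noisy_problem R n m) (a : parameters R) (r : run R n m).
Variables (b : constants R) (o : opt_constants R).

Definition settled (k'' : nat) : Prop :=
  forall k : nat, (k'' <= k)%N -> nu r k = nu r k''.

Definition kappa : R := sigma_max o / sigma_min o.

Definition Gamma1 : R :=
  2 / (sigma_min o * Num.min 1 (kappa ^- 2 / 2)).

Definition Gamma2 : R :=
  (1 + (Mg o + MW b * Mc b * Gamma1 / 2) * (Gamma1 / (pi1 a * nu r 0%N)))^-1.

(* An upper bound for all nu_k provided that nu_init <= nubar (nu never
   decreases). *)
Definition nubar : R :=
  tau a * Gamma1 / (1 - pi1 a) * (Mg o + MW b * Mc b * Gamma1 / 2).

Definition ML (v : R) : R := Num.max (Lf b + MW b) (v * Lc b).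

Definition Theta : R :=
  pi0 a * Gamma2 ^+ 2 * (1 - zeta a) ^+ 2 / (2 * tau a * xi a * ML nubar).

Definition Eh : R :=
  xi a / (Gamma2 * (1 - zeta a)) * (epsg b + nubar * epsA b).

Definition epsbar : R := epsf a + nubar * epsc a.

Definition gammabar : R :=
  2^-1 * (- Eh + Num.sqrt (Eh ^+ 2 + 8 * (epsf a + nubar * epsc a) / Theta))
    + muhat b.

Variables (k' k'' : nat).

Definition GbarAcII : \bar R :=
  ereal_sup [set (norm2 (g P x))%:E | x in CAcII P a r b k'].

Definition eps_gZ : \bar R :=
  ((epsg b)%:E + (epsZ o)%:E * GbarAcII + (epsg b * epsZ o)%:E)%E.

(* Supremum of the noisy measure ||Atilde^T ctilde||, over all points of the
   region; not to be confused with the threshold EAcII. *)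
Definition calEAcII : \bar R :=
  ereal_sup [set (norm2 ((Atilde P x)^T *m ctilde P x))%:E
            | x in CAcII P a r b k'].

Definition EgZI : \bar R :=
  (Eh%:E + (Gamma1 * MW b / sigma_min o)%:E * calEAcII + eps_gZ
     + gammabar%:E)%E.

Variables (q : 'cV[R]_n -> nat) (Z : forall x : 'cV[R]_n, 'M[R]_(n, q x)).

Definition gZnorm (x : 'cV[R]_n) : R := norm2 ((g P x)^T *m Z x)^T.

Definition CgZI : set 'cV[R]_n := [set x | ((gZnorm x)%:E <= EgZI)%E].

Definition phibargZI : \bar R :=
  ereal_sup [set (phi P x (nu r k''))%:E | x in CgZI].

Definition GbargZI : \bar R := ereal_sup [set (norm2 (g P x))%:E | x in CgZI].

Definition dgZ : R :=
  tau a * Gamma2 * (1 - zeta a) / ((tau a - 1) * xi a * ML nubar) * gammabar.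

Definition PgZII : \bar R :=
  ((GbargZI + (nu r k'')%:E * calEAcII + dgZ%:E) * dgZ%:E)%E.

Definition EgZII : \bar R :=
  (phibargZI + Order.max PgZII (2 * epsbar)%:E + (2 * epsbar)%:E)%E.

Definition in_CgZII (k : nat) : Prop :=
  ((phi P (iterate r k) (nu r k))%:E <= EgZII)%E.

End OptimalityRegions.

(* Main.v *)
From HB Require Import structures.
Require Import Defs.
From mathcomp Require Import all_boot all_order all_algebra.
From mathcomp Require Import all_classical all_reals all_analysis.
From mathcomp Require Import ring lra.

Set Implicit Arguments.
Unset Strict Implicit.
Unset Printing Implicit Defensive.

Import Order.TTheory GRing.Theory Num.Theory.
Import numFieldNormedType.Exports.

Local Open Scope classical_set_scope.
Local Open Scope ring_scope.

(** A single iteration obeys three estimates.  Comparing the normal step with the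
Cauchy point of its subproblem bounds vpred below by the noisy stationarity
measure h = |Atilde^T ctilde| times the radius ([vpred_cauchy]); the update of
the merit parameter gives pred > pi1 nu vpred ([pred_gt]); and Taylor's formula
shows that ared falls short of pred by at most a [model_gap], quadratic in the
radius up to noise, plus twice the noise of the merit function ([ared_ge]).
The term with xi in the ratio rho is exactly what absorbs that last noise, so a
step is accepted as soon as [model_gap] < (1 - pi0) pred ([accept_of_gap]),
while any accepted step lowers the noisy merit function by pi0 pred up to that
noise ([accepted_decrease]).

(i) Outside CAcI one has h > Ev + gamma, which produces a threshold radius
[Dfeas]: smaller steps are accepted ([feas_small]), and accepted steps with a
radius at least Dfeas / tau decrease the noisy merit function by a fixed amount,
because gamma lies beyond the root of the quadratic that balances decrease and
noise ([feas_large]).  Acceptance enlarges the radius and rejection shrinks it,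
so a run that stayed outside for ever would decrease a positive function without
end ([no_endless_decrease]).  Dividing the merit function by nu makes it
monotone in nu as well.

(ii) During an excursion out of CAcI, steps of radius at most Dfeas do not
increase even the noiseless merit function: noise of size eps in c perturbs
|c| - |c + w| by at most 4 eps |w| / (|c| + |ctilde|) ([norm_change_noise]),
which is little compared with vpred while h is large.  Once the radius has
exceeded Dfeas / tau it stays so, and the noisy merit function decreases.  What
remains is the increase over the step that leaves the region, for which the
definition of EAcII has room ([first_step]).

The merit parameters are bounded since full rank of the Jacobians makes the
length of the normal step at most Gamma1 vpred ([normal_step_le]).

(iii) repeats (i) with the reduced gradient instead of h: outside CgZI, but
inside CAcII, it exceeds Eh + gammabar ([opt_good_notC]), and pred is at least
Gamma2 times the tangential decrease ([pred_ge_hpred]).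

(iv) is harder.  After the last visit to CgZI there can be a long phase of
accepted steps with radius at most [Dopt], and now nothing prevents |c| from
being as small as the noise, in which case a step may raise the merit function
by 2 nu eps.  The number of such noisy steps has no a priori bound, but their
total length has: radii grow geometrically, so the phase has length at most
Dopt / (tau - 1).  Hence the cost is charged to length.  On a window of length
at most 2 Dopt between two noisy steps, the objective changes little because
the normal steps add up to a displacement u with A u close to the difference of
two constraint values of noise size ([obj_window]), and |c| grows only by noise
over the square root of a ratio of lengths, because each normal step is at
least as good as one that undoes part of u ([con_window]).  Chaining windows
([noisy_bound]) yields a total cost below tau Dopt (gammabar + Eh) / (tau - 1)
([phase_total]).  The definition of PgZII contains that amount: on leaving CgZI
the gradient norm crosses the level EgZI, hence the supremum of |g| over CgZI is
at least Eh + gammabar ([exit_gradient]).  If the phase leaves CAcII, the merit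
bound of part (ii) takes over ([excursion_bound]). *)

(** * Euclidean norms and operator norms *)

Section Euclid.
Variable R : realType.
Implicit Types d p q : nat.

Definition dot d (u v : 'cV[R]_d) : R := \sum_i u i 0 * v i 0.

Lemma dotE d (u v : 'cV[R]_d) : dot u v = (u^T *m v) 0 0.
Proof. by rewrite mxE; apply: eq_bigr => i _; rewrite mxE. Qed.

Lemma dotC d (u v : 'cV[R]_d) : dot u v = dot v u.
Proof. by apply: eq_bigr => i _; rewrite mulrC. Qed.

Lemma dotDl d (u v w : 'cV[R]_d) : dot (u + v) w = dot u w + dot v w.
Proof. by rewrite -big_split; apply: eq_bigr => i _; rewrite mxE mulrDl. Qed.

Lemma dotZl d (k : R) (u w : 'cV[R]_d) : dot (k *: u) w = k * dot u w.
Proof. by rewrite /dot mulr_sumr; apply: eq_bigr => i _; rewrite mxE mulrA. Qed.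

Lemma dotDr d (u v w : 'cV[R]_d) : dot w (u + v) = dot w u + dot w v.
Proof. by rewrite dotC dotDl !(dotC w). Qed.

Lemma dotZr d (k : R) (u w : 'cV[R]_d) : dot w (k *: u) = k * dot w u.
Proof. by rewrite dotC dotZl dotC. Qed.

Lemma dotNl d (u w : 'cV[R]_d) : dot (- u) w = - dot u w.
Proof. by rewrite -scaleN1r dotZl mulN1r. Qed.

Lemma dotNr d (u w : 'cV[R]_d) : dot w (- u) = - dot w u.
Proof. by rewrite dotC dotNl dotC. Qed.

Lemma dotBl d (u v w : 'cV[R]_d) : dot (u - v) w = dot u w - dot v w.
Proof. by rewrite dotDl dotNl. Qed.

Lemma dotBr d (u v w : 'cV[R]_d) : dot w (u - v) = dot w u - dot w v.
Proof. by rewrite dotDr dotNr. Qed.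

Lemma dot0l d (w : 'cV[R]_d) : dot 0 w = 0.
Proof. by rewrite -[X in dot X]( scale0r (0 : 'cV_d)) dotZl mul0r. Qed.

Lemma dot0r d (w : 'cV[R]_d) : dot w 0 = 0.
Proof. by rewrite dotC dot0l. Qed.

Definition dotE_lin := (dotDl, dotDr, dotBl, dotBr, dotZl, dotZr, dotNl, dotNr).

Lemma dot_suml d I (s : seq I) (P : pred I) (F : I -> 'cV[R]_d) w :
  dot (\sum_(i <- s | P i) F i) w = \sum_(i <- s | P i) dot (F i) w.
Proof.
by elim/big_rec2: _ => [|i a b _ <-]; rewrite ?dot0l // dotDl.
Qed.

Lemma dot_tr p q (B : 'M[R]_(p, q)) u v : dot (B *m u) v = dot u (B^T *m v).
Proof. by rewrite !dotE trmx_mul mulmxA. Qed.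

Lemma norm2_sq d (u : 'cV[R]_d) : norm2 u ^+ 2 = dot u u.
Proof.
rewrite sqr_sqrtr; first by apply: eq_bigr => i _; rewrite expr2.
by apply: sumr_ge0 => i _; rewrite sqr_ge0.
Qed.

Lemma norm2_ge0 d (u : 'cV[R]_d) : 0 <= norm2 u.
Proof. exact: sqrtr_ge0. Qed.
#[local] Hint Resolve norm2_ge0 : core.

Lemma dot_ge0 d (u : 'cV[R]_d) : 0 <= dot u u.
Proof. by rewrite -norm2_sq sqr_ge0. Qed.

Lemma dot_eq0 d (u : 'cV[R]_d) : dot u u = 0 -> u = 0.
Proof.
move=> /eqP; rewrite psumr_eq0 => [/allP h|i _]; last by rewrite -expr2 sqr_ge0.
apply/colP => i; rewrite mxE; have := h i (mem_index_enum i).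
by rewrite -expr2 sqrf_eq0 => /eqP.
Qed.

Lemma norm2_eq0 d (u : 'cV[R]_d) : norm2 u = 0 -> u = 0.
Proof. by move=> h; apply: dot_eq0; rewrite -norm2_sq h expr0n. Qed.

Lemma norm20 d : norm2 (0 : 'cV[R]_d) = 0.
Proof. by apply/eqP; rewrite -sqrf_eq0 norm2_sq dot0l. Qed.

Lemma norm2Z d (k : R) (u : 'cV[R]_d) : norm2 (k *: u) = `|k| * norm2 u.
Proof.
apply/eqP; rewrite -(@eqrXn2 _ 2) //; last by rewrite mulr_ge0.
by rewrite exprMn !norm2_sq dotZl dotZr mulrA real_normK ?num_real // expr2.
Qed.

Lemma norm2N d (u : 'cV[R]_d) : norm2 (- u) = norm2 u.
Proof. by rewrite -scaleN1r norm2Z normrN1 mul1r. Qed.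

Lemma norm2BC d (u v : 'cV[R]_d) : norm2 (u - v) = norm2 (v - u).
Proof. by rewrite -norm2N opprB. Qed.

Lemma cauchy_schwarz d (u v : 'cV[R]_d) : dot u v <= norm2 u * norm2 v.
Proof.
have [h|u0] := eqVneq (norm2 u) 0.
  by rewrite h mul0r (norm2_eq0 h) dot0l.
have [h|v0] := eqVneq (norm2 v) 0.
  by rewrite h mulr0 (norm2_eq0 h) dot0r.
have un : 0 < norm2 u by rewrite lt_def u0 norm2_ge0.
have vn : 0 < norm2 v by rewrite lt_def v0 norm2_ge0.
have := dot_ge0 (norm2 v *: u - norm2 u *: v).
rewrite !dotE_lin -!norm2_sq (dotC v u) => h.
have : 0 <= 2 * (norm2 u * norm2 v) * (norm2 u * norm2 v - dot u v) by nra.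
by rewrite pmulr_rge0 ?subr_ge0 // !mulr_gt0.
Qed.

Lemma cauchy_schwarzN d (u v : 'cV[R]_d) : - (norm2 u * norm2 v) <= dot u v.
Proof. by have := cauchy_schwarz (- u) v; rewrite dotNl norm2N; lra. Qed.

Lemma norm2D_sq d (u v : 'cV[R]_d) :
  norm2 (u + v) ^+ 2 = norm2 u ^+ 2 + 2 * dot u v + norm2 v ^+ 2.
Proof. by rewrite !norm2_sq !dotE_lin (dotC v u); ring. Qed.

Lemma norm2_triangle d (u v : 'cV[R]_d) : norm2 (u + v) <= norm2 u + norm2 v.
Proof.
rewrite -(@ler_pXn2r _ 2) ?nnegrE ?addr_ge0 //.
rewrite sqrrD !norm2_sq !dotE_lin (dotC v u).
by have := cauchy_schwarz u v; rewrite -!norm2_sq mulr2n; lra.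
Qed.

Lemma norm2B_le d (u v : 'cV[R]_d) : norm2 (u - v) <= norm2 u + norm2 v.
Proof. by rewrite (le_trans (norm2_triangle _ _)) // norm2N. Qed.

Lemma norm2_leB d (u v : 'cV[R]_d) : norm2 u - norm2 v <= norm2 (u - v).
Proof. by have := norm2_triangle (u - v) v; rewrite subrK; lra. Qed.

Lemma norm2_sum d I (s : seq I) (P : pred I) (F : I -> 'cV[R]_d) :
  norm2 (\sum_(i <- s | P i) F i) <= \sum_(i <- s | P i) norm2 (F i).
Proof.
elim/big_rec2: _ => [|i a b _ h]; first by rewrite norm20.
by rewrite (le_trans (norm2_triangle _ _)) // lerD2l.
Qed.

Lemma norm2_le_dot d (u : 'cV[R]_d) (K : R) : 0 <= K ->
  (forall w, norm2 w = 1 -> dot w u <= K) -> norm2 u <= K.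
Proof.
move=> K0 h; have [->//|u0] := eqVneq (norm2 u) 0.
have un : 0 < norm2 u by rewrite lt_def u0 norm2_ge0.
have := h ((norm2 u)^-1 *: u).
rewrite norm2Z ger0_norm ?invr_ge0 // mulVf // dotZl -norm2_sq => /(_ erefl).
by rewrite expr2 mulrA mulVf // mul1r.
Qed.

(** Its only purpose is that the set defining opnorm is bounded, so that opnorm is
    a genuine supremum. *)
Lemma frobenius_bound p q (B : 'M[R]_(p, q)) (v : 'cV[R]_q) :
  norm2 (B *m v) <= (\sum_j norm2 (col j B)) * norm2 v.
Proof.
have -> : B *m v = \sum_j v j 0 *: col j B.
  apply/colP => i; rewrite mxE summxE; apply: eq_bigr => j _.
  by rewrite !mxE mulrC.
apply: (le_trans (norm2_sum _ _ _)); rewrite big_distrl /=.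
apply: ler_sum => j _; rewrite norm2Z mulrC ler_wpM2l //.
rewrite -(@ler_pXn2r _ 2) ?nnegrE // real_normK ?num_real // norm2_sq.
rewrite /dot (bigD1 j) //= -expr2 lerDl.
by apply: sumr_ge0 => k _; rewrite -expr2 sqr_ge0.
Qed.

Lemma opnorm_set_bounded p q (B : 'M[R]_(p, q)) :
  has_sup [set norm2 (B *m v) | v in [set v : 'cV[R]_q | norm2 v <= 1]].
Proof.
split; first by exists (norm2 (B *m 0)); exists 0 => //=; rewrite norm20.
exists (\sum_j norm2 (col j B)) => _ [v /= v1 <-].
apply: (le_trans (frobenius_bound _ _)); rewrite -[leRHS]mulr1.
by rewrite ler_wpM2l // sumr_ge0.
Qed.

Lemma opnorm_ge0 p q (B : 'M[R]_(p, q)) : 0 <= opnorm B.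
Proof.
apply: (@le_trans _ _ (norm2 (B *m 0))) => //.
apply: ub_le_sup; first by have [] := opnorm_set_bounded B.
by exists 0 => //=; rewrite norm20.
Qed.

Lemma opnormP p q (B : 'M[R]_(p, q)) (v : 'cV[R]_q) :
  norm2 (B *m v) <= opnorm B * norm2 v.
Proof.
have [h|v0] := eqVneq (norm2 v) 0.
  by rewrite (norm2_eq0 h) mulmx0 !norm20 mulr0.
have vn : 0 < norm2 v by rewrite lt_def v0 norm2_ge0.
rewrite -ler_pdivrMr // mulrC -[X in X * _]ger0_norm ?invr_ge0 // -norm2Z.
apply: ub_le_sup; first by have [] := opnorm_set_bounded B.
exists ((norm2 v)^-1 *: v); last by rewrite scalemxAr.
by rewrite /= norm2Z ger0_norm ?invr_ge0 // mulVf.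
Qed.

Lemma opnorm_le p q (B : 'M[R]_(p, q)) (K : R) (v : 'cV[R]_q) :
  opnorm B <= K -> norm2 (B *m v) <= K * norm2 v.
Proof. by move=> h; apply: (le_trans (opnormP _ _)); rewrite ler_wpM2r. Qed.

(** A matrix and its transpose have the same norm; duality through norm2_le_dot
    avoids singular values. *)
Lemma opnorm_tr_le p q (B : 'M[R]_(p, q)) (K : R) (v : 'cV[R]_p) :
  opnorm B <= K -> norm2 (B^T *m v) <= K * norm2 v.
Proof.
move=> h; have K0 : 0 <= K := le_trans (opnorm_ge0 _) h.
apply: norm2_le_dot => [|w w1]; first by rewrite mulr_ge0.
rewrite -dot_tr; apply: (le_trans (cauchy_schwarz _ _)).
by rewrite ler_wpM2r // (le_trans (opnorm_le _ h)) // w1 mulr1.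
Qed.

End Euclid.
#[global] Hint Resolve norm2_ge0 : core.

(** * Taylor bounds and extreme singular values *)

Section Calculus.
Variable R : realType.

Lemma derive_gradE n (f : 'cV[R]_n -> R) (x v : 'cV[R]_n) :
  differentiable f x -> 'D_v f x = dot (grad f x) v.
Proof.
move=> df; rewrite deriveE //.
have {1}-> : v = \sum_j v j 0 *: delta_mx j 0.
  apply/colP => i; rewrite summxE (bigD1 i) //= !mxE !eqxx mulr1 big1 ?addr0 //.
  by move=> j ji; rewrite !mxE eq_sym (negbTE ji) mulr0.
rewrite linear_sum; apply: eq_bigr => j _.
by rewrite linearZ /= mxE deriveE // mulrC.
Qed.

(** Restricting to a line turns directional derivatives into ordinary ones, for
    the mean value theorem. *)
Lemma is_derive_line n (f : 'cV[R]_n -> R) (x p : 'cV[R]_n) (t : R) :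
  differentiable f (x + t *: p) ->
  is_derive t (1 : R) (fun s : R => f (x + s *: p)) ('D_p f (x + t *: p)).
Proof.
move=> df.
have E : (fun h : R => h^-1 *: (f (x + (h *: (1 : R) + t) *: p) - f (x + t *: p)))
       = (fun h : R => h^-1 *: (f (h *: p + (x + t *: p)) - f (x + t *: p))).
  apply/funext => h; congr (_ *: (f _ - _)).
  by rewrite scalerDl addrCA /GRing.scale /= mulr1.
have dp : derivable f (x + t *: p) p by apply: diff_derivable.
apply: DeriveDef; last by rewrite /derive /= E.
by rewrite /derivable /= E.
Qed.

(** The mean value theorem for f (x + t p) - t f'(x; p) - K t^2 / 2, a function of
    t whose derivative is nonpositive. *)
Lemma taylor_line n (f : 'cV[R]_n -> R) (x p : 'cV[R]_n) (K : R) :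
  (forall y, differentiable f y) ->
  (forall t : R, 0 <= t <= 1 -> 'D_p f (x + t *: p) - 'D_p f x <= K * t) ->
  f (x + p) - f x - 'D_p f x <= K / 2.
Proof.
move=> df hK.
pose h (t : R) : R := f (x + t *: p) - t * 'D_p f x - K / 2 * t ^+ 2.
pose dh (t : R) : R := 'D_p f (x + t *: p) - 'D_p f x - K * t.
have dhP (t : R) : is_derive t (1 : R) h (dh t).
  have d1 := is_derive_line (df (x + t *: p)).
  have d2 : is_derive t (1 : R) (fun s : R => s * 'D_p f x) ('D_p f x).
    by apply: is_derive_eq; rewrite scaler0 add0r /GRing.scale /= mulr1.
  have d3 : is_derive t (1 : R) (fun s : R => K / 2 * s ^+ 2) (K * t).
    by apply: is_derive_eq; rewrite /GRing.scale /=; field.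
  by rewrite /h /dh; apply: is_deriveB.
have hcont : {within `[0, 1]%classic, continuous h}.
  by apply: derivable_within_continuous => t _; have [] := dhP t.
have [c] := MVT_segment ler01 (fun t _ => dhP t) hcont.
rewrite in_itv /= => c01; rewrite subr0 mulr1 => hc.
have : h 1 - h 0 <= 0 by rewrite hc /dh; have := hK c c01; lra.
by rewrite /h scale1r scale0r addr0 expr1n expr0n /=; lra.
Qed.

Lemma taylor_upper n (f : 'cV[R]_n -> R) (x p : 'cV[R]_n) (L : R) :
  (forall y, differentiable f y) ->
  (forall y z, norm2 (grad f y - grad f z) <= L * norm2 (y - z)) ->
  f (x + p) - f x - dot (grad f x) p <= L / 2 * norm2 p ^+ 2.
Proof.
move=> df hL; rewrite -derive_gradE // mulrAC.
apply: taylor_line => // t /andP[t0 t1].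
rewrite !derive_gradE // -dotBl.
apply: le_trans (cauchy_schwarz _ _) _.
have := hL (x + t *: p) x; rewrite addrAC subrr add0r norm2Z ger0_norm // => h.
have := norm2_ge0 p; have := norm2_ge0 (grad f (x + t *: p) - grad f x); nra.
Qed.

Lemma derive_dot_con n m (c : 'cV[R]_n -> 'cV[R]_m) (w : 'cV[R]_m) x v :
  differentiable c x ->
  differentiable (fun y => dot w (c y)) x /\
  'D_v (fun y => dot w (c y)) x = dot w (jac c x *m v).
Proof.
move=> dc.
have dci i : differentiable (fun y => c y i 0 : R^o) x.
  apply: (@differentiable_comp _ _ _ _ c (fun M : 'cV[R]_m => M i 0)) => //.
  exact: differentiable_coord.
have E : (fun y => dot w (c y)) = \sum_i (fun y => w i 0 *: (c y i 0 : R^o)).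
  by apply/funext => y; rewrite fct_sumE.
have dwi i : differentiable (fun y => w i 0 *: (c y i 0 : R^o)) x.
  by apply: differentiableZ.
rewrite E; split; first exact: differentiable_sum.
rewrite derive_sum => [|i]; last exact/diff_derivable.
apply: eq_bigr => i _; rewrite deriveZ; last exact/diff_derivable.
congr (_ * _); rewrite derive_gradE // mxE; apply: eq_bigr => j _.
by rewrite !mxE.
Qed.

(** Reduced to the scalar case by testing the remainder against unit vectors. *)
Lemma taylor_con n m (c : 'cV[R]_n -> 'cV[R]_m) (x p : 'cV[R]_n) (L : R) :
  (forall y, differentiable c y) ->
  (forall y z, opnorm (jac c y - jac c z) <= L * norm2 (y - z)) -> 0 <= L ->
  norm2 (c (x + p) - c x - jac c x *m p) <= L / 2 * norm2 p ^+ 2.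
Proof.
move=> dc hL L0; apply: norm2_le_dot => [|w w1].
  by rewrite mulr_ge0 ?sqr_ge0 // divr_ge0.
pose F y := dot w (c y).
have dF y : differentiable F y := (derive_dot_con w (0 : 'cV_n) (dc y)).1.
have DF y : 'D_p F y = dot w (jac c y *m p) := (derive_dot_con w p (dc y)).2.
rewrite !dotBr -/(F _) -/(F _) -DF mulrAC.
apply: taylor_line => // t /andP[t0 t1]; rewrite !DF -dotBr -mulmxBl.
apply: le_trans (cauchy_schwarz _ _) _; rewrite w1 mul1r.
have := opnorm_le p (hL (x + t *: p) x).
rewrite addrAC subrr add0r norm2Z ger0_norm //; lra.
Qed.

End Calculus.

Section Rayleigh.
Variable R : realType.

Lemma continuous_bigsum (T : topologicalType) (I : finType) (F : I -> T -> R) :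
  (forall i, continuous (F i)) -> continuous (fun v => \sum_i F i v).
Proof.
move=> cF; rewrite (_ : (fun v => _) = \sum_i F i).
  by elim/big_ind: _ => // [v|f g cf cg v]; [exact: cvg_cst | apply: cvgD; [exact: cf | exact: cg]].
by apply/funext => v; rewrite fct_sumE.
Qed.

(** A minimizer w of the Rayleigh quotient exists by compactness of the sphere.
    The residual r = S w - l w vanishes because moving from w to w - s r would
    otherwise lower the quotient to first order in s. *)
Lemma rayleigh_min m (S : 'M[R]_m.+1) : S^T = S ->
  exists (w : 'cV[R]_m.+1) (l : R), [/\ norm2 w = 1, S *m w = l *: w &
    forall u, l * dot u u <= dot u (S *m u)].
Proof.
move=> Ssym.
pose A : set 'rV[R]_m.+1 := [set v | dot v^T v^T = 1].
pose F (v : 'rV[R]_m.+1) : R := dot v^T (S *m v^T).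
have cont_dot (g h : 'rV[R]_m.+1 -> 'cV[R]_m.+1) :
    (forall i, continuous (fun v => g v i 0)) ->
    (forall i, continuous (fun v => h v i 0)) ->
    continuous (fun v => dot (g v) (h v)).
  move=> cg ch; apply: continuous_bigsum => i v.
  exact: (cvgM (cg i v) (ch i v)).
have cT (i : 'I_m.+1) : continuous (fun v : 'rV[R]_m.+1 => v^T i 0).
  rewrite (_ : (fun v : 'rV[R]_m.+1 => v^T i 0) = (fun v => v 0 i)).
    exact: coord_continuous.
  by apply/funext => v; rewrite mxE.
have cS (i : 'I_m.+1) : continuous (fun v : 'rV[R]_m.+1 => (S *m v^T) i 0).
  rewrite (_ : (fun v : 'rV[R]_m.+1 => _) =
     (fun v => \sum_j S i j * v^T j 0)); last by apply/funext=> v; rewrite mxE.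
  apply: continuous_bigsum => j v.
  exact: (cvgM (cvg_cst _) (cT j v)).
have A0 : A !=set0.
  exists (delta_mx 0 0); rewrite /A /= /dot (bigD1 0) //= !mxE !eqxx mulr1.
  rewrite big1 ?addr0 // => i i0; rewrite !mxE (negbTE i0) andbF mulr0 //.
have Acl : closed A.
  have -> : A = (fun v => dot v^T v^T) @^-1` [set 1] by [].
  by apply: closed_comp; [move=> v _; exact: cont_dot | exact: closed_eq].
have Abd : bounded_set A.
  exists 1; split; first exact: num_real.
  move=> M M1 v; rewrite /A /= => v1; apply: (le_trans _ (ltW M1)).
  rewrite [leLHS]/Num.norm /= mx_normrE; apply/bigmax_leP; split => //= i _.
  rewrite (ord1 i.1) -(@ler_pXn2r _ 2) ?nnegrE // expr1n -v1 real_normK ?num_real //.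
  rewrite /dot (bigD1 i.2) //= !mxE -expr2 lerDl.
  by apply: sumr_ge0 => k _; rewrite -expr2 sqr_ge0.
have Aco := bounded_closed_compact Abd Acl.
have [|v /set_mem vA vmin] := EVT_min_rV A0 Aco (f := F).
  by apply: continuous_subspaceT; exact: cont_dot.
pose w := v^T; pose l := F v.
have w1 : dot w w = 1 by [].
have minP u : l * dot u u <= dot u (S *m u).
  have [h|u0] := eqVneq (dot u u) 0.
    by rewrite h mulr0 (dot_eq0 h) mulmx0 dot0l.
  have up : 0 < norm2 u.
    by rewrite lt_def norm2_ge0 andbT -sqrf_eq0 norm2_sq.
  have hA : A ((norm2 u)^-1 *: u)^T.
    by rewrite /A /= trmxK dotZl dotZr -norm2_sq; field; rewrite gt_eqF.
  have := vmin _ (mem_set hA).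
  rewrite -/l /F trmxK -scalemxAr dotZl dotZr mulrA -invfM -expr2 => h.
  have := ler_wpM2r (sqr_ge0 (norm2 u)) h.
  by rewrite -norm2_sq mulrAC mulVf ?mul1r // expf_neq0 // gt_eqF.
exists w, l; split => //.
  have := norm2_sq w; rewrite w1 => /eqP; rewrite sqrf_eq1 => /orP[/eqP //|/eqP].
  by have := norm2_ge0 w; lra.
have [r rE] : exists r, r = S *m w - l *: w by eexists.
apply/eqP; rewrite -subr_eq0; apply/eqP; apply: dot_eq0; rewrite -rE.
have Sw (z : 'cV[R]_m.+1) : dot w (S *m z) = dot z (S *m w).
  by rewrite dotC dot_tr Ssym.
have key (s : R) : 0 < s -> 2 * dot r r <= s * (dot r (S *m r) - l * dot r r).
  move=> s0.
  have := minP (w - s *: r).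
  rewrite mulmxBr -scalemxAr !dotE_lin (Sw r) (_ : dot w (S *m w) = l) // w1 (dotC w r).
  have -> : dot r (S *m w) = dot r r + l * dot r w.
    by rewrite -dotZr -dotDr rE subrK.
  move=> h.
  have : 0 <= s * (s * (dot r (S *m r) - l * dot r r) - 2 * dot r r) by lra.
  by rewrite pmulr_rge0 // subr_ge0.
apply/eqP; rewrite eq_le dot_ge0 andbT.
apply/ler_addgt0Pr => e e0; rewrite add0r.
set K := dot r (S *m r) - l * dot r r in key.
have K1 : 0 < `|K| + 1 by rewrite ltr_wpDl.
have := key (e / (`|K| + 1)) (divr_gt0 e0 K1).
have : e / (`|K| + 1) * K <= e.
  rewrite mulrAC ler_pdivrMr //; have := ler_norm K; nra.
have := dot_ge0 r; lra.
Qed.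

(** The least eigenvalue of B B^T is attained, by rayleigh_min, hence it is the
    square of a singular value. *)
Lemma singular_value_lower m n (B : 'M[R]_(m, n)) (s : R) :
  0 <= s -> (forall t, singular_value B t -> s <= t) ->
  forall w, s * norm2 w <= norm2 (B^T *m w).
Proof.
case: m B => [|m] B s0 hB w.
  have -> : w = 0 by rewrite [w]flatmx0.
  by rewrite norm20 mulr0 norm2_ge0.
have [|v [l [v1 Sv lmin]]] := rayleigh_min (S := B *m B^T).
  by rewrite trmx_mul trmxK.
have lE : l = norm2 (B^T *m v) ^+ 2.
  by rewrite norm2_sq dot_tr trmxK mulmxA Sv dotZr -norm2_sq v1 expr1n mulr1.
have ev : eigenvalue (B *m B^T) (l).
  apply/eigenvalueP; exists v^T.
    have Ssym : (B *m B^T)^T = B *m B^T by rewrite trmx_mul trmxK.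
    by rewrite -Ssym -trmx_mul Sv linearZ.
  apply: contra_eq_neq v1 => /(congr1 trmx); rewrite trmxK trmx0 => ->.
  by rewrite norm20 eq_sym oner_neq0.
have := hB (norm2 (B^T *m v)); rewrite /singular_value norm2_ge0 -lE.
move=> /(_ (conj isT ev)) h.
have sl : s ^+ 2 <= l by rewrite lE lerXn2r ?nnegrE ?norm2_ge0.
rewrite -(@ler_pXn2r _ 2) ?nnegrE ?mulr_ge0 ?norm2_ge0 // exprMn !norm2_sq.
apply: le_trans (ler_wpM2r (dot_ge0 w) sl) _.
apply: le_trans (lmin w) _.
by rewrite -mulmxA dotC dot_tr.
Qed.

Lemma singular_value_upper m n (B : 'M[R]_(m, n)) (s : R) :
  0 <= s -> (forall t, singular_value B t -> t <= s) ->
  forall w, norm2 (B^T *m w) <= s * norm2 w.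
Proof.
case: m B => [|m] B s0 hB w.
  have -> : w = 0 by rewrite [w]flatmx0.
  by rewrite mulmx0 !norm20 mulr0.
have [|v [l [v1 Sv lmin]]] := rayleigh_min (S := - (B *m B^T)).
  by rewrite linearN /= trmx_mul trmxK.
have Sv' : B *m B^T *m v = - l *: v by rewrite scaleNr -Sv mulNmx opprK.
have lE : - l = norm2 (B^T *m v) ^+ 2.
  by rewrite norm2_sq dot_tr trmxK mulmxA Sv' dotZr -norm2_sq v1 expr1n mulr1.
have ev : eigenvalue (B *m B^T) (- l).
  apply/eigenvalueP; exists v^T.
    have Ssym : (B *m B^T)^T = B *m B^T by rewrite trmx_mul trmxK.
    by rewrite -Ssym -trmx_mul Sv' linearZ.
  apply: contra_eq_neq v1 => /(congr1 trmx); rewrite trmxK trmx0 => ->.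
  by rewrite norm20 eq_sym oner_neq0.
have := hB (norm2 (B^T *m v)); rewrite /singular_value norm2_ge0 -lE.
move=> /(_ (conj isT ev)) h.
have sl : - l <= s ^+ 2 by rewrite lE lerXn2r ?nnegrE ?norm2_ge0.
rewrite -(@ler_pXn2r _ 2) ?nnegrE ?mulr_ge0 ?norm2_ge0 // exprMn !norm2_sq.
apply: le_trans _ (ler_wpM2r (dot_ge0 w) sl).
have := lmin w; rewrite mulNmx dotNr -mulmxA dot_tr trmxK; lra.
Qed.

End Rayleigh.

(** * The normal step and the acceptance test *)

Section NormalStep.
Variables (R : realType) (n m : nat) (At : 'M[R]_(m, n)) (ct : 'cV[R]_m).
Variables (D : R) (v : 'cV[R]_n).
Hypothesis Hv : is_normal_step At ct D v.
Let D0 : 0 <= D. Proof. by case: Hv => h _ _; apply: le_trans h; apply: norm2_ge0. Qed.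

Lemma normal_decrease_ge0 : norm2 (At *m v + ct) <= norm2 ct.
Proof.
case: Hv => _ _ /(_ 0); rewrite norm20 mulmx0 add0r; exact.
Qed.

(** The decrease is at least that of the Cauchy point - (T / h) At^T ct, whose
    model value follows from the curvature bound s; the squared decrease is turned
    into a decrease of norms. *)
Lemma normal_cauchy_decrease (s T : R) : 0 <= s ->
  (forall u, norm2 (At *m u) <= s * norm2 u) ->
  0 <= T <= D -> s ^+ 2 * T <= norm2 (At^T *m ct) ->
  norm2 (At^T *m ct) * T
    <= 2 * norm2 ct * (norm2 ct - norm2 (At *m v + ct)).
Proof.
move=> s0 hs /andP[T0 TD] hT; set h := norm2 (At^T *m ct) in hT *.
have N := normal_decrease_ge0.
have X0 := norm2_ge0 ct; have N0 := norm2_ge0 (At *m v + ct).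
have h0 : 0 <= h := norm2_ge0 _.
have [hz|hnz] := eqVneq h 0.
  by rewrite hz mul0r mulr_ge0 ?subr_ge0 // mulr_ge0.
have hp : 0 < h by rewrite lt_def hnz h0.
pose u := - (T / h) *: (At^T *m ct).
have nu' : norm2 u = T.
  by rewrite norm2Z normrN ger0_norm ?divr_ge0 // -/h divfK.
case: Hv => _ _ /(_ u); rewrite nu' => /(_ TD) hu.
have au : norm2 (At *m u) <= s * T by rewrite -nu'; exact: hs.
have e1 : norm2 (At *m u + ct) ^+ 2 <= norm2 ct ^+ 2 - T * h.
  rewrite norm2_sq !dotE_lin -!norm2_sq (dotC ct).
  have -> : dot (At *m u) ct = - (T * h).
    by rewrite dot_tr /u dotZl -norm2_sq -/h; field.
  have := norm2_ge0 (At *m u); nra.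
nra.
Qed.

(** First-order optimality of a minimizer over a ball: the directional derivative
    towards any competitor is nonnegative. *)
Lemma normal_variational (u : 'cV[R]_n) : norm2 u <= D ->
  dot (At *m v + ct) (At *m v - At *m u) <= 0.
Proof.
move=> uD; case: Hv => vD _ vmin.
have [a0 a0E] : exists a0, a0 = At *m v + ct by eexists.
have [b0 b0E] : exists b0, b0 = At *m (u - v) by eexists.
rewrite -a0E.
have key (t : R) : 0 < t <= 1 -> 0 <= 2 * dot a0 b0 + t * dot b0 b0.
  move=> /andP[t0 t1].
  have := vmin (v + t *: (u - v)); rewrite -a0E.
  have -> : v + t *: (u - v) = (1 - t) *: v + t *: u.
    by rewrite scalerBr scalerBl scale1r addrA addrAC.
  have le1 : norm2 ((1 - t) *: v + t *: u) <= D.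
    apply: le_trans (norm2_triangle _ _) _; rewrite !norm2Z !ger0_norm ?subr_ge0 ?(ltW t0) //.
    have := norm2_ge0 u; have := norm2_ge0 v; nra.
  move=> /(_ le1).
  have -> : At *m ((1 - t) *: v + t *: u) + ct = a0 + t *: b0.
    rewrite a0E b0E mulmxDr -!scalemxAr mulmxBr scalerBr scalerBl scale1r.
    by move: (At *m v) (At *m u) => X Y; apply/colP => i; rewrite !mxE; ring.
  rewrite -(@ler_pXn2r _ 2) ?nnegrE ?norm2_ge0 // !norm2_sq !dotE_lin (dotC b0 a0) => h.
  have : 0 <= t * (2 * dot a0 b0 + t * dot b0 b0) by lra.
  by rewrite pmulr_rge0.
have -> : At *m v - At *m u = - b0 by rewrite b0E mulmxBr opprB.
rewrite dotNr oppr_le0.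
have bb := dot_ge0 b0.
rewrite -(pmulr_rge0 _ (ltr0Sn R 1)).
apply/ler_addgt0Pr => e e0.
pose t := Num.min 1 (e / (dot b0 b0 + 1)).
have t0 : 0 < t by rewrite lt_min ltr01 divr_gt0 // ltr_wpDl.
have tb : t * dot b0 b0 <= e.
  apply: (@le_trans _ _ (e / (dot b0 b0 + 1) * dot b0 b0)).
    by rewrite ler_wpM2r // ge_min lexx orbT.
  by rewrite mulrAC ler_pdivrMr ?ltr_wpDl //; nra.
have := key t; rewrite t0 ge_min lexx => /(_ isT); lra.
Qed.

End NormalStep.

(** The second bound is what makes noise harmless away from feasibility. It
    follows from expanding |ct|^2 - |c|^2 and |ct + w|^2 - |c + w|^2, whose
    difference is linear in w. *)
Lemma norm_change_noise (R : realType) (m : nat) (c ct w : 'cV[R]_m) :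
  (norm2 ct - norm2 (ct + w) - (norm2 c - norm2 (c + w)) <= 2 * norm2 (ct - c))
  /\ (norm2 ct - norm2 (ct + w) - (norm2 c - norm2 (c + w))) * (norm2 c + norm2 ct)
     <= 4 * norm2 (ct - c) * norm2 w.
Proof.
have d0 := norm2_ge0 (ct - c).
have E : ct + w - (c + w) = ct - c by rewrite opprD addrACA subrr addr0.
have h1 := norm2_leB ct c; have h2 := norm2_leB (c + w) (ct + w).
rewrite norm2BC E in h2.
split; first lra.
set X := norm2 c; set Y := norm2 ct; set X' := norm2 (c + w); set Y' := norm2 (ct + w).
set d := norm2 (ct - c).
have [X0 Y0 X'0 Y'0] : [/\ 0 <= X, 0 <= Y, 0 <= X' & 0 <= Y'] by rewrite !norm2_ge0.
have q1 : Y ^+ 2 - X ^+ 2 = dot (ct - c) (ct + c).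
  rewrite !norm2_sq !dotE_lin (dotC ct c); ring.
have q2 : Y' ^+ 2 - X' ^+ 2 = dot (ct - c) (ct + c) + 2 * dot (ct - c) w.
  rewrite !norm2_sq !dotE_lin (dotC ct c) (dotC w ct) (dotC w c); ring.
have cs := cauchy_schwarzN (ct - c) w; rewrite -/d in cs.
have t1 := norm2_triangle c w; rewrite -/X -/X' in t1.
have t2 := norm2_triangle ct w; rewrite -/Y -/Y' in t2.
have h2' : X' - Y' <= d by [].
have h2'' : Y' - X' <= d by have := norm2_leB (ct + w) (c + w); rewrite E.
have w0 := norm2_ge0 w.
(* (Y - X)(X + Y) - (Y' - X')(X' + Y') = - 2 (ct - c).w *)
have key : (Y - X) * (X + Y) - (Y' - X') * (X' + Y') <= 2 * d * norm2 w by nra.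
have [le0|gt0] := leP 0 (Y' - X').
  have : (Y' - X') * ((X' + Y') - (X + Y)) <= d * (2 * norm2 w).
    apply: (@le_trans _ _ ((Y' - X') * (2 * norm2 w))); first by rewrite ler_wpM2l //; lra.
    by rewrite ler_wpM2r // mulr_ge0.
  by nra.
have t3 : X <= X' + norm2 w.
  by have := norm2_leB c (- w); rewrite opprK norm2N -/X -/X'; lra.
have t4 : Y <= Y' + norm2 w.
  by have := norm2_leB ct (- w); rewrite opprK norm2N -/Y -/Y'; lra.
have : (X' - Y') * ((X + Y) - (X' + Y')) <= d * (2 * norm2 w).
  apply: (@le_trans _ _ ((X' - Y') * (2 * norm2 w))); first by rewrite ler_wpM2l //; lra.
  by rewrite ler_wpM2r // mulr_ge0.
by nra.
Qed.

(** The hypotheses shared by all four parts, bundled so that each lemma about a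
    run takes one premise. *)
Record standing (R : realType) (n m : nat) (P : noisy_problem R n m)
    (a : parameters R) (r : run R n m) (b : constants R) : Prop := Standing {
  std_parameters : valid_parameters a;
  std_generated : generated P a r;
  std_Mc : 0 < Mc b;
  std_M : 0 < Mbig r b;
  std_smooth : smoothness P b;
  std_bounds : iterate_bounds P r b;
  std_noise : noise_bounds P a b }.

Section Run.
Variables (R : realType) (n m : nat).
Variables (P : noisy_problem R n m) (a : parameters R) (r : run R n m).
Variable (b : constants R).
Hypothesis S : standing P a r b.

Let Ha := std_parameters S.
Let Hr := std_generated S.
Let H1 := std_smooth S.
Let H2 := std_bounds S.
Let H3 := std_noise S.

Local Notation x k := (iterate r k).
Local Notation p k := (step r k).
Local Notation v k := (nstep r k).
Local Notation D k := (Defs.radius r k).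
Local Notation W k := (hess r k).
Local Notation At k := (At_ P r k).
Local Notation ct k := (ct_ P r k).
Local Notation gt k := (gt_ P r k).
Local Notation cc k := (con P (iterate r k)).
Local Notation pred k := (pred_at P r k (nu r k)).

Lemma pi0_bounds : 0 < pi0 a < 1. Proof. by case: Ha. Qed.
Lemma pi1_bounds : 0 < pi1 a < 1. Proof. by case: Ha. Qed.
Lemma zeta_bounds : 0 < zeta a < 1. Proof. by case: Ha. Qed.
Lemma tau_gt1 : 1 < tau a. Proof. by case: Ha. Qed.

Lemma xiE : xi a * (1 - pi0 a) = 2.
Proof. by rewrite /xi divfK // subr_eq0 gt_eqF //; case/andP: pi0_bounds. Qed.

Lemma xi_gt2 : 2 < xi a.
Proof. by have := xiE; case/andP: pi0_bounds; nra. Qed.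

Lemma run_step k :
  [/\ (W k)^T = W k,
      is_normal_step (At k) (ct k) (zeta a * D k) (v k),
      is_full_step (At k) (ct k) (gt k) (W k) (v k) (D k) (p k),
      merit_update P a r k & iterate_update P a r k].
Proof. by case: Hr => _ _ /(_ k). Qed.

Lemma nu_prev_le k : 0 < nu_prev r k -> nu_prev r k <= nu r k.
Proof.
have [_ _ _ [j [-> _ _]] _] := run_step k; move=> n0.
by rewrite ler_peMr ?(ltW n0) // exprn_ege1 // ltW // tau_gt1.
Qed.

Lemma nu_prev_gt0 k : 0 < nu_prev r k.
Proof.
elim: k => [|k IH] /=; first by case: Hr.
exact: lt_le_trans IH (nu_prev_le IH).
Qed.

Lemma nu_gt0 k : 0 < nu r k. Proof. exact: (nu_prev_gt0 k.+1). Qed.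
#[local] Hint Resolve nu_gt0 : core.
Lemma nu_ge0 k : 0 <= nu r k. Proof. exact: ltW. Qed.
#[local] Hint Resolve nu_ge0 : core.

Lemma nu_mono i j : (i <= j)%N -> nu r i <= nu r j.
Proof.
elim: j => [|j IH]; first by rewrite leqn0 => /eqP ->.
rewrite leq_eqVlt => /orP[/eqP -> //|]; rewrite ltnS => /IH h.
exact: le_trans h (nu_prev_le (nu_prev_gt0 j.+1)).
Qed.

Definition accepted k := pi0 a < rho P a r k.

Lemma acceptedP k : accepted k -> x k.+1 = x k + p k /\ D k.+1 = tau a * D k.
Proof.
by have [_ _ _ _] := run_step k; rewrite /iterate_update /accepted => /[swap] ->.
Qed.

Lemma rejectedP k : ~~ accepted k -> x k.+1 = x k /\ D k.+1 = D k / tau a.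
Proof.
have [_ _ _ _] := run_step k; rewrite /iterate_update /accepted => /[swap].
by move/negbTE ->.
Qed.

Lemma radius_gt0 k : 0 < D k.
Proof.
have t0 : 0 < tau a := lt_trans ltr01 tau_gt1.
elim: k => [|k IH]; first by case: Hr.
have [/acceptedP [_ ->]|/rejectedP [_ ->]] := boolP (accepted k).
  exact: mulr_gt0.
exact: divr_gt0.
Qed.
#[local] Hint Resolve radius_gt0 : core.
Lemma radius_ge0 k : 0 <= D k. Proof. exact: ltW. Qed.
#[local] Hint Resolve radius_ge0 : core.

Lemma step_le_radius k : norm2 (p k) <= D k.
Proof. by have [_ _ [_ h _] _ _] := run_step k. Qed.

Lemma At_step k : At k *m p k = At k *m v k.
Proof. by have [_ _ [h _ _] _ _] := run_step k; apply: (addIr (ct k)). Qed.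

(** The full step has the same linearized constraint value as the normal step. *)
Lemma vpredE k : vpred P r k = norm2 (ct k) - norm2 (At k *m v k + ct k).
Proof. by rewrite /vpred At_step. Qed.

Lemma vpred_ge0 k : 0 <= vpred P r k.
Proof.
rewrite vpredE subr_ge0; have [_ h _ _ _] := run_step k.
exact: normal_decrease_ge0 h.
Qed.

Lemma pred_gt k : pi1 a * nu r k * vpred P r k < pred k.
Proof. by have [_ _ _ [j []]] := run_step k. Qed.

Lemma pred_gt0 k : 0 < pred k.
Proof.
apply: le_lt_trans (pred_gt k); rewrite !mulr_ge0 ?vpred_ge0 //.
by case/andP: pi1_bounds => /ltW.
Qed.

Lemma MA_ge0 : 0 <= MA b.
Proof. by have [h _ _ _] := H2 0; apply: le_trans (opnorm_ge0 _) h. Qed.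
Lemma MW_ge0 : 0 <= MW b.
Proof. by have [_ h _ _] := H2 0; apply: le_trans (opnorm_ge0 _) h. Qed.
Lemma Lf_ge0 : 0 <= Lf b. Proof. by case: H1. Qed.
Lemma Lc_ge0 : 0 <= Lc b. Proof. by case: H1. Qed.
Lemma epsf_ge0 : 0 <= epsf a.
Proof. by have [h _ _ _] := H3 0; apply: le_trans (normr_ge0 _) h. Qed.
Lemma epsc_ge0 : 0 <= epsc a.
Proof. by have [_ h _ _] := H3 0; apply: le_trans (norm2_ge0 _) h. Qed.
Lemma epsg_ge0 : 0 <= epsg b.
Proof. by have [_ _ h _] := H3 0; apply: le_trans (norm2_ge0 _) h. Qed.
Lemma epsA_ge0 : 0 <= epsA b.
Proof. by have [_ _ _ h] := H3 0; apply: le_trans (opnorm_ge0 _) h. Qed.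

Lemma At_le k u : norm2 (At k *m u) <= MA b * norm2 u.
Proof. by have [h _ _ _] := H2 k; exact: opnorm_le. Qed.
Lemma AtT_le k u : norm2 ((At k)^T *m u) <= MA b * norm2 u.
Proof. by have [h _ _ _] := H2 k; exact: opnorm_tr_le. Qed.
Lemma W_le k u : norm2 (W k *m u) <= MW b * norm2 u.
Proof. by have [_ h _ _] := H2 k; exact: opnorm_le. Qed.
Lemma ct_le k : norm2 (ct k) <= Mc b.
Proof. by have [_ _ h _] := H2 k. Qed.
Lemma ft_gt0 k : 0 < ft_ P r k.
Proof. by have [_ _ _ h] := H2 k. Qed.
Lemma ct_noise k : norm2 (ct k - cc k) <= epsc a.
Proof.
by have [_ h _ _] := H3 (x k); rewrite /ct_ /ctilde addrAC subrr add0r.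
Qed.
Lemma deltaA_le y u : norm2 (deltaA P y *m u) <= epsA b * norm2 u.
Proof. by have [_ _ _ h] := H3 y; exact: opnorm_le. Qed.
Lemma deltaAT_le y u : norm2 ((deltaA P y)^T *m u) <= epsA b * norm2 u.
Proof. by have [_ _ _ h] := H3 y; exact: opnorm_tr_le. Qed.

Lemma f_taylor y s : obj P (y + s) - obj P y - dot (g P y) s <= Lf b / 2 * norm2 s ^+ 2.
Proof. by case: H1 => _ _ [df lf] _; exact: taylor_upper. Qed.

Lemma c_taylor y s : norm2 (con P (y + s) - con P y - A P y *m s) <= Lc b / 2 * norm2 s ^+ 2.
Proof. by case: H1 => _ ? _ [df lf]; exact: taylor_con. Qed.

Lemma c_step_error k :
  norm2 (con P (x k + p k) - cc k - At k *m p k)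
    <= Lc b / 2 * norm2 (p k) ^+ 2 + epsA b * norm2 (p k).
Proof.
have -> : con P (x k + p k) - cc k - At k *m p k
  = (con P (x k + p k) - cc k - A P (x k) *m p k) - deltaA P (x k) *m p k.
  by rewrite /At_ /Atilde mulmxDl opprD addrA.
by apply: le_trans (norm2B_le _ _) _; rewrite lerD ?c_taylor ?deltaA_le.
Qed.

Lemma gt_split k : gt k = g P (x k) + deltag P (x k).
Proof. by []. Qed.

Lemma qmodelE k u :
  qmodel (gt k) (W k) u = dot (gt k) u + 2^-1 * dot u (W k *m u).
Proof. by rewrite /qmodel !dotE mulmxA. Qed.

Lemma f_step_error k :
  obj P (x k + p k) - obj P (x k) - qmodel (gt k) (W k) (p k)
    <= (Lf b + MW b) / 2 * norm2 (p k) ^+ 2 + epsg b * norm2 (p k).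
Proof.
have h1 := f_taylor (x k) (p k).
have h2 := cauchy_schwarzN (deltag P (x k)) (p k).
have h3 := cauchy_schwarzN (p k) (W k *m p k).
have h4 := W_le k (p k).
have [_ _ h5 _] := H3 (x k).
rewrite qmodelE gt_split dotDl.
have s0 := norm2_ge0 (p k).
have : norm2 (deltag P (x k)) * norm2 (p k) <= epsg b * norm2 (p k) by rewrite ler_wpM2r.
have : norm2 (p k) * norm2 (W k *m p k) <= MW b * norm2 (p k) ^+ 2.
  by rewrite expr2 mulrA (mulrC (MW b)) -mulrA ler_wpM2l.
lra.
Qed.

(** Bound for the error of the quadratic model of the merit function over a step
    of length at most the radius. *)
Definition model_gap k : R :=
  (Lf b + MW b + nu r k * Lc b) / 2 * D k ^+ 2 + (epsg b + nu r k * epsA b) * D k.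

Lemma gap_le_model k :
  (Lf b + MW b) / 2 * norm2 (p k) ^+ 2 + epsg b * norm2 (p k)
  + nu r k * (Lc b / 2 * norm2 (p k) ^+ 2 + epsA b * norm2 (p k)) <= model_gap k.
Proof.
have s0 := norm2_ge0 (p k); have sD := step_le_radius k.
have s2 : norm2 (p k) ^+ 2 <= D k ^+ 2 by rewrite ler_pXn2r ?nnegrE.
have n0 := nu_ge0 k.
have c1 : 0 <= (Lf b + MW b + nu r k * Lc b) / 2.
  by rewrite divr_ge0 ?addr_ge0 ?mulr_ge0 ?Lf_ge0 ?MW_ge0 ?Lc_ge0.
have c2 : 0 <= epsg b + nu r k * epsA b.
  by rewrite addr_ge0 ?mulr_ge0 ?epsg_ge0 ?epsA_ge0.
have := ler_wpM2l c1 s2; have := ler_wpM2l c2 sD.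
rewrite /model_gap; lra.
Qed.

(** How much noise makes the predicted decrease of constraint norm exceed the
    decrease for the noiseless constraint value. *)
Definition brace k : R :=
  vpred P r k - (norm2 (cc k) - norm2 (cc k + At k *m p k)).

Lemma brace_le2 k : brace k <= 2 * epsc a.
Proof.
have [h _] := norm_change_noise (cc k) (ct k) (At k *m p k).
rewrite /brace /vpred [At k *m _ + _]addrC; apply: le_trans h _.
by have := ct_noise k; rewrite /ct_; lra.
Qed.

Lemma brace_le4 k : brace k * (norm2 (cc k) + norm2 (ct k))
  <= 4 * epsc a * norm2 (At k *m p k).
Proof.
have [_ h] := norm_change_noise (cc k) (ct k) (At k *m p k).
rewrite /brace /vpred [At k *m _ + _]addrC; apply: le_trans h _.
apply: ler_wpM2r; first exact: norm2_ge0.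
by have := ct_noise k; lra.
Qed.

(** A bound for the noiseless merit function in which the noise in f and c enters
    only through brace; in ared_ge, for the noisy one, it costs twice the noise
    level. *)
Lemma phi_step k :
  phi P (x k + p k) (nu r k)
    <= phi P (x k) (nu r k) - pred k + model_gap k + nu r k * brace k.
Proof.
have h1 := f_step_error k; have h2 := c_step_error k; have h3 := gap_le_model k.
have h4 : norm2 (con P (x k + p k)) <= norm2 (cc k + At k *m p k)
   + (Lc b / 2 * norm2 (p k) ^+ 2 + epsA b * norm2 (p k)).
  have := norm2_leB (con P (x k + p k)) (cc k + At k *m p k).
  by rewrite opprD addrA; lra.
have n0 := nu_ge0 k; have := ler_wpM2l n0 h4.
rewrite /phi /brace /pred_at; lra.
Qed.

Lemma f_noise y : `|ftilde P y - obj P y| <= epsf a.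
Proof. by rewrite /ftilde addrAC subrr add0r; have [] := H3 y. Qed.

Lemma c_noise y : norm2 (ctilde P y - con P y) <= epsc a.
Proof. by rewrite /ctilde addrAC subrr add0r; have [] := H3 y. Qed.

Lemma phitilde_close y w : 0 <= w ->
  `|phitilde P y w - phi P y w| <= epsf a + w * epsc a.
Proof.
move=> w0; have := f_noise y; have := c_noise y.
have h1 := norm2_leB (ctilde P y) (con P y).
have h2 := norm2_leB (con P y) (ctilde P y).
rewrite norm2BC in h2 => hc; rewrite !ler_norml => /andP[f1 f2].
have e1 : w * (norm2 (ctilde P y) - norm2 (con P y)) <= w * epsc a.
  by rewrite ler_wpM2l // (le_trans h1).
have e2 : w * (norm2 (con P y) - norm2 (ctilde P y)) <= w * epsc a.
  by rewrite ler_wpM2l // (le_trans h2).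
rewrite /phitilde /phi; apply/andP; split; lra.
Qed.

Lemma ared_ge k :
  pred k - model_gap k - 2 * (epsf a + nu r k * epsc a) <= ared P r k.
Proof.
have h1 := f_step_error k; have h2 := c_step_error k; have h3 := gap_le_model k.
have := f_noise (x k); have := f_noise (x k + p k).
rewrite !ler_norml => /andP[f1 f2] /andP[f3 f4].
have h4 : norm2 (ctilde P (x k + p k)) <= norm2 (At k *m p k + ct k) + 2 * epsc a
   + (Lc b / 2 * norm2 (p k) ^+ 2 + epsA b * norm2 (p k)).
  have -> : ctilde P (x k + p k) = (At k *m p k + ct k)
    + ((ctilde P (x k + p k) - con P (x k + p k)) - (ct k - cc k)
    + (con P (x k + p k) - cc k - At k *m p k)).
    by apply/colP => i; rewrite !mxE; ring.
  apply: le_trans (norm2_triangle _ _) _.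
  have t2 := norm2_triangle (ctilde P (x k + p k) - con P (x k + p k) - (ct k - cc k))
    (con P (x k + p k) - cc k - At k *m p k).
  have t3 := norm2B_le (ctilde P (x k + p k) - con P (x k + p k)) (ct k - cc k).
  by have := c_noise (x k + p k); have := ct_noise k; lra.
have n0 := nu_ge0 k; have := ler_wpM2l n0 h4.
rewrite /ared /phitilde /pred_at /vpred /ct_; lra.
Qed.

Lemma noise_ge0 k : 0 <= epsf a + nu r k * epsc a.
Proof. by rewrite addr_ge0 ?mulr_ge0 ?epsf_ge0 ?epsc_ge0. Qed.

Lemma rho_den_gt0 k : 0 < pred k + xi a * (epsf a + nu r k * epsc a).
Proof.
rewrite ltr_wpDr ?pred_gt0 // mulr_ge0 ?noise_ge0 //.
by have := xi_gt2; lra.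
Qed.

(** With (1 - pi0) xi = 2 the relaxation of rho cancels the noise in ared. *)
Lemma accept_of_gap k : model_gap k < (1 - pi0 a) * pred k -> accepted k.
Proof.
move=> h; rewrite /accepted /rho ltr_pdivlMr ?rho_den_gt0 //.
have := ared_ge k; have e := xiE; have n0 := noise_ge0 k.
have : (1 - pi0 a) * (xi a * (epsf a + nu r k * epsc a)) = 2 * (epsf a + nu r k * epsc a).
  by rewrite mulrA (mulrC (1 - _)) e.
lra.
Qed.

Lemma accepted_decrease k : accepted k ->
  phitilde P (x k.+1) (nu r k)
    <= phitilde P (x k) (nu r k) - pi0 a * pred k + 2 * (epsf a + nu r k * epsc a).
Proof.
move=> acc; have [-> _] := acceptedP acc.
move: acc; rewrite /accepted /rho ltr_pdivlMr ?rho_den_gt0 //.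
have e := xiE.
have : (1 - pi0 a) * (xi a * (epsf a + nu r k * epsc a)) = 2 * (epsf a + nu r k * epsc a).
  by rewrite mulrA (mulrC (1 - _)) e.
rewrite /ared; lra.
Qed.

Lemma accepted_phi_le k : accepted k ->
  phi P (x k.+1) (nu r k) <= phi P (x k) (nu r k) + 4 * (epsf a + nu r k * epsc a).
Proof.
move=> acc; have h := accepted_decrease acc.
have := phitilde_close (x k) (nu_ge0 k); have := phitilde_close (x k.+1) (nu_ge0 k).
rewrite !ler_norml => /andP[? ?] /andP[? ?].
have : 0 <= pi0 a * pred k.
  by rewrite mulr_ge0 ?(ltW (pred_gt0 _)) //; case/andP: pi0_bounds => /ltW.
lra.
Qed.

(** The bound on |Atilde| stands for the curvature of the normal subproblem, the
    one on |ctilde| for its initial value. *)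
Lemma vpred_cauchy k (T : R) : 0 <= T <= zeta a * D k ->
  MA b ^+ 2 * T <= norm2 ((At k)^T *m ct k) ->
  norm2 ((At k)^T *m ct k) * T <= 2 * Mc b * vpred P r k.
Proof.
move=> hT hM; have [_ hv _ _ _] := run_step k.
have := normal_cauchy_decrease hv MA_ge0 (At_le k) hT hM.
rewrite -vpredE => h; apply: le_trans h _.
by rewrite ler_wpM2r ?vpred_ge0 // ler_wpM2l // ct_le.
Qed.

End Run.

(** * Steps taken away from feasibility stationarity *)

(** The offsets gamma are defined with the nonnegative root of g (g + E) = K; the
    offset d pushes g strictly beyond it. *)
Lemma quadratic_threshold (R : realType) (E K d : R) : 0 <= E -> 0 <= K -> 0 < d ->
  let g := 2^-1 * (- E + Num.sqrt (E ^+ 2 + 4 * K)) + d in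
  0 < g /\ K < g * (g + E).
Proof.
move=> E0 K0 d0 g.
have s2 : Num.sqrt (E ^+ 2 + 4 * K) ^+ 2 = E ^+ 2 + 4 * K.
  by rewrite sqr_sqrtr // addr_ge0 ?sqr_ge0 // mulr_ge0.
have s0 := sqrtr_ge0 (E ^+ 2 + 4 * K).
rewrite /g; move: (Num.sqrt _) s0 s2 => s s0 s2.
have sE : E <= s by nra.
split; first lra.
nra.
Qed.

Section Feasibility.
Variables (R : realType) (n m : nat).
Variables (P : noisy_problem R n m) (a : parameters R) (r : run R n m).
Variable (b : constants R).
Hypothesis S : standing P a r b.
Variable k' : nat.
Hypothesis Hmu : 0 < mu b.

Local Notation x k := (iterate r k).
Local Notation p k := (step r k).
Local Notation D k := (Defs.radius r k).
Local Notation At k := (At_ P r k).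
Local Notation ct k := (ct_ P r k).
Local Notation cc k := (con P (iterate r k)).
Local Notation pred k := (pred_at P r k (nu r k)).
Local Notation vp k := (vpred P r k).
Local Notation E := (Ev a r b k').
Local Notation gam := (gamma_feas a r b k').
Local Notation e0 := (e_noise a r k').
Local Notation Mb := (Mbig r b).
Local Notation mx := (Num.max 1 (Mc b)).
Local Notation ch := (chi a r b).

(** The noisy measure of feasibility stationarity, the only one that the iteration
    sees. *)
Definition cstat k : R := norm2 ((At k)^T *m ct k).

Lemma mx_ge1 : 1 <= mx. Proof. by rewrite le_max lexx. Qed.
Lemma mx_geMc : Mc b <= mx. Proof. by rewrite le_max lexx orbT. Qed.
Lemma Mb_geMA : MA b ^+ 2 <= Mb. Proof. by rewrite /Mbig !le_max lexx !orbT. Qed.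
Lemma Mb_geLc : Lc b <= Mb. Proof. by rewrite /Mbig !le_max lexx !orbT. Qed.
Lemma Mb_geLf k : Lf b + MW b <= Mb * nu r k.
Proof.
have n0 := nu_gt0 S 0.
have h : (Lf b + MW b) / nu r 0%N <= Mb by rewrite /Mbig le_max lexx.
move: h; rewrite ler_pdivrMr // => h; apply: le_trans h _.
by rewrite ler_wpM2l ?(ltW (std_M S)) // (nu_mono S).
Qed.

Lemma xi_gt0 : 0 < xi a. Proof. by have := xi_gt2 S; lra. Qed.
Lemma tau_gt0 : 0 < tau a. Proof. exact: lt_trans ltr01 (tau_gt1 S). Qed.
Lemma mx_gt0 : 0 < mx. Proof. exact: lt_le_trans ltr01 mx_ge1. Qed.
Lemma xmM_gt0 : 0 < xi a * mx * Mb.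
Proof. exact: mulr_gt0 (mulr_gt0 xi_gt0 mx_gt0) (std_M S). Qed.
Lemma chi_den_gt0 : 0 < 2 * tau a * xi a * Mc b * mx * Mb.
Proof.
apply: mulr_gt0 (std_M S); apply: mulr_gt0 mx_gt0; apply: mulr_gt0 (std_Mc S).
by apply: mulr_gt0 xi_gt0; rewrite mulr_gt0 ?tau_gt0.
Qed.
Lemma pz_gt0 : 0 < pi1 a * zeta a.
Proof.
by have /andP[? _] := pi1_bounds S; have /andP[? _] := zeta_bounds S; rewrite mulr_gt0.
Qed.

Lemma chiE : ch * (2 * tau a * xi a * Mc b * mx * Mb) = pi0 a * pi1 a ^+ 2 * zeta a ^+ 2.
Proof. by rewrite /chi divfK // gt_eqF // chi_den_gt0. Qed.

Lemma chi_gt0 : 0 < ch.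
Proof.
have /andP[? _] := pi0_bounds S; have /andP[? _] := pi1_bounds S.
have /andP[? _] := zeta_bounds S.
by rewrite /chi divr_gt0 ?chi_den_gt0 // !mulr_gt0 ?exprn_gt0.
Qed.

Lemma e0_ge0 : 0 <= e0.
Proof. by rewrite /e_noise addr_ge0 ?divr_ge0 ?(epsf_ge0 S) ?(epsc_ge0 S) ?(nu_ge0 S). Qed.

Lemma e0_ge_epsc : epsc a <= e0.
Proof. by rewrite /e_noise lerDr divr_ge0 ?(epsf_ge0 S) ?(nu_ge0 S). Qed.

Lemma EvE : E * (pi1 a * zeta a) = xi a * Mc b * (epsg b / nu r k' + epsA b).
Proof.
by rewrite /Ev mulrAC divfK // gt_eqF // pz_gt0.
Qed.

Lemma Ev_ge0 : 0 <= E.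
Proof.
have h : 0 <= xi a * Mc b := ltW (mulr_gt0 xi_gt0 (std_Mc S)).
rewrite /Ev mulr_ge0 ?(divr_ge0 h) ?(ltW pz_gt0) //.
by rewrite addr_ge0 ?divr_ge0 ?(epsg_ge0 S) ?(epsA_ge0 S) ?(nu_ge0 S).
Qed.

Lemma gamma_root : 0 < gam /\ 2 * e0 < ch * (gam * (gam + E)).
Proof.
have K0 : 0 <= 2 * e0 / ch := divr_ge0 (mulr_ge0 (ler0n R 2) e0_ge0) (ltW chi_gt0).
have := quadratic_threshold Ev_ge0 K0 Hmu.
have -> : 4 * (2 * e0 / ch) = 8 * e0 / ch by field; rewrite gt_eqF ?chi_gt0.
rewrite /= -/(gamma_feas a r b k') => -[g0]; rewrite ltr_pdivrMr ?chi_gt0 // => h.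
by split=> //; rewrite [X in _ < X]mulrC.
Qed.

Lemma gamma_gt0 : 0 < gam. Proof. exact: gamma_root.1. Qed.

(** The largest radius at which the quadratic model error is still dominated by
    the decrease that h > Ev + gamma guarantees. *)
Definition Dfeas : R := pi1 a * zeta a / (xi a * mx * Mb) * gam.

Lemma DfeasE : Dfeas * (xi a * mx * Mb) = pi1 a * zeta a * gam.
Proof.
by rewrite /Dfeas mulrAC divfK // gt_eqF // xmM_gt0.
Qed.

Lemma Dfeas_gt0 : 0 < Dfeas.
Proof. exact: mulr_gt0 (divr_gt0 pz_gt0 xmM_gt0) gamma_gt0. Qed.

(** The working form of being outside CAcI; the extra terms of EAcI pay for
    replacing A and c by their noisy values. *)
Definition feas_good k := E + gam < cstat k.

Lemma cstat_noise k :
  norm2 ((A P (x k))^T *m cc k)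
   <= cstat k + epsA b * Mc b + epsc a * MA b + epsA b * epsc a.
Proof.
have -> : (A P (x k))^T *m cc k = (At k)^T *m ct k
   - (deltaA P (x k))^T *m ct k - (At k)^T *m (ct k - cc k)
   + (deltaA P (x k))^T *m (ct k - cc k).
  have -> : (At k)^T = (A P (x k))^T + (deltaA P (x k))^T.
    by apply/matrixP => i j; rewrite !mxE.
  rewrite !mulmxBr !mulmxDl.
  move: (_ *m cc k) (_ *m cc k) (_ *m ct k) (_ *m ct k) => X1 X2 X3 X4.
  by apply/colP => i; rewrite !mxE; ring.
have t1 := norm2_triangle ((At k)^T *m ct k - (deltaA P (x k))^T *m ct k
  - (At k)^T *m (ct k - cc k)) ((deltaA P (x k))^T *m (ct k - cc k)).
have t2 := norm2B_le ((At k)^T *m ct k - (deltaA P (x k))^T *m ct k)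
   ((At k)^T *m (ct k - cc k)).
have t3 := norm2B_le ((At k)^T *m ct k) ((deltaA P (x k))^T *m ct k).
have s1 := deltaAT_le S (x k) (ct k); have s2 := deltaAT_le S (x k) (ct k - cc k).
have s3 := AtT_le S k (ct k - cc k).
have d1 := ct_le S k; have d2 := ct_noise S k.
have := ler_wpM2l (epsA_ge0 S) d1; have := ler_wpM2l (epsA_ge0 S) d2.
have := ler_wpM2l (MA_ge0 S) d2.
rewrite /cstat; lra.
Qed.

Lemma feas_good_notC k : ~ CAcI P a r b k' (x k) -> feas_good k.
Proof.
rewrite /CAcI /= => /negP; rewrite -ltNge /EAcI => h.
by have := cstat_noise k; rewrite /feas_good; lra.
Qed.

Lemma small_radius k : D k <= Dfeas -> xi a * mx * Mb * D k <= pi1 a * zeta a * gam.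
Proof.
by move=> h; rewrite -DfeasE mulrC ler_wpM2r // ltW // xmM_gt0.
Qed.

Lemma Dfeas_M : Mb * Dfeas <= gam.
Proof.
have /andP[p10 p11] := pi1_bounds S; have /andP[z0 z1] := zeta_bounds S.
have h := DfeasE; have xg := xi_gt2 S; have m1 := mx_ge1.
have MD0 : 0 < Mb * Dfeas by rewrite mulr_gt0 ?(std_M S) ?Dfeas_gt0.
have q1 : pi1 a * zeta a * gam <= gam.
  by rewrite -[leRHS]mul1r ler_wpM2r ?(ltW gamma_gt0) //; nra.
have xm : 1 <= xi a * mx by nra.
have : 1 * (Mb * Dfeas) <= xi a * mx * (Mb * Dfeas) by rewrite ler_wpM2r // ltW.
by move: h; lra.
Qed.

Lemma feas_vpred k T : feas_good k -> 0 <= T -> T <= D k -> T <= Dfeas ->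
  cstat k * (zeta a * T) <= 2 * Mc b * vp k.
Proof.
move=> gk T0 TD TF; have /andP[z0 z1] := zeta_bounds S.
apply: (vpred_cauchy S); first by rewrite mulr_ge0 ?(ltW z0) //= ler_wpM2l // ltW.
apply: (@le_trans _ _ gam).
  apply: le_trans Dfeas_M; apply: (@le_trans _ _ (Mb * (zeta a * T))).
    by rewrite ler_wpM2r ?Mb_geMA // mulr_ge0 // ltW.
  rewrite ler_wpM2l ?(ltW (std_M S)) //; apply: le_trans TF.
  by rewrite -[leRHS]mul1r ler_wpM2r // ltW.
by have := Ev_ge0; move: gk; rewrite /feas_good /cstat; lra.
Qed.

Lemma noise_rate k : nu r k' <= nu r k ->
  epsg b + nu r k * epsA b <= nu r k * (epsg b / nu r k' + epsA b).
Proof.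
move=> hk; rewrite mulrDr lerD2r mulrCA -[leLHS]mulr1 ler_wpM2l ?(epsg_ge0 S) //.
by rewrite ler_pdivlMr ?(nu_gt0 S) // mul1r.
Qed.

Lemma e_rate k : nu r k' <= nu r k -> epsf a + nu r k * epsc a <= nu r k * e0.
Proof.
move=> hk; rewrite mulrDr lerD2r mulrCA -[leLHS]mulr1 ler_wpM2l ?(epsf_ge0 S) //.
by rewrite ler_pdivlMr ?(nu_gt0 S) // mul1r.
Qed.

Lemma gap_rate k : nu r k' <= nu r k ->
  model_gap r b k
  <= nu r k * (Mb * D k ^+ 2 + (epsg b / nu r k' + epsA b) * D k).
Proof.
move=> hk; have n0 := nu_ge0 S k.
have h1 := Mb_geLf k; have h2 := ler_wpM2l n0 Mb_geLc.
have h3 := noise_rate hk; have D0 := radius_ge0 S k.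
have := ler_wpM2r D0 h3; have D20 := sqr_ge0 (D k).
have q : (Lf b + MW b + nu r k * Lc b) / 2 <= nu r k * Mb by lra.
have := ler_wpM2r D20 q.
rewrite /model_gap; lra.
Qed.

Lemma feas_gap k : nu r k' <= nu r k -> feas_good k -> D k <= Dfeas ->
  model_gap r b k <= (1 - pi0 a) * (pi1 a * nu r k * vp k).
Proof.
move=> hk gk Dk; have n0 := nu_gt0 S k; have D0 := radius_gt0 S k.
apply: le_trans (gap_rate hk) _.
have -> : (1 - pi0 a) * (pi1 a * nu r k * vp k)
   = nu r k * ((1 - pi0 a) * pi1 a * vp k) by ring.
rewrite ler_pM2l //.
have hv := feas_vpred gk (ltW D0) (lexx _) Dk.
have Mc0 := std_Mc S; have x2 := xi_gt2 S; have xE := xiE S.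
have xM : 0 < xi a * Mc b by rewrite mulr_gt0 //; lra.
rewrite -(ler_pM2l xM).
have -> : xi a * Mc b * ((1 - pi0 a) * pi1 a * vp k) = pi1 a * (2 * Mc b * vp k).
  by rewrite -xE; ring.
have /andP[p10 p11] := pi1_bounds S.
apply: le_trans (ler_wpM2l (ltW p10) hv).
have s1 := small_radius Dk.
have s2 : xi a * Mc b * Mb * D k <= xi a * mx * Mb * D k.
  rewrite ler_wpM2r ?(ltW D0) // ler_wpM2r ?(ltW (std_M S)) //.
  by rewrite ler_wpM2l ?mx_geMc //; lra.
have s3 := ler_wpM2r (ltW D0) (le_trans s2 s1).
have eE := EvE.
have s4 : xi a * Mc b * ((epsg b / nu r k' + epsA b) * D k) = E * (pi1 a * zeta a) * D k.
  by rewrite eE; ring.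
rewrite mulrDr s4.
have /andP[z0 z1] := zeta_bounds S.
have pz : 0 < pi1 a * (zeta a * D k) by rewrite !mulr_gt0.
have := ler_wpM2l (ltW pz) (ltW gk).
lra.
Qed.

(** Because chi gamma (gamma + Ev) > 2 e, stationarity outside the region is large
    compared with the noise in c; this is the input of feas_brace. *)
Lemma feas_stat_sq k : feas_good k ->
  8 * epsc a * MA b ^+ 2 * Mc b <= pi0 a * pi1 a * zeta a * cstat k ^+ 2.
Proof.
move=> gk; have [g0 gr] := gamma_root; have E0 := Ev_ge0.
have /andP[p10 p11] := pi1_bounds S; have /andP[z0 z1] := zeta_bounds S.
have /andP[p00 p01] := pi0_bounds S.
have h0 : gam * (gam + E) <= cstat k ^+ 2 by move: gk; rewrite /feas_good; nra.
have e1 := e0_ge_epsc; have c0 := chi_gt0; have ec0 := epsc_ge0 S.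
have q1 : 2 * epsc a <= ch * cstat k ^+ 2.
  by have := ler_wpM2l (ltW c0) h0; lra.
have Mc0 := std_Mc S; have x2 := xi_gt2 S; have t1 := tau_gt1 S; have m1 := mx_ge1.
have M0 := std_M S; have MA2 := Mb_geMA; have MA20 := sqr_ge0 (MA b).
have w0 := ltW chi_den_gt0.
have q2 := ler_wpM2r w0 q1.
have E2 : ch * cstat k ^+ 2 * (2 * tau a * xi a * Mc b * mx * Mb)
  = pi0 a * pi1 a ^+ 2 * zeta a ^+ 2 * cstat k ^+ 2 by rewrite -chiE; ring.
rewrite E2 in q2.
have q3 : pi0 a * pi1 a ^+ 2 * zeta a ^+ 2 * cstat k ^+ 2
   <= pi0 a * pi1 a * zeta a * cstat k ^+ 2.
  rewrite ler_wpM2r ?sqr_ge0 // -!mulrA ler_wpM2l ?(ltW p00) //.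
  have y0 := pz_gt0; have y1 : pi1 a * zeta a <= 1 by nra.
  by have := ler_wpM2l (ltW y0) y1; lra.
apply: le_trans q3; apply: le_trans q2.
have u1 : 2 <= tau a * xi a by nra.
have u2 : 2 <= tau a * xi a * mx by nra.
have u3 : 2 * MA b ^+ 2 <= tau a * xi a * mx * Mb by nra.
have u4 : 0 <= 4 * epsc a * Mc b by rewrite !mulr_ge0 // ltW.
by have := ler_wpM2l u4 u3; lra.
Qed.

Lemma feas_brace k : feas_good k -> D k <= Dfeas ->
  brace P r k <= pi0 a * pi1 a * vp k.
Proof.
move=> gk Dk; have D0 := radius_gt0 S k.
have /andP[p10 p11] := pi1_bounds S; have /andP[z0 z1] := zeta_bounds S.
have /andP[p00 p01] := pi0_bounds S.
have [b0|b0] := leP (brace P r k) 0.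
  by apply: le_trans b0 _; rewrite !mulr_ge0 ?(vpred_ge0 S) // ltW.
have hv := feas_vpred gk (ltW D0) (lexx _) Dk.
have h0 : 0 < cstat k.
  by have := gamma_gt0; have := Ev_ge0; move: gk; rewrite /feas_good; lra.
have hsq := feas_stat_sq gk.
have b4 := brace_le4 S k.
have MA0 := MA_ge0 S; have ec0 := epsc_ge0 S; have Mc0 := std_Mc S.
have a1 : norm2 (At k *m p k) <= MA b * D k.
  by apply: le_trans (At_le S k _) _; rewrite ler_wpM2l // (step_le_radius S).
have a2 : cstat k <= MA b * norm2 (ct k) := AtT_le S k (ct k).
have cc0 := norm2_ge0 (cc k); have ct0 := norm2_ge0 (ct k).
have c1 : brace P r k * norm2 (ct k) <= 4 * epsc a * (MA b * D k).
  apply: (@le_trans _ _ (brace P r k * (norm2 (cc k) + norm2 (ct k)))).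
    by rewrite ler_wpM2l ?(ltW b0) // lerDr.
  by apply: le_trans b4 _; rewrite ler_wpM2l // mulr_ge0.
have c2 : brace P r k * cstat k <= 4 * epsc a * MA b ^+ 2 * D k.
  have := ler_wpM2l (ltW b0) a2; have := ler_wpM2l MA0 c1; lra.
have c3 : 2 * Mc b * (brace P r k * cstat k) <= pi0 a * pi1 a * zeta a * cstat k ^+ 2 * D k.
  have M2 : 0 <= 2 * Mc b by lra.
  have := ler_wpM2l M2 c2; have := ler_wpM2r (ltW D0) hsq; lra.
have c4 : 2 * Mc b * brace P r k <= pi0 a * pi1 a * (cstat k * (zeta a * D k)).
  rewrite -(ler_pM2r h0); move: c3; lra.
have pp : 0 <= pi0 a * pi1 a by rewrite mulr_ge0 // ltW.
have c5 := ler_wpM2l pp hv.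
have M2 : 0 < 2 * Mc b by lra.
by rewrite -(ler_pM2l M2); lra.
Qed.

(** Noise in the model is dominated by Ev, curvature by gamma, and the noise in c
    by feas_brace. *)
Lemma feas_small k : nu r k' <= nu r k -> feas_good k -> D k <= Dfeas ->
  accepted P a r k /\ phi P (x k.+1) (nu r k) <= phi P (x k) (nu r k).
Proof.
move=> hk gk Dk; have gap := feas_gap hk gk Dk; have br := feas_brace gk Dk.
have pg := pred_gt S k.
have /andP[p00 p01] := pi0_bounds S.
have acc : accepted P a r k.
  apply: (accept_of_gap S); apply: le_lt_trans gap _.
  by rewrite ltr_pM2l // subr_gt0.
split => //; have [-> _] := acceptedP S acc.
apply: le_trans (phi_step S k) _.
by have := ler_wpM2l (nu_ge0 S k) br; lra.
Qed.

Definition eta_feas : R := ch * (gam * (gam + E)) - 2 * e0.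

Lemma eta_feas_gt0 : 0 < eta_feas.
Proof. by rewrite subr_gt0; exact: gamma_root.2. Qed.

(** Compare with the Cauchy decrease at radius Dfeas / tau, where the bound is chi
    gamma (gamma + Ev). *)
Lemma feas_large k : nu r k' <= nu r k -> feas_good k -> Dfeas / tau a <= D k ->
  accepted P a r k ->
  phitilde P (x k.+1) (nu r k) <= phitilde P (x k) (nu r k) - nu r k * eta_feas.
Proof.
move=> hk gk Dk acc; apply: le_trans (accepted_decrease S acc) _.
have t1 := tau_gt1 S; have t0 : 0 < tau a by lra.
have n0 := nu_gt0 S k; have er := e_rate hk.
have T0 : 0 <= Dfeas / tau a by rewrite divr_ge0 ?(ltW Dfeas_gt0) // ltW.
have TF : Dfeas / tau a <= Dfeas.
  by rewrite ler_pdivrMr // -[leLHS]mulr1 ler_wpM2l ?(ltW Dfeas_gt0) // ltW.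
have hv := feas_vpred gk T0 Dk TF.
have pg := pred_gt S k.
have /andP[p10 p11] := pi1_bounds S; have /andP[z0 z1] := zeta_bounds S.
have /andP[p00 p01] := pi0_bounds S.
have g0 := gamma_gt0; have Mc0 := std_Mc S.
suff : nu r k * (ch * (gam * (gam + E))) <= pi0 a * pred k by rewrite /eta_feas; lra.
have pv : 2 * Mc b * (pi1 a * nu r k * vp k) <= 2 * Mc b * pred k.
  by rewrite ler_wpM2l ?(ltW pg) //; lra.
have c0 := chi_gt0.
have q1 : ch * (gam * (gam + E)) <= ch * (gam * cstat k).
  rewrite ler_wpM2l ?(ltW c0) // ler_wpM2l ?(ltW g0) //.
  by move: gk; rewrite /feas_good; lra.
have q2 : 2 * Mc b * (ch * (gam * cstat k))
   = pi0 a * pi1 a * (cstat k * (zeta a * (Dfeas / tau a))).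
  have cE := chiE; have dE := DfeasE.
  have xm := xmM_gt0.
  apply: (mulIf (lt0r_neq0 (mulr_gt0 t0 xm))).
  transitivity (ch * (2 * tau a * xi a * Mc b * mx * Mb) * (gam * cstat k)); first ring.
  rewrite cE; transitivity (pi0 a * pi1 a * cstat k * zeta a * (Dfeas * (xi a * mx * Mb))).
    by rewrite dE; ring.
  by field; rewrite gt_eqF.
have pp : 0 <= pi0 a * pi1 a by rewrite mulr_ge0 // ltW.
have q3 := ler_wpM2l pp hv.
have M2 : 0 < 2 * Mc b by lra.
rewrite -(ler_pM2l M2).
have M3 : 0 <= 2 * Mc b * nu r k by rewrite mulr_ge0 ?(ltW n0) // ltW.
have := ler_wpM2l M3 q1; have := ler_wpM2l (ltW n0) q3.
have := ler_wpM2l (ltW p00) pv.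
have -> : 2 * Mc b * nu r k * (ch * (gam * cstat k))
  = nu r k * (2 * Mc b * (ch * (gam * cstat k))) by ring.
rewrite q2; lra.
Qed.

End Feasibility.

(** * Trust-region dynamics and returns to the feasibility region *)

Section RadiusDynamics.
Variable R : realType.

Lemma bernoulli (t : R) j : 1 <= t -> 1 + (t - 1) *+ j <= t ^+ j.
Proof.
move=> t1; elim: j => [|j IH]; first by rewrite mulr0n addr0 expr0.
rewrite exprS mulrS; have : 0 <= (t - 1) *+ j by rewrite mulrn_wge0 // subr_ge0.
by move: IH; move: (t ^+ j) ((t - 1) *+ j) => u w; nra.
Qed.

Lemma pow_unbounded (t M : R) : 1 < t -> exists j, M < t ^+ j.
Proof.
move=> t1; have d0 : 0 < t - 1 by rewrite subr_gt0.
have q0 : 0 <= `|M| / (t - 1) by rewrite divr_ge0 // ltW.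
exists (Num.bound (`|M| / (t - 1))).
apply: lt_le_trans (bernoulli _ (ltW t1)).
have := archi_boundP q0; rewrite ltr_pdivrMr // -mulr_natl => h.
by have := ler_norm M; lra.
Qed.

(** Radii below D0 lead to acceptance, hence growth, so the radius eventually
    stays above D0 / tau. It cannot shrink for ever, so there are infinitely many
    accepted steps, each lowering the nonnegative Psi by eta. *)
Lemma no_endless_decrease (tau D0 eta : R) (D Psi : nat -> R) (acc : pred nat) N :
  1 < tau -> 0 < D0 -> 0 < eta -> (forall k, 0 < D k) -> (forall k, 0 <= Psi k) ->
  (forall k, acc k -> D k.+1 = tau * D k) ->
  (forall k, ~~ acc k -> D k.+1 = D k / tau) ->
  (forall k, (N <= k)%N -> D k <= D0 -> acc k) ->
  (forall k, (N <= k)%N -> ~~ acc k -> Psi k.+1 <= Psi k) ->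
  (forall k, (N <= k)%N -> acc k -> D0 / tau <= D k -> Psi k.+1 <= Psi k - eta) ->
  False.
Proof.
move=> t1 D00 eta0 Dp Psi0 Dacc Drej Hsmall Hrej Hlarge.
have t0 : 0 < tau := lt_trans ltr01 t1.
have q0 : D0 / tau <= D0 by rewrite ler_pdivrMr // -[leLHS]mulr1 ler_wpM2l // ltW.
have [K NK DK] : exists2 K, (N <= K)%N & D0 / tau < D K.
  apply: contrapT => h.
  have hle k : (N <= k)%N -> D k <= D0 / tau.
    by move=> Nk; rewrite leNgt; apply/negP => hk; apply: h; exists k.
  have grow j : D (N + j)%N = tau ^+ j * D N.
    elim: j => [|j IH]; first by rewrite addn0 mul1r.
    rewrite addnS Dacc ?IH ?exprS ?mulrA //.
    apply: Hsmall; first exact: leq_addr.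
    exact: le_trans (hle _ (leq_addr _ _)) q0.
  have [j hj] := pow_unbounded (D0 / D N) t1.
  have := hle (N + j)%N (leq_addr _ _); rewrite grow.
  move: hj; rewrite ltr_pdivrMr // => h1 h2.
  by have := lt_le_trans h1 (le_trans h2 q0); rewrite ltxx.
have inv k : (K <= k)%N -> D0 / tau < D k.
  elim: k => [|k IH]; first by rewrite leqn0 => /eqP <-.
  rewrite leq_eqVlt => /orP[/eqP <- //|]; rewrite ltnS => Kk.
  have Dk := IH Kk.
  have [ak|rk] := boolP (acc k).
    rewrite Dacc //; apply: lt_le_trans Dk _; rewrite -[leLHS]mul1r.
    by rewrite ler_wpM2r // ltW.
  rewrite Drej // ltr_pM2r ?invr_gt0 // ltNge; apply: contra rk.
  by apply: Hsmall; exact: leq_trans NK Kk.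
have mono k j : (K <= k)%N -> Psi (k + j)%N <= Psi k.
  move=> Kk; elim: j => [|j IH]; first by rewrite addn0.
  rewrite addnS; apply: le_trans IH.
  have Kkj : (K <= k + j)%N by rewrite (leq_trans Kk) // leq_addr.
  have Nkj := leq_trans NK Kkj.
  have [ak|rk] := boolP (acc (k + j)%N); last exact: Hrej.
  have := Hlarge _ Nkj ak (ltW (inv _ Kkj)); lra.
have next k : (K <= k)%N -> exists2 k2, (k <= k2)%N & acc k2.
  move=> Kk; apply: contrapT => h.
  have hrej j : ~~ acc (k + j)%N.
    by apply/negP => hk; apply: h; exists (k + j)%N => //; exact: leq_addr.
  have shrink j : tau ^+ j * D (k + j)%N = D k.
    elim: j => [|j IH]; first by rewrite addn0 mul1r.
    by rewrite addnS Drej // -[RHS]IH exprS; field; rewrite gt_eqF.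
  have q : 0 < D0 / tau by rewrite divr_gt0.
  have [j hj] := pow_unbounded (D k / (D0 / tau)) t1.
  have := inv (k + j)%N (leq_trans Kk (leq_addr _ _)).
  move: hj; rewrite ltr_pdivrMr // -(shrink j) ltr_pM2l ?exprn_gt0 // => h1 h2.
  by have := lt_trans h1 h2; rewrite ltxx.
have drop j : exists2 k, (K <= k)%N & Psi k <= Psi K - eta *+ j.
  elim: j => [|j [k Kk hk]]; first by exists K; rewrite ?mulr0n ?subr0.
  have [k2 kk2 ak2] := next k Kk.
  have Kk2 := leq_trans Kk kk2.
  exists k2.+1; first exact: leqW.
  have := Hlarge k2 (leq_trans NK Kk2) ak2 (ltW (inv _ Kk2)).
  have := mono k (k2 - k)%N Kk; rewrite subnKC // mulrSr; lra.
have p0 : 0 <= Psi K / eta by rewrite divr_ge0 // ltW.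
have [k Kk hk] := drop (Num.bound (Psi K / eta)).
have := archi_boundP p0; rewrite ltr_pdivrMr // mulr_natl => h.
by have := Psi0 k; lra.
Qed.

End RadiusDynamics.

(** If the Jacobian and constraint values vary little over a step, and the next
    point is outside the region, then stationarity before the step was nearly as
    large; E + M gam and t gam are the two lower bounds that the step estimate of
    first_step_small consumes. *)
Lemma exit_stationarity (R : realType) (E gam t M ec u y h : R) :
  0 <= E -> 0 < gam -> 0 < t -> 0 < M -> 2 * t <= 1 - u -> M <= u / 4 ->
  8 * ec <= M -> y <= t ^+ 2 * E -> y <= t ^+ 2 * gam ->
  E + gam < h + t * gam + y + t * gam * (t * M) / 2 + t * gam * (M + ec) ->
  E + M * gam <= h /\ t * gam <= h.
Proof.
move=> E0 g0 t0 M0 t2 M4 ecM yA yB main.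
have tg0 : 0 < t * gam by rewrite mulr_gt0.
have tM : t * M <= 1 / 2 * M by rewrite ler_wpM2r ?(ltW M0) //; lra.
have w1 : t * gam * (t * M) / 2 + t * gam * (M + ec) <= t * gam * (11 / 8 * M).
  have : t * gam * (t * M) <= t * gam * (1 / 2 * M) by rewrite ler_wpM2l // ltW.
  have : t * gam * ec <= t * gam * (M / 8) by rewrite ler_wpM2l ?(ltW tg0) //; lra.
  lra.
have tt : t ^+ 2 <= t * (1 / 2) by rewrite expr2 ler_wpM2l ?(ltW t0) //; lra.
split.
  have : 0 <= gam * (1 - t - t ^+ 2 - t * (11 / 8 * M) - M).
    by rewrite mulr_ge0 ?(ltW g0) //; lra.
  lra.
have : 0 <= gam * (1 - 2 * t - t * (11 / 8 * M)) by rewrite mulr_ge0 ?(ltW g0) //; lra.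
have : t ^+ 2 * E <= E.
  by rewrite -[leRHS]mul1r ler_wpM2r // expr_le1 ?(ltW t0) //; lra.
lra.
Qed.

Section FeasibilityResults.
Variables (R : realType) (n m : nat).
Variables (P : noisy_problem R n m) (a : parameters R) (r : run R n m).
Variable (b : constants R).
Hypothesis S : standing P a r b.
Variable k' : nat.
Hypothesis Hmu : 0 < mu b.

Local Notation x k := (iterate r k).
Local Notation p k := (step r k).
Local Notation D k := (Defs.radius r k).
Local Notation At k := (At_ P r k).
Local Notation ct k := (ct_ P r k).
Local Notation cc k := (con P (iterate r k)).
Local Notation pred k := (pred_at P r k (nu r k)).
Local Notation vp k := (vpred P r k).
Local Notation E := (Ev a r b k').
Local Notation gam := (gamma_feas a r b k').
Local Notation e0 := (e_noise a r k').
Local Notation Mb := (Mbig r b).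
Local Notation mx := (Num.max 1 (Mc b)).
Local Notation DF := (Dfeas a r b k').
Local Notation inC k := (CAcI P a r b k' (iterate r k)).

(** The noisy merit function divided by the merit parameter: nonincreasing in the
    parameter, as ftilde > 0. *)
Definition PhiT (y : 'cV[R]_n) (w : R) : R := w^-1 * ftilde P y + norm2 (ctilde P y).
(** Noise is added to f before dividing, so that this upper bound for PhiT is also
    nonincreasing in the merit parameter; Phi itself is not, since f may be
    negative. *)
Definition PhiP (y : 'cV[R]_n) (w : R) : R :=
  w^-1 * (obj P y + epsf a) + norm2 (con P y) + epsc a.

Lemma PhiTE y w : 0 < w -> w * PhiT y w = phitilde P y w.
Proof. by move=> w0; rewrite /PhiT /phitilde; field; rewrite gt_eqF. Qed.

Lemma PhiE y w : 0 < w -> w * Phi P y w = phi P y w.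
Proof. by move=> w0; rewrite /Phi /phi; field; rewrite gt_eqF. Qed.

Lemma PhiPE y w : PhiP y w = Phi P y w + (w^-1 * epsf a + epsc a).
Proof. by rewrite /PhiP /Phi; ring. Qed.

Lemma PhiT_nu_anti k w w' : 0 < w -> w <= w' -> PhiT (x k) w' <= PhiT (x k) w.
Proof.
move=> w0 ww'; rewrite lerD2r ler_wpM2r ?(ltW (ft_gt0 S k)) //.
by rewrite lef_pV2 ?posrE // (lt_le_trans w0).
Qed.

Lemma PhiP_nu_anti k w w' : 0 < w -> w <= w' -> PhiP (x k) w' <= PhiP (x k) w.
Proof.
move=> w0 ww'; rewrite !lerD2r ler_wpM2r //.
  have := f_noise S (x k); have := ft_gt0 S k; rewrite /ft_ ler_norml => ? /andP[? ?].
  lra.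
by rewrite lef_pV2 ?posrE // (lt_le_trans w0).
Qed.

Lemma noise_scaled w : 0 < w -> epsf a + w * epsc a = w * (w^-1 * epsf a + epsc a).
Proof. by move=> w0; field; rewrite gt_eqF. Qed.

Lemma PhiT_close y w : 0 < w ->
  `|PhiT y w - Phi P y w| <= w^-1 * epsf a + epsc a.
Proof.
move=> w0; have := phitilde_close S y (ltW w0).
rewrite -PhiTE // -PhiE // -mulrBr normrM gtr0_norm // noise_scaled //.
by rewrite ler_pM2l.
Qed.

Lemma PhiT_le_PhiP y w : 0 < w -> PhiT y w <= PhiP y w.
Proof.
move=> w0; have := PhiT_close y w0; rewrite PhiPE ler_norml => /andP[? ?]; lra.
Qed.

Lemma e_anti k : nu r k' <= nu r k -> (nu r k)^-1 * epsf a + epsc a <= e0.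
Proof.
move=> hk; have := e_rate S hk; rewrite noise_scaled ?(nu_gt0 S) //.
by rewrite ler_pM2l ?(nu_gt0 S).
Qed.

Lemma Phi_le_PhiT k y : nu r k' <= nu r k -> Phi P y (nu r k) <= PhiT y (nu r k) + e0.
Proof.
move=> hk; have := PhiT_close y (nu_gt0 S k); have := e_anti hk.
rewrite ler_norml => ? /andP[? ?]; lra.
Qed.

Lemma PhiT_le_Phi k y : nu r k' <= nu r k -> PhiT y (nu r k) <= Phi P y (nu r k) + e0.
Proof.
move=> hk; have := PhiT_close y (nu_gt0 S k); have := e_anti hk.
rewrite ler_norml => ? /andP[? ?]; lra.
Qed.

Lemma PhiP_le_Phi k y : nu r k' <= nu r k -> PhiP y (nu r k) <= Phi P y (nu r k) + e0.
Proof. by move=> hk; rewrite PhiPE; have := e_anti hk; lra. Qed.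

Lemma nu_succ k : nu r k <= nu r k.+1. Proof. exact: (nu_mono S). Qed.

Lemma feas_visits N : exists k, (N <= k)%N /\ inC k.
Proof.
apply: contrapT => hno.
have out k : (N <= k)%N -> feas_good P a r b k' k.
  by move=> Nk; apply: (feas_good_notC S) => hk; apply: hno; exists k.
apply: (@no_endless_decrease R (tau a) DF (eta_feas a r b k') (Defs.radius r)
  (fun k => PhiT (x k) (nu r k)) (accepted P a r) (maxn N k')).
- exact: tau_gt1 S.
- exact: Dfeas_gt0 S _ Hmu.
- exact: eta_feas_gt0 S _ Hmu.
- exact: radius_gt0 S.
- move=> k; have i0 : 0 <= (nu r k)^-1 by rewrite invr_ge0 (nu_ge0 S).
  exact: addr_ge0 (mulr_ge0 i0 (ltW (ft_gt0 S k))) (norm2_ge0 _).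
- by move=> k /(acceptedP S) [].
- by move=> k /(rejectedP S) [].
- move=> k; rewrite geq_max => /andP[Nk kk] Dk.
  by have [] := feas_small S Hmu (nu_mono S kk) (out k Nk) Dk.
- move=> k _ rk; have [E1 _] := rejectedP S rk; have := PhiT_nu_anti k.+1 (nu_gt0 S k) (nu_succ k).
  by rewrite {2}E1.
- move=> k; rewrite geq_max => /andP[Nk kk] ak Dk.
  apply: le_trans (PhiT_nu_anti k.+1 (nu_gt0 S k) (nu_succ k)) _.
  have := feas_large S Hmu (nu_mono S kk) (out k Nk) Dk ak.
  by rewrite -!PhiTE ?(nu_gt0 S) // -mulrBr ler_pM2l ?(nu_gt0 S).
Qed.

(** The invariant of an excursion: either the radius is large, and then PhiT can
    only decrease, or the radius may be small, and then PhiP can only decrease. *)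
Definition out_state (T : R) k :=
  PhiT (x k) (nu r k) <= T /\ (DF / tau a < D k \/ PhiP (x k) (nu r k) <= T).

Lemma out_state_of_PhiP T k : PhiP (x k) (nu r k) <= T -> out_state T k.
Proof.
move=> h; split; last by right.
exact: le_trans (PhiT_le_PhiP _ (nu_gt0 S k)) h.
Qed.

Lemma rejected_radius k : nu r k' <= nu r k -> feas_good P a r b k' k ->
  ~~ accepted P a r k -> DF / tau a < D k.+1.
Proof.
move=> hk gk rk; have [_ ->] := rejectedP S rk.
rewrite ltr_pM2r ?invr_gt0 ?(tau_gt0 S) // ltNge; apply: contra rk => Dk.
by have [] := feas_small S Hmu hk gk Dk.
Qed.

Lemma accepted_radius k : accepted P a r k -> DF / tau a < D k -> DF / tau a < D k.+1.
Proof.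
move=> ak h; have [_ ->] := acceptedP S ak; apply: lt_le_trans h _.
by rewrite -[leLHS]mul1r ler_wpM2r ?(radius_ge0 S) // ltW // (tau_gt1 S).
Qed.

Lemma out_step T k : nu r k' <= nu r k -> ~ inC k -> out_state T k -> out_state T k.+1.
Proof.
move=> hk hC [hT hD]; have gk := feas_good_notC S hC.
have [ak|rk] := boolP (accepted P a r k); last first.
  split; last by left; exact: rejected_radius.
  apply: le_trans (PhiT_nu_anti k.+1 (nu_gt0 S k) (nu_succ k)) _.
  by have [-> _] := rejectedP S rk.
case: hD => [hD|hP].
  split; last by left; exact: accepted_radius.
  apply: le_trans (PhiT_nu_anti k.+1 (nu_gt0 S k) (nu_succ k)) _.
  have := feas_large S Hmu hk gk (ltW hD) ak.
  rewrite -!PhiTE ?(nu_gt0 S) // -mulrBr ler_pM2l ?(nu_gt0 S) // => h.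
  by have := eta_feas_gt0 S k' Hmu; lra.
have [Dk|Dk] := leP (D k) DF.
  apply: out_state_of_PhiP; apply: le_trans hP.
  apply: le_trans (PhiP_nu_anti k.+1 (nu_gt0 S k) (nu_succ k)) _.
  have [_] := feas_small S Hmu hk gk Dk.
  by rewrite -!PhiE ?(nu_gt0 S) // ler_pM2l ?(nu_gt0 S) // !PhiPE lerD2r.
have hD : DF / tau a < D k.
  apply: le_lt_trans Dk; rewrite ler_pdivrMr ?(tau_gt0 S) // -[leLHS]mulr1.
  by rewrite ler_wpM2l ?(ltW (Dfeas_gt0 S _ Hmu)) // ltW // (tau_gt1 S).
split; last by left; exact: accepted_radius.
apply: le_trans (PhiT_nu_anti k.+1 (nu_gt0 S k) (nu_succ k)) _.
have := feas_large S Hmu hk gk (ltW hD) ak.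
rewrite -!PhiTE ?(nu_gt0 S) // -mulrBr ler_pM2l ?(nu_gt0 S) // => h.
by have := eta_feas_gt0 S k' Hmu; lra.
Qed.

(** A re-entry into the region resets the invariant, so only the step out of the
    region has to be bounded. *)
Lemma feas_invariant T K : nu r k' <= nu r K ->
  (forall k, nu r k' <= nu r k -> inC k -> Phi P (x k) (nu r k) + 3 * e0 <= T) ->
  (forall k, nu r k' <= nu r k -> inC k -> ~ inC k.+1 -> accepted P a r k ->
     D k <= DF / tau a -> Phi P (x k.+1) (nu r k) + e0 <= T) ->
  inC K \/ out_state T K ->
  forall k, (K <= k)%N -> inC k \/ out_state T k.
Proof.
move=> hK h1 h2 hst; elim=> [|k IH]; first by rewrite leqn0 => /eqP <-.
rewrite leq_eqVlt => /orP[/eqP <- //|]; rewrite ltnS => Kk.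
have hk : nu r k' <= nu r k := le_trans hK (nu_mono S Kk).
have [C1|nC1] := pselect (inC k.+1); first by left.
right; have [Ck|nCk] := pselect (inC k); last first.
  by apply: out_step => //; case: (IH Kk).
have [ak|rk] := boolP (accepted P a r k); last first.
  by case: nC1; have [-> _] := rejectedP S rk.
have [Dk|Dk] := leP (D k) (DF / tau a).
  apply: out_state_of_PhiP.
  apply: le_trans (PhiP_nu_anti k.+1 (nu_gt0 S k) (nu_succ k)) _.
  apply: le_trans (PhiP_le_Phi _ hk) _; exact: h2.
split; last by left; exact: accepted_radius.
apply: le_trans (PhiT_nu_anti k.+1 (nu_gt0 S k) (nu_succ k)) _.
apply: le_trans (h1 k hk Ck).
have := accepted_decrease S ak; have n0 := nu_gt0 S k.
have pp : 0 <= pi0 a * pred k.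
  by rewrite mulr_ge0 ?(ltW (pred_gt0 S _)) //; case/andP: (pi0_bounds S) => /ltW.
have er := e_rate S hk; have cl := PhiT_le_Phi (x k) hk.
rewrite -!PhiTE // => h.
have : nu r k * PhiT (x k.+1) (nu r k) <= nu r k * (PhiT (x k) (nu r k) + 2 * e0) by lra.
rewrite ler_pM2l //; lra.
Qed.

(** Moving from x_k to x_{k+1} changes A and c by multiples of the step length,
    and replaces noisy values by exact ones. *)
Lemma stat_next k : accepted P a r k ->
  norm2 ((A P (x k.+1))^T *m cc k.+1) <=
  cstat P r k + norm2 (p k) * (MA b ^+ 2 + MA b * epsA b + MA b * (Lc b / 2) * norm2 (p k)
     + Lc b * (Mc b + epsc a)) + MA b * epsc a + epsA b * (Mc b + epsc a).
Proof.
move=> ak; have [E1 _] := acceptedP S ak.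
set s := norm2 (p k); have s0 : 0 <= s := norm2_ge0 _.
have cz : norm2 (cc k.+1) <= Mc b + epsc a.
  have := ct_le S k.+1; have := ct_noise S k.+1.
  have := norm2_leB (cc k.+1) (ct k.+1); rewrite norm2BC; lra.
set cz' := cc k.+1 in cz *.
have -> : (A P (x k.+1))^T *m cz' = (A P (x k.+1) - A P (x k))^T *m cz'
  - (deltaA P (x k))^T *m cz' + (At k)^T *m ct k
  + (At k)^T *m (At k *m p k) - (At k)^T *m (ct k - cc k)
  + (At k)^T *m (cz' - cc k - At k *m p k).
  have -> : (A P (x k.+1) - A P (x k))^T = (A P (x k.+1))^T - (A P (x k))^T.
    by apply/matrixP => i j; rewrite !mxE.
  have -> : (A P (x k))^T = (At k)^T - (deltaA P (x k))^T.
    by apply/matrixP => i j; rewrite !mxE addrK.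
  rewrite !mulmxBr !mulmxBl.
  move: (_ *m cz') (_ *m cz') (_ *m cz') (_ *m ct k) (_ *m (At k *m p k)) (_ *m cc k).
  by move=> X1 X2 X3 X4 X5 X6; apply/colP => i; rewrite !mxE; ring.
set v1 := (_ - _)^T *m _; set v2 := _ *m cz'; set v3 := _ *m ct k.
set v4 := _ *m (At k *m p k); set v5 := _ *m (ct k - _); set v6 := _ *m (_ - _ - _).
have t1 := norm2_triangle (v1 - v2 + v3 + v4 - v5) v6.
have t2 := norm2B_le (v1 - v2 + v3 + v4) v5.
have t3 := norm2_triangle (v1 - v2 + v3) v4.
have t4 := norm2_triangle (v1 - v2) v3.
have t5 := norm2B_le v1 v2.
have MA0 := MA_ge0 S; have eA0 := epsA_ge0 S; have Lc0 := Lc_ge0 S.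
have b1 : norm2 v1 <= Lc b * s * (Mc b + epsc a).
  apply: (@le_trans _ _ (Lc b * s * norm2 cz')).
    case: (std_smooth S) => _ _ _ [_ lc]; apply: opnorm_tr_le.
    by have := lc (x k.+1) (x k); rewrite E1 [in norm2 _]addrAC subrr add0r.
  by rewrite ler_wpM2l // mulr_ge0.
have b2 : norm2 v2 <= epsA b * (Mc b + epsc a).
  by apply: le_trans (deltaAT_le S _ _) _; rewrite ler_wpM2l.
have b4 : norm2 v4 <= MA b ^+ 2 * s.
  apply: le_trans (AtT_le S _ _) _; rewrite expr2 -mulrA ler_wpM2l //.
  exact: At_le S _ _.
have b5 : norm2 v5 <= MA b * epsc a.
  by apply: le_trans (AtT_le S _ _) _; rewrite ler_wpM2l // (ct_noise S).
have b6 : norm2 v6 <= MA b * (Lc b / 2 * s ^+ 2 + epsA b * s).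
  apply: le_trans (AtT_le S _ _) _; rewrite ler_wpM2l //.
  by rewrite /cz' E1; exact: c_step_error S k.
have b3 : norm2 v3 = cstat P r k by [].
rewrite expr2 in b6; lra.
Qed.

(** When Mc is small, Ev + gamma < MA Mc forces the noise in A and c to be small
    as well. Stationarity is then large enough already at x_k for the model error
    to be dominated, leaving only the noise of brace. *)
Lemma first_step_small k : nu r k' <= nu r k ->
  inC k -> ~ inC k.+1 -> accepted P a r k -> D k <= DF / tau a ->
  Mc b <= pi0 a * pi1 a * zeta a / 4 ->
  Phi P (x k.+1) (nu r k) <= Phi P (x k) (nu r k) + 2 * e0.
Proof.
move=> hk Ck nC1 ak Dk Mcs.
have /andP[p00 p01] := pi0_bounds S; have /andP[p10 p11] := pi1_bounds S.
have /andP[z0 z1] := zeta_bounds S; have t1 := tau_gt1 S.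
have xE := xiE S; have x2 := xi_gt2 S; have Mc0 := std_Mc S; have M0 := std_M S.
have g0 := gamma_gt0 S k' Hmu; have E0 := Ev_ge0 S k'.
have y0 := pz_gt0 S; have y1 : pi1 a * zeta a <= 1 by nra.
have Mc4 : Mc b <= pi0 a / 4.
  apply: le_trans Mcs _; rewrite ler_pM2r ?invr_gt0 // -mulrA.
  by rewrite -[leRHS]mulr1 ler_wpM2l // ltW.
have mx1 : mx = 1 by apply/max_idPl; lra.
(* chosen so that M Dfeas = t gamma, as max(1, Mc) = 1 *)
pose t := pi1 a * zeta a / xi a.
have tE : xi a * t = pi1 a * zeta a by rewrite /t mulrC divfK // gt_eqF // (xi_gt0 S).
have t0 : 0 < t by rewrite /t divr_gt0 // (xi_gt0 S).
have t2 : 2 * t <= 1 - pi0 a by rewrite -xE -mulrA mulrCA tE; nra.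
have DD : D k <= DF.
  apply: le_trans Dk _; rewrite ler_pdivrMr ?(tau_gt0 S) // -[leLHS]mulr1.
  by rewrite ler_wpM2l ?(ltW (Dfeas_gt0 S _ Hmu)) // ltW.
have D0 := radius_gt0 S k.
have MD : Mb * D k <= t * gam.
  have := small_radius S DD; rewrite mx1 mulr1 -tE => h.
  by rewrite -(ler_pM2l (xi_gt0 S)); lra.
set s := norm2 (p k); have s0 : 0 <= s := norm2_ge0 _.
have sD : s <= D k := step_le_radius S k.
have Ms : Mb * s <= t * gam by apply: le_trans MD; rewrite ler_wpM2l // ltW.
have MA0 := MA_ge0 S; have MA2 := Mb_geMA r b; have Lc0 := Lc_ge0 S; have LcM := Mb_geLc r b.
have eA0 := epsA_ge0 S; have ec0 := epsc_ge0 S.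
have gz := feas_good_notC S nC1.
have hz : E + gam < MA b * Mc b.
  apply: lt_le_trans gz _; apply: le_trans (AtT_le S _ _) _.
  by rewrite ler_wpM2l // (ct_le S).
have MAp : 0 < MA b.
  by rewrite lt_def MA0 andbT; apply: contraTneq hz => ->; rewrite mul0r -leNgt addr_ge0 // ltW.
have eAE : epsA b * Mc b <= t * E.
  have eE := EvE S k'.
  have q : 0 <= epsg b / nu r k' by rewrite divr_ge0 ?(epsg_ge0 S) ?(nu_ge0 S).
  have q2 : xi a * (t * E) = xi a * Mc b * (epsg b / nu r k' + epsA b).
    by rewrite mulrA tE mulrC eE.
  rewrite -(ler_pM2l (xi_gt0 S)) q2.
  by have := mulr_ge0 (ltW (mulr_gt0 (xi_gt0 S) Mc0)) q; lra.
have ecM : 8 * epsc a <= Mc b.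
  have := feas_stat_sq S Hmu gz.
  have h1 : cstat P r k.+1 <= MA b * Mc b.
    by apply: le_trans (AtT_le S _ _) _; rewrite ler_wpM2l // (ct_le S).
  have h2 : cstat P r k.+1 ^+ 2 <= (MA b * Mc b) ^+ 2.
    by rewrite ler_pXn2r ?nnegrE ?mulr_ge0 ?(ltW Mc0) // norm2_ge0.
  have h3 : pi0 a * pi1 a * zeta a * cstat P r k.+1 ^+ 2 <= 1 * (MA b * Mc b) ^+ 2.
    apply: ler_pM => //; first by rewrite !mulr_ge0 // ltW.
      by rewrite sqr_ge0.
    by rewrite -mulrA; nra.
  move=> h4; have := le_trans h4 h3; rewrite mul1r.
  have -> : (MA b * Mc b) ^+ 2 = Mc b * (MA b ^+ 2 * Mc b) by ring.
  by rewrite -mulrA ler_pM2r // mulr_gt0 // exprn_gt0.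
have MAs : MA b * s <= t * Mc b.
  rewrite -(ler_pM2l MAp).
  have : MA b ^+ 2 * s <= Mb * s by rewrite ler_wpM2r.
  have : t * gam <= t * (MA b * Mc b) by rewrite ler_wpM2l ?(ltW t0) //; lra.
  by rewrite expr2; lra.
pose y := MA b * epsA b * s.
have yA : y <= t ^+ 2 * E.
  rewrite -(ler_pM2l Mc0).
  have := ler_wpM2r (mulr_ge0 (ltW t0) E0) MAs.
  have : MA b * s * (epsA b * Mc b) <= MA b * s * (t * E) by rewrite ler_wpM2l // mulr_ge0.
  by rewrite /y expr2; lra.
have yB : y <= t ^+ 2 * gam.
  have MMc : 0 < MA b * Mc b by rewrite mulr_gt0.
  rewrite -(ler_pM2l MMc).
  have q1 : MA b * MA b * s * (epsA b * Mc b) <= MA b * MA b * s * (t * E).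
    by rewrite ler_wpM2l // !mulr_ge0.
  have q2 : MA b ^+ 2 * s <= t * gam.
    by apply: le_trans Ms; rewrite ler_wpM2r.
  have q3 := ler_wpM2r (mulr_ge0 (ltW t0) E0) q2.
  have tg : 0 <= t ^+ 2 * gam by rewrite mulr_ge0 ?sqr_ge0 // ltW.
  have q4 : t ^+ 2 * gam * E <= t ^+ 2 * gam * (MA b * Mc b) by rewrite ler_wpM2l //; lra.
  by move: q3 q4; rewrite /y !expr2; lra.
have LcsM : Lc b * s <= t * gam by apply: le_trans Ms; rewrite ler_wpM2r.
have z1' : MA b * (Lc b / 2) * s * s <= t * gam * (t * Mc b) / 2.
  have := ler_pM (mulr_ge0 Lc0 s0) (mulr_ge0 MA0 s0) LcsM MAs; lra.
have z2 : s * (Lc b * (Mc b + epsc a)) <= t * gam * (Mc b + epsc a).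
  by rewrite mulrA [s * _]mulrC ler_wpM2r // addr_ge0 // ltW.
have z3 : MA b ^+ 2 * s <= t * gam by apply: le_trans Ms; rewrite ler_wpM2r.
have EI : EAcI a r b k' < norm2 ((A P (x k.+1))^T *m cc k.+1).
  by rewrite ltNge; apply/negP.
have sn := stat_next ak.
have main : E + gam < cstat P r k + t * gam + y + t * gam * (t * Mc b) / 2
   + t * gam * (Mc b + epsc a).
  move: EI sn; rewrite /EAcI -/s /y; lra.
set h0 := cstat P r k in main.
have [hA hB] := exit_stationarity E0 g0 t0 Mc0 t2 Mc4 ecM yA yB main.
have hv : h0 * (zeta a * D k) <= 2 * Mc b * vp k.
  apply: (vpred_cauchy S); first by rewrite mulr_ge0 ?(ltW z0) ?(ltW D0) /=.
  apply: le_trans hB; apply: le_trans MD.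
  rewrite mulrA; apply: ler_wpM2r; first exact: ltW.
  apply: le_trans MA2; rewrite -[leRHS]mulr1.
  by rewrite ler_wpM2l ?sqr_ge0 // ltW.
have gap := gap_rate S hk.
have n0 := nu_gt0 S k; have pg := pred_gt S k.
have core : Mb * D k ^+ 2 + (epsg b / nu r k' + epsA b) * D k <= pi1 a * vp k.
  have xM : 0 < xi a * Mc b := mulr_gt0 (xi_gt0 S) Mc0.
  rewrite -(ler_pM2l xM).
  have eE := EvE S k'.
  have q1 : xi a * Mc b * (Mb * D k ^+ 2 + (epsg b / nu r k' + epsA b) * D k)
    = xi a * (Mb * D k) * (Mc b * D k) + E * (pi1 a * zeta a) * D k by rewrite eE; ring.
  rewrite q1.
  have q2 : xi a * (Mb * D k) * (Mc b * D k) <= xi a * (t * gam) * (Mc b * D k).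
    rewrite ler_wpM2r ?mulr_ge0 ?(ltW Mc0) ?(ltW D0) // ler_wpM2l ?(ltW (xi_gt0 S)) //.
  have q3 : xi a * (t * gam) = pi1 a * zeta a * gam by rewrite mulrA tE.
  rewrite q3 in q2.
  have q4 : 0 <= pi1 a * zeta a * D k by rewrite mulr_ge0 ?(ltW y0) ?(ltW D0).
  have q5 := ler_wpM2l q4 hA.
  have q6 := ler_wpM2l (ltW p10) hv.
  have q7 : 2 * (Mc b * (pi1 a * vp k)) <= xi a * (Mc b * (pi1 a * vp k)).
    by rewrite ler_wpM2r ?(ltW x2) // !mulr_ge0 ?(vpred_ge0 S) // ltW.
  lra.
have st := phi_step S k; have [E1 _] := acceptedP S ak; rewrite -E1 in st.
have br := ler_wpM2l (ltW n0) (brace_le2 S k).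
have cn := ler_wpM2l (ltW n0) core.
have ee := ler_wpM2l (ltW n0) (e0_ge_epsc S k').
have pe1 := PhiE (x k) n0; have pe2 := PhiE (x k.+1) n0.
rewrite -(ler_pM2l n0); lra.
Qed.

End FeasibilityResults.

(** * Excursions from the feasibility region *)

Section FeasibilityRegion.
Variables (R : realType) (n m : nat).
Variables (P : noisy_problem R n m) (a : parameters R) (r : run R n m).
Variable (b : constants R).
Hypothesis S : standing P a r b.
Variable k' : nat.
Hypothesis Hmu : 0 < mu b.

Local Notation x k := (iterate r k).
Local Notation D k := (Defs.radius r k).
Local Notation E := (Ev a r b k').
Local Notation gam := (gamma_feas a r b k').
Local Notation e0 := (e_noise a r k').
Local Notation Mb := (Mbig r b).
Local Notation mx := (Num.max 1 (Mc b)).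
Local Notation DF := (Dfeas a r b k').
Local Notation inC k := (CAcI P a r b k' (iterate r k)).

Lemma dAcE : dAc a r b k' * (tau a - 1) = tau a * DF.
Proof.
have t1 : tau a - 1 != 0 by rewrite subr_eq0 gt_eqF // (tau_gt1 S).
have X0 := gt_eqF (xi_gt0 S); have m0 := gt_eqF (mx_gt0 b); have M0 := gt_eqF (std_M S).
by rewrite /dAc /Dfeas; field; rewrite t1 X0 m0 M0.
Qed.

Lemma dAc_gt0 : 0 < dAc a r b k'.
Proof.
have t1 : 0 < tau a - 1 by rewrite subr_gt0 (tau_gt1 S).
by rewrite -(pmulr_lgt0 _ t1) dAcE; exact: mulr_gt0 (tau_gt0 S) (Dfeas_gt0 S _ Hmu).
Qed.

Lemma EAcI_ge : E + gam <= EAcI a r b k'.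
Proof.
have := mulr_ge0 (epsA_ge0 S) (ltW (std_Mc S)).
have := mulr_ge0 (epsc_ge0 S) (MA_ge0 S).
have := mulr_ge0 (epsA_ge0 S) (epsc_ge0 S).
by rewrite /EAcI; lra.
Qed.

(** An accepted step costs at most 4 e; if Mc is not small, the term EAcI dAc of
    PAcII covers it. *)
Lemma region_growth : pi0 a * pi1 a * zeta a / 4 <= Mc b ->
  4 * e0 <= EAcI a r b k' * dAc a r b k'.
Proof.
move=> hM; have d0 := dAc_gt0; have EI := ler_wpM2r (ltW d0) EAcI_ge.
apply: le_trans EI.
have [g0 gr] := gamma_root S k' Hmu; have t1 := tau_gt1 S.
have /andP[p00 p01] := pi0_bounds S.
have y0 := pz_gt0 S; have cE := chiE S; have dE := DfeasE S k'; have aE := dAcE.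
have den := chi_den_gt0 S; have ed := e0_ge0 S k'.
have w0 : 0 < pi0 a * (pi1 a * zeta a) by rewrite mulr_gt0.
have t10 : 0 < tau a - 1 by rewrite subr_gt0.
have Z : 0 < xi a * mx * Mb := xmM_gt0 S.
rewrite -(ler_pM2r Z) -(ler_pM2r w0) -(ler_pM2r t10).
have q1 : (E + gam) * dAc a r b k' * (xi a * mx * Mb) * (pi0 a * (pi1 a * zeta a)) * (tau a - 1)
  = tau a * (pi0 a * pi1 a ^+ 2 * zeta a ^+ 2) * (gam * (gam + E)).
  transitivity ((E + gam) * (dAc a r b k' * (tau a - 1)) * (xi a * mx * Mb) * (pi0 a * (pi1 a * zeta a))).
    by ring.
  rewrite aE; transitivity ((E + gam) * tau a * (DF * (xi a * mx * Mb)) * (pi0 a * (pi1 a * zeta a))).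
    by ring.
  by rewrite dE; ring.
rewrite q1 -cE.
have q2 := ler_wpM2l (ltW (mulr_gt0 (tau_gt0 S) den)) (ltW gr).
have q3 : 0 <= e0 * (xi a * mx * Mb) by rewrite mulr_ge0 // ltW.
have q4 : 4 * (tau a - 1) <= tau a ^+ 2 by have := sqr_ge0 (tau a - 2); lra.
have q5 : (pi0 a * (pi1 a * zeta a)) * (tau a - 1) <= Mc b * tau a ^+ 2.
  have : 0 <= (Mc b - pi0 a * pi1 a * zeta a / 4) * tau a ^+ 2.
    by rewrite mulr_ge0 ?sqr_ge0 // subr_ge0.
  have := ler_wpM2l (ltW w0) q4; lra.
have q6 := ler_wpM2l q3 q5.
apply: (@le_trans _ _ (tau a * (2 * tau a * xi a * Mc b * mx * Mb) * (2 * e0))); last first.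
  by apply: le_trans q2 _; rewrite le_eqVlt; apply/orP; left; apply/eqP; ring.
by lra.
Qed.

Lemma GbarAcI_ge0 k : inC k -> (0 <= GbarAcI P a r b k')%E.
Proof.
move=> Ck; apply: (@le_trans _ _ (norm2 (g P (x k)))%:E); first by rewrite lee_fin norm2_ge0.
by apply: ereal_sup_ubound; exists (x k).
Qed.

Lemma PAcII_ge k : inC k -> ((EAcI a r b k' * dAc a r b k')%:E <= PAcII P a r b k')%E.
Proof.
move=> Ck; rewrite /PAcII EFinM; apply: lee_wpmul2r.
- by rewrite lee_fin ltW // dAc_gt0.
- rewrite -addeA; apply: (@le_trans _ _ (0 + (EAcI a r b k')%:E)%E); first by rewrite add0e.
  apply: leeD.
    by apply: mule_ge0; [exact: GbarAcI_ge0 Ck | rewrite lee_fin invr_ge0 (nu_ge0 S)].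
  rewrite -EFinD lee_fin lerDl mulr_ge0 ?(ltW dAc_gt0) //.
  by rewrite addr_ge0 ?divr_ge0 ?(Lf_ge0 S) ?(nu_ge0 S) ?(Lc_ge0 S).
Qed.

(** Two regimes, according to the size of Mc, because neither estimate of the
    increase fits the region in both. *)
Lemma first_step k : nu r k' <= nu r k ->
  inC k -> ~ inC k.+1 -> accepted P a r k -> D k <= DF / tau a ->
  ((Phi P (x k.+1) (nu r k))%:E
    <= (Phi P (x k) (nu r k))%:E + Order.max (PAcII P a r b k') (2 * e0)%:E)%E.
Proof.
move=> hk Ck nC1 ak Dk.
have [hM|hM] := leP (Mc b) (pi0 a * pi1 a * zeta a / 4).
  have := first_step_small S Hmu hk Ck nC1 ak Dk hM; rewrite -lee_fin [X in (_ <= X)%E]EFinD => h.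
  by apply: le_trans h _; apply: leeD => //; rewrite le_max lexx orbT.
have := accepted_phi_le S ak; have er := e_rate S hk; have n0 := nu_gt0 S k.
rewrite -!PhiE // => h.
have h2 : Phi P (x k.+1) (nu r k) <= Phi P (x k) (nu r k) + EAcI a r b k' * dAc a r b k'.
  rewrite -(ler_pM2l n0).
  by have := ler_wpM2l (ltW n0) (region_growth (ltW hM)); lra.
rewrite -lee_fin [X in (_ <= X)%E]EFinD in h2; apply: le_trans h2 _; apply: leeD => //.
by rewrite le_max (PAcII_ge Ck).
Qed.

(** The hypothesis compares merit parameters rather than indices, so that it also
    applies when the entry precedes the anchor but the parameter has already
    settled. *)
Lemma CAcI_stays K : nu r k' <= nu r K -> inC K ->
  forall k, (K <= k)%N -> in_CAcII P a r b k' k.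
Proof.
move=> hK CK k Kk; rewrite /in_CAcII.
set PB := PhibarAcI P a r b k'; set Q := Order.max (PAcII P a r b k') (2 * e0)%:E.
have ed := e0_ge0 S k'.
have PBge j : nu r k' <= nu r j -> inC j -> ((Phi P (x j) (nu r j))%:E <= PB)%E.
  by move=> hj Cj; apply: ereal_sup_ubound; exists (x j, nu r j).
have Qge : ((2 * e0)%:E <= Q)%E by rewrite le_max lexx orbT.
have EE : EAcII P a r b k' = (PB + Q + (2 * e0)%:E)%E by [].
have [finPQ|] := boolP ((PB + Q)%E \is a fin_num); last first.
  rewrite fin_numE negb_and !negbK => /orP[/eqP h|/eqP h].
    have : (-oo < PB + Q)%E.
      apply: (@lt_le_trans _ _ ((Phi P (x K) (nu r K))%:E + (2 * e0)%:E)%E).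
        by rewrite -EFinD ltNyr.
      by apply: leeD => //; exact: PBge.
    by rewrite h ltxx.
  by rewrite EE h addye // leey.
pose T := fine (PB + Q)%E + e0.
have TE : (PB + Q)%E = (T - e0)%:E by rewrite /T addrK fineK.
have h1 j : nu r k' <= nu r j -> inC j -> Phi P (x j) (nu r j) + 3 * e0 <= T.
  move=> hj Cj; have : ((Phi P (x j) (nu r j))%:E + (2 * e0)%:E <= (T - e0)%:E)%E.
    by rewrite -TE; apply: leeD => //; exact: PBge.
  by rewrite -EFinD lee_fin; lra.
have h2 j : nu r k' <= nu r j -> inC j -> ~ inC j.+1 -> accepted P a r j ->
     D j <= DF / tau a -> Phi P (x j.+1) (nu r j) + e0 <= T.
  move=> hj Cj nC aj Dj; have := first_step hj Cj nC aj Dj.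
  rewrite -/Q => h; have : ((Phi P (x j.+1) (nu r j))%:E <= (T - e0)%:E)%E.
    by rewrite -TE; apply: le_trans h _; apply: leeD => //; exact: PBge.
  by rewrite lee_fin; lra.
have hk : nu r k' <= nu r k := le_trans hK (nu_mono S Kk).
rewrite EE TE -EFinD lee_fin.
have [Ck|[hT _]] := feas_invariant S Hmu hK h1 h2 (or_introl CK) Kk.
  by have := h1 k hk Ck; lra.
by have := Phi_le_PhiT S (x k) hk; lra.
Qed.

End FeasibilityRegion.

(** * Full-rank Jacobians: merit parameters and the tangential step *)

Section Optimality.
Variables (R : realType) (n m : nat).
Variables (P : noisy_problem R n m) (a : parameters R) (r : run R n m).
Variables (b : constants R) (o : opt_constants R).
Hypothesis S : standing P a r b.
Hypothesis Hsv : jacobians_bounded_below P r o.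
Hypothesis Hgb : gradient_and_singular_value_bounds P r o.

Local Notation x k := (iterate r k).
Local Notation p k := (step r k).
Local Notation v k := (nstep r k).
Local Notation W k := (hess r k).
Local Notation D k := (Defs.radius r k).
Local Notation At k := (At_ P r k).
Local Notation ct k := (ct_ P r k).
Local Notation gt k := (gt_ P r k).
Local Notation pred k := (pred_at P r k (nu r k)).
Local Notation vp k := (vpred P r k).
Local Notation smin := (sigma_min o).
Local Notation smax := (sigma_max o).
Local Notation kap := (kappa o).
Local Notation G1 := (Gamma1 o).
Local Notation mn := (Num.min 1 (kap ^- 2 / 2)).

Lemma smin_gt0 : 0 < smin. Proof. by case: Hsv. Qed.
Lemma smax_gt0 : 0 < smax. Proof. by case: Hgb. Qed.
Lemma kap_gt0 : 0 < kap. Proof. exact: divr_gt0 smax_gt0 smin_gt0. Qed.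
Lemma kapE : kap * smin = smax.
Proof. by rewrite /kappa divfK // gt_eqF // smin_gt0. Qed.

Lemma gt_le k : norm2 (gt k) <= Mg o. Proof. by case: Hgb. Qed.
Lemma Mg_ge0 : 0 <= Mg o. Proof. exact: le_trans (norm2_ge0 _) (gt_le 0). Qed.

Lemma At_lower k w : smin * norm2 w <= norm2 ((At k)^T *m w).
Proof.
by case: Hsv => s0 hs; apply: singular_value_lower; [exact: ltW | exact: hs].
Qed.

Lemma AtT_upper k w : norm2 ((At k)^T *m w) <= smax * norm2 w.
Proof.
by case: Hgb => _ s0 hs; apply: singular_value_upper; [exact: ltW | exact: hs].
Qed.

Lemma At_upper k u : norm2 (At k *m u) <= smax * norm2 u.
Proof.
apply: norm2_le_dot => [|w w1]; first exact: mulr_ge0 (ltW smax_gt0) (norm2_ge0 _).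
rewrite dotC dot_tr dotC; apply: le_trans (cauchy_schwarz _ _) _.
by rewrite ler_wpM2r ?norm2_ge0 // (le_trans (AtT_upper _ _)) // w1 mulr1.
Qed.

(** The normal step lies in the range of At^T, on which At is bounded below. *)
Lemma range_lower k w : smin * norm2 ((At k)^T *m w) <= norm2 (At k *m ((At k)^T *m w)).
Proof.
set u := (At k)^T *m w.
have [h|h] := eqVneq (norm2 u) 0; first by rewrite h mulr0 norm2_ge0.
have u0 : 0 < norm2 u by rewrite lt_def h norm2_ge0.
rewrite -(ler_pM2r u0) -mulrA -expr2 norm2_sq.
have -> : dot u u = dot w (At k *m u) by rewrite {1}/u dot_tr trmxK.
have s0 := smin_gt0.
apply: le_trans (ler_wpM2l (ltW s0) (cauchy_schwarz _ _)) _.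
by rewrite mulrA mulrC ler_wpM2l ?norm2_ge0 // At_lower.
Qed.

Lemma v_range k : exists w, v k = (At k)^T *m w.
Proof. by have [_ [_ h _] _ _ _] := run_step S k. Qed.

Lemma v_lower k : smin * norm2 (v k) <= norm2 (At k *m v k).
Proof. by have [w ->] := v_range k; exact: range_lower. Qed.

Lemma v_le_radius k : norm2 (v k) <= zeta a * D k.
Proof. by have [_ [h _ _] _ _ _] := run_step S k. Qed.

Lemma Gamma1_min_gt0 : 0 < mn.
Proof. by rewrite lt_min ltr01 divr_gt0 // invr_gt0 exprn_gt0 // kap_gt0. Qed.

Lemma Gamma1_min_le1 : mn <= 1. Proof. by rewrite ge_min lexx. Qed.
Lemma Gamma1_min_leK : mn <= kap ^- 2 / 2. Proof. by rewrite ge_min lexx orbT. Qed.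

Lemma Gamma1E : G1 * (smin * mn) = 2.
Proof. by rewrite /Gamma1 divfK // gt_eqF // mulr_gt0 ?smin_gt0 ?Gamma1_min_gt0. Qed.

Lemma Gamma1_gt0 : 0 < G1.
Proof. by rewrite /Gamma1 divr_gt0 // mulr_gt0 ?smin_gt0 ?Gamma1_min_gt0. Qed.

Lemma Gamma1_geK : 4 * kap ^+ 2 <= G1 * smin.
Proof.
have k2 : 0 < kap ^+ 2 by rewrite exprn_gt0 // kap_gt0.
have := ler_wpM2l (mulr_ge0 (ltW Gamma1_gt0) (ltW smin_gt0)) Gamma1_min_leK.
rewrite -mulrA Gamma1E => h.
have := ler_wpM2r (ltW k2) h.
have -> : G1 * smin * (kap ^- 2 / 2) * kap ^+ 2 = G1 * smin / 2.
  by field; rewrite gt_eqF // kap_gt0.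
lra.
Qed.

Lemma stat_lower k : smin * norm2 (ct k) <= cstat P r k.
Proof. exact: At_lower. Qed.

(** As vpred_cauchy, with |ct| in place of its bound Mc: this makes the normal
    step proportional to vpred. *)
Lemma vpred_cauchy_sv k T : 0 <= T <= zeta a * D k ->
  smax ^+ 2 * T <= cstat P r k ->
  cstat P r k * T <= 2 * norm2 (ct k) * vp k.
Proof.
move=> hT hs; have [_ hv _ _ _] := run_step S k.
rewrite (vpredE S).
exact: (normal_cauchy_decrease hv (ltW smax_gt0) (At_upper k) hT hs).
Qed.

Lemma Atv_le2 k : norm2 (At k *m v k) <= 2 * norm2 (ct k).
Proof.
have [_ hv _ _ _] := run_step S k; have := normal_decrease_ge0 hv.
by have := norm2B_le (At k *m v k + ct k) (ct k); rewrite addrK; lra.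
Qed.

(** Since |v| <= 2 |ct| / sigma_min, a radius min(1, kappa^-2 / 2) |v| is small
    enough for the Cauchy estimate, where stationarity is at least sigma_min |ct|. *)
Lemma normal_step_le k : norm2 (v k) <= G1 * vp k.
Proof.
have X0 := norm2_ge0 (ct k); have s0 := smin_gt0; have m0 := Gamma1_min_gt0.
have hv := v_lower k; have hw := Atv_le2 k; have v0 := norm2_ge0 (v k).
have hs := stat_lower k; have vD := v_le_radius k.
have T1 : mn * norm2 (v k) <= norm2 (v k).
  by rewrite -[leRHS]mul1r ler_wpM2r ?Gamma1_min_le1.
have key : smax ^+ 2 * (mn * norm2 (v k)) <= cstat P r k.
  apply: le_trans hs.
  apply: (@le_trans _ _ (smax ^+ 2 * (kap ^- 2 / 2 * norm2 (v k)))).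
    by rewrite ler_wpM2l ?sqr_ge0 // ler_wpM2r ?Gamma1_min_leK.
  rewrite -kapE.
  have -> : (kap * smin) ^+ 2 * (kap ^- 2 / 2 * norm2 (v k)) = smin * (smin * norm2 (v k)) / 2.
    by field; rewrite gt_eqF // kap_gt0.
  have : smin * (smin * norm2 (v k)) <= smin * (2 * norm2 (ct k)).
    by rewrite ler_wpM2l ?(ltW s0) //; lra.
  lra.
have hc : cstat P r k * (mn * norm2 (v k)) <= 2 * norm2 (ct k) * vp k.
  apply: vpred_cauchy_sv => //; rewrite mulr_ge0 ?(ltW m0) //=; lra.
have [Xz|Xnz] := eqVneq (norm2 (ct k)) 0.
  have -> : norm2 (v k) = 0.
    rewrite Xz in hw; apply/eqP; rewrite eq_le v0 andbT -(pmulr_rle0 _ s0); lra.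
  exact: mulr_ge0 (ltW Gamma1_gt0) (vpred_ge0 S k).
have Xp : 0 < norm2 (ct k) by rewrite lt_def Xnz.
have h2 : smin * mn * norm2 (v k) <= 2 * vp k.
  rewrite -(ler_pM2l Xp).
  have := ler_wpM2r (mulr_ge0 (ltW m0) v0) hs; lra.
have := ler_wpM2l (ltW Gamma1_gt0) h2.
have -> : G1 * (smin * mn * norm2 (v k)) = 2 * norm2 (v k).
  by rewrite mulrA Gamma1E.
lra.
Qed.

Lemma vpred_le_Mc k : vp k <= Mc b.
Proof.
rewrite (vpredE S); have := norm2_ge0 (At k *m v k + ct k); have := ct_le S k; lra.
Qed.

Lemma normal_step_le_Mc k : norm2 (v k) <= G1 * Mc b.
Proof.
by apply: le_trans (normal_step_le k) _; rewrite ler_wpM2l ?vpred_le_Mc // ltW // Gamma1_gt0.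
Qed.

(** The variational inequality of the normal step, against the zero step. *)
Lemma Atv_sq k : norm2 (At k *m v k) ^+ 2 <= 2 * norm2 (ct k) * vp k.
Proof.
have [_ hv _ _ _] := run_step S k.
have D0 : 0 <= zeta a * D k := le_trans (norm2_ge0 _) (v_le_radius k).
have := normal_variational hv (u := 0); rewrite norm20 mulmx0 subr0 => /(_ D0).
have N := normal_decrease_ge0 hv.
rewrite (vpredE S); set N' := norm2 (_ + _) in N *; set X := norm2 (ct k) in N *.
have e1 : N' ^+ 2 = norm2 (At k *m v k) ^+ 2 + 2 * dot (ct k) (At k *m v k) + X ^+ 2.
  by rewrite /N' norm2D_sq (dotC (ct k)).
rewrite dotDl -norm2_sq => h.
have N0 : 0 <= N' := norm2_ge0 _.
have : (X - N') * (X - N') >= 0 by rewrite -expr2 sqr_ge0.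
nra.
Qed.

(** The constant is linear in kappa, better than what the bound on |v| would give,
    and the budget of small phases relies on it. *)
Lemma Atv_le_vpred k : norm2 (At k *m v k) <= 2 * kap * vp k.
Proof.
have X0 := norm2_ge0 (ct k); have s0 := smin_gt0; have k0 := kap_gt0.
have v0 := norm2_ge0 (v k); have hs := stat_lower k; have vD := v_le_radius k.
have w0 := norm2_ge0 (At k *m v k); have p0 := vpred_ge0 S k.
have [Xz|Xnz] := eqVneq (norm2 (ct k)) 0.
  have := Atv_le2 k; rewrite Xz => h.
  by have := mulr_ge0 (mulr_ge0 (ler0n R 2) (ltW k0)) p0; lra.
have Xp : 0 < norm2 (ct k) by rewrite lt_def Xnz.
have [c1|c2] := leP (smax ^+ 2 * norm2 (v k)) (cstat P r k).
  have hT : 0 <= norm2 (v k) <= zeta a * D k by rewrite v0 vD.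
  have h := vpred_cauchy_sv hT c1.
  have h2 : smin * norm2 (v k) <= 2 * vp k.
    by rewrite -(ler_pM2l Xp); have := ler_wpM2r v0 hs; lra.
  have := At_upper k (v k); rewrite -kapE => h3.
  by have := ler_wpM2l (ltW k0) h2; lra.
have hh : 0 <= cstat P r k := norm2_ge0 _.
have S2 : 0 < smax ^+ 2 by rewrite exprn_gt0 // smax_gt0.
pose T := cstat P r k / smax ^+ 2.
have T0 : 0 <= T by rewrite divr_ge0 // ltW.
have TE : smax ^+ 2 * T = cstat P r k by rewrite /T mulrC divfK // gt_eqF.
have TD : T <= zeta a * D k.
  by apply: le_trans vD; rewrite -(ler_pM2l S2) TE ltW.
have hT : 0 <= T <= zeta a * D k by rewrite T0 TD.
have h : cstat P r k * T <= 2 * norm2 (ct k) * vp k.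
  by apply: vpred_cauchy_sv => //; rewrite TE.
have h1 : cstat P r k ^+ 2 <= smax ^+ 2 * (2 * norm2 (ct k) * vp k).
  by have := ler_wpM2l (ltW S2) h; rewrite mulrCA TE expr2.
have h2 : (smin * norm2 (ct k)) ^+ 2 <= cstat P r k ^+ 2.
  by rewrite ler_pXn2r ?nnegrE // mulr_ge0 // ltW.
have h3 : norm2 (ct k) <= 2 * kap ^+ 2 * vp k.
  have q : 0 < smin ^+ 2 * norm2 (ct k) by rewrite mulr_gt0 // exprn_gt0.
  rewrite -(ler_pM2l q).
  have := le_trans h2 h1; rewrite -kapE; lra.
have h4 := Atv_sq k.
have h5 : norm2 (At k *m v k) ^+ 2 <= (2 * kap * vp k) ^+ 2.
  by apply: le_trans h4 _; have := ler_wpM2r p0 h3; rewrite !expr2; lra.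
have q := mulr_ge0 (mulr_ge0 (ler0n R 2) (ltW k0)) p0.
by rewrite -(@ler_pXn2r _ 2) ?nnegrE.
Qed.

(** Bounds the increase of the objective model along the normal step, per unit of
    vpred. *)
Definition Qnorm : R := (Mg o + MW b * Mc b * G1 / 2) * G1.

Lemma Qnorm_fac_ge0 : 0 <= Mg o + MW b * Mc b * G1 / 2.
Proof.
rewrite addr_ge0 ?Mg_ge0 // divr_ge0 // mulr_ge0 ?(ltW Gamma1_gt0) //.
exact: mulr_ge0 (MW_ge0 S) (ltW (std_Mc S)).
Qed.

Lemma Qnorm_ge0 : 0 <= Qnorm.
Proof. exact: mulr_ge0 Qnorm_fac_ge0 (ltW Gamma1_gt0). Qed.

Lemma qmodel_normal_le k : qmodel (gt k) (W k) (v k) <= Qnorm * vp k.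
Proof.
rewrite (qmodelE P r k).
have h1 := cauchy_schwarz (gt k) (v k); have h2 := cauchy_schwarz (v k) (W k *m v k).
have h3 := W_le S k (v k); have v0 := norm2_ge0 (v k).
have h4 : norm2 (gt k) * norm2 (v k) <= Mg o * norm2 (v k) by rewrite ler_wpM2r ?gt_le.
have h5 : norm2 (v k) * norm2 (W k *m v k) <= norm2 (v k) * (MW b * norm2 (v k)).
  by rewrite ler_wpM2l.
have h6 : norm2 (v k) * (MW b * norm2 (v k)) <= norm2 (v k) * (MW b * (G1 * Mc b)).
  by rewrite ler_wpM2l // ler_wpM2l ?(MW_ge0 S) // normal_step_le_Mc.
have := ler_wpM2l Qnorm_fac_ge0 (normal_step_le k).
rewrite /Qnorm; lra.
Qed.

Lemma qmodel_step_le k : qmodel (gt k) (W k) (p k) <= qmodel (gt k) (W k) (v k).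
Proof.
have [_ _ [_ _ h] _ _] := run_step S k; apply: h => //.
apply: le_trans (v_le_radius k) _; rewrite -[leRHS]mul1r ler_wpM2r ?(radius_ge0 S) //.
by case/andP: (zeta_bounds S) => _ /ltW.
Qed.

Lemma nubarE : nubar a b o * (1 - pi1 a) = tau a * Qnorm.
Proof.
have : 1 - pi1 a != 0 by rewrite subr_eq0 gt_eqF //; case/andP: (pi1_bounds S).
by move=> h; rewrite /nubar /Qnorm; field.
Qed.

(** If the parameter was increased, then its previous value failed the test, hence
    was at most Qnorm / (1 - pi1). *)
Lemma nu_le_max k : nu r k <= Num.max (nu_prev r k) (nubar a b o).
Proof.
have [_ _ _ [j [jE hstop hloop]] _] := run_step S k.
case: j jE hloop => [|j] jE hloop; first by rewrite jE expr0 mulr1 le_max lexx.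
rewrite le_max; apply/orP; right.
have /andP[p10 p11] := pi1_bounds S.
have p1 : 0 < 1 - pi1 a by lra.
have := hloop j (leqnn _); rewrite /pred_at; set w := nu_prev r k * tau a ^+ j => hl.
have nE : nu r k = w * tau a by rewrite jE exprSr mulrA.
move: hstop; rewrite /pred_at => hs.
have q1 := qmodel_normal_le k; have q2 := qmodel_step_le k.
have p0 := vpred_ge0 S k.
have vpos : 0 < vp k.
  rewrite lt_def p0 andbT; apply/eqP => vz; move: hs hl; rewrite vz; lra.
have h : (1 - pi1 a) * w <= Qnorm.
  by rewrite -(ler_pM2r vpos); lra.
rewrite -(ler_pM2r p1) nubarE nE.
by have := ler_wpM2l (ltW (tau_gt0 S)) h; lra.
Qed.

Lemma nu_bounded k : nu r k <= Num.max (nu_init r) (nubar a b o).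
Proof.
elim: k => [|k IH]; first exact: nu_le_max 0%N.
by apply: le_trans (nu_le_max k.+1) _; rewrite ge_max IH le_max lexx orbT.
Qed.

Local Notation G2 := (Gamma2 a r b o).

Lemma Gamma2_inv : G2^-1 = 1 + Qnorm / (pi1 a * nu r 0%N).
Proof. by rewrite /Gamma2 invrK /Qnorm mulrA. Qed.

Lemma Gamma2_inv_ge1 : 1 <= G2^-1.
Proof.
rewrite Gamma2_inv lerDl divr_ge0 ?Qnorm_ge0 // mulr_ge0 ?(nu_ge0 S) //.
by case/andP: (pi1_bounds S) => /ltW.
Qed.

Lemma Gamma2_gt0 : 0 < G2.
Proof. by rewrite -invr_gt0 (lt_le_trans ltr01) // Gamma2_inv_ge1. Qed.

Lemma Gamma2_le1 : G2 <= 1.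
Proof.
rewrite -[leLHS]mulr1; apply: le_trans (ler_wpM2l (ltW Gamma2_gt0) Gamma2_inv_ge1) _.
by rewrite mulfV // gt_eqF // Gamma2_gt0.
Qed.

(** Decrease of the objective model over the tangential part of the step. *)
Definition hpred k : R := qmodel (gt k) (W k) (v k) - qmodel (gt k) (W k) (p k).

(** The normal step may increase the objective model, by at most Qnorm vpred, and
    vpred is at most pred / (pi1 nu_0). *)
Lemma pred_ge_hpred k : G2 * hpred k <= pred k.
Proof.
have q1 := qmodel_normal_le k; have pg := pred_gt S k.
have /andP[p10 p11] := pi1_bounds S; have n0 := nu_gt0 S 0; have nk := nu_mono S (leq0n k).
have p0 := vpred_ge0 S k; have Q0 := Qnorm_ge0.
have w0 : 0 < pi1 a * nu r 0%N by rewrite mulr_gt0.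
have h1 : vp k <= pred k / (pi1 a * nu r 0%N).
  rewrite ler_pdivlMr //; apply: le_trans (ltW pg).
  by rewrite mulrC ler_wpM2r // ler_wpM2l // ltW.
have h2 : hpred k <= pred k * G2^-1.
  have nv : 0 <= nu r k * vp k := mulr_ge0 (nu_ge0 S k) p0.
  have -> : pred k * G2^-1 = pred k + Qnorm * (pred k / (pi1 a * nu r 0%N)).
    by rewrite Gamma2_inv; ring.
  have := ler_wpM2l Q0 h1; rewrite /hpred {2}/pred_at; lra.
have := ler_wpM2l (ltW Gamma2_gt0) h2.
by rewrite mulrCA mulfV ?mulr1 // gt_eqF // Gamma2_gt0.
Qed.

Section Tangential.
Variables (q : 'cV[R]_n -> nat) (Z Ztilde : forall y : 'cV[R]_n, 'M[R]_(n, q y)).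
Hypothesis HZ : kernel_bases P o Z Ztilde.

(** Reduced gradient of the model at the end of the normal step, in the noisy null
    space. *)
Definition redgrad k : R := norm2 ((Ztilde (x k))^T *m (gt k + W k *m v k)).

Lemma kernel_mul0 p' q' d (B : 'M[R]_(p', q')) (Y : 'M[R]_(q', d)) :
  orthonormal_kernel_basis B Y -> B *m Y = 0.
Proof.
case=> _ /andP[/sub_kermxP h _]; apply: trmx_inj.
by rewrite trmx_mul trmx0.
Qed.

Lemma orthonormal_isometry p' q' d (B : 'M[R]_(p', q')) (Y : 'M[R]_(q', d)) u :
  orthonormal_kernel_basis B Y -> norm2 (Y *m u) = norm2 u.
Proof.
case=> hY _; have : norm2 (Y *m u) ^+ 2 = norm2 u ^+ 2.
  by rewrite !norm2_sq dot_tr mulmxA hY mul1mx.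
by move/eqP; rewrite eqrXn2 ?norm2_ge0 // => /eqP.
Qed.

Lemma orthonormal_tr_le p' q' d (B : 'M[R]_(p', q')) (Y : 'M[R]_(q', d)) u :
  orthonormal_kernel_basis B Y -> norm2 (Y^T *m u) <= norm2 u.
Proof.
move=> hY; apply: norm2_le_dot => [|w w1]; first exact: norm2_ge0.
rewrite -dot_tr; apply: le_trans (cauchy_schwarz _ _) _.
by rewrite (orthonormal_isometry _ hY) w1 mul1r.
Qed.

(** Cauchy decrease in the null space: move from the normal step along the
    negative reduced gradient, by length T. *)
Lemma hpred_cauchy k T : 0 <= T <= (1 - zeta a) * D k -> MW b * T <= redgrad k ->
  redgrad k * T / 2 <= hpred k.
Proof.
move=> /andP[T0 TD] hM.
have [_ hZt _] := HZ (x k); set Y := Ztilde (x k) in hZt.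
set rho := Y^T *m (gt k + W k *m v k).
have rE : redgrad k = norm2 rho by [].
have hp0 : 0 <= hpred k by rewrite subr_ge0 qmodel_step_le.
have [rz|rnz] := eqVneq (redgrad k) 0; first by rewrite rz !mul0r.
have rp : 0 < redgrad k by rewrite lt_def rnz rE norm2_ge0.
pose t := T / redgrad k.
have t0 : 0 <= t by rewrite divr_ge0 // ltW.
have tE : t * redgrad k = T by rewrite /t divfK.
pose d := Y *m rho.
have dn : norm2 d = redgrad k by rewrite /d (orthonormal_isometry _ hZt) rE.
pose u := v k - t *: d.
have un : norm2 u <= D k.
  apply: le_trans (norm2B_le _ _) _; rewrite norm2Z ger0_norm // dn tE.
  by have := v_le_radius k; lra.
have uA : At k *m u = At k *m v k.
  by rewrite /u mulmxBr -scalemxAr /d mulmxA (kernel_mul0 hZt) mul0mx scaler0 subr0.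
have [Ws _ [_ _ h] _ _] := run_step S k.
have qu : qmodel (gt k) (W k) (p k) <= qmodel (gt k) (W k) u by apply: h => //; rewrite uA.
have gd : dot (gt k + W k *m v k) d = redgrad k ^+ 2.
  by rewrite rE norm2_sq /d dotC dot_tr.
have Wd : dot d (W k *m d) <= MW b * redgrad k ^+ 2.
  apply: le_trans (cauchy_schwarz _ _) _; rewrite dn.
  have := W_le S k d; rewrite dn => h1.
  by have := ler_wpM2l (ltW rp) h1; rewrite expr2; lra.
have quE : qmodel (gt k) (W k) u = qmodel (gt k) (W k) (v k)
   - t * dot (gt k + W k *m v k) d + t ^+ 2 / 2 * dot d (W k *m d).
  rewrite !(qmodelE P r k) /u mulmxBr -scalemxAr; move: (gt k) => gg.
  have sym : dot d (W k *m v k) = dot (v k) (W k *m d) by rewrite dotC dot_tr Ws.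
  rewrite !dotE_lin sym (dotC (W k *m v k) d) sym; move: (W k *m v k) (W k *m d) => w1 w2.
  by field.
rewrite gd in quE.
have T2 : t ^+ 2 * (MW b * redgrad k ^+ 2) = T * (MW b * T) by rewrite -tE; ring.
have T3 : t * redgrad k ^+ 2 = T * redgrad k by rewrite -tE; ring.
have := ler_wpM2l (sqr_ge0 t) Wd; rewrite T2.
have := ler_wpM2l T0 hM.
rewrite /hpred; lra.
Qed.

End Tangential.

End Optimality.

(** * Steps taken away from optimality, and returns to its region *)

Section OptimalityRegion.
Variables (R : realType) (n m : nat).
Variables (P : noisy_problem R n m) (a : parameters R) (r : run R n m).
Variables (b : constants R) (o : opt_constants R).
Variables (q : 'cV[R]_n -> nat) (Z Ztilde : forall y : 'cV[R]_n, 'M[R]_(n, q y)).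
Variable k' : nat.
Hypothesis S : standing P a r b.
Hypothesis Hmu : 0 < mu b.
Hypothesis Hmuhat : 0 < muhat b.
Hypothesis Hsv : jacobians_bounded_below P r o.
Hypothesis HZ : kernel_bases P o Z Ztilde.
Hypothesis Hgb : gradient_and_singular_value_bounds P r o.
Hypothesis Hinit : nu_init r <= nubar a b o.
Hypothesis HML : 0 < ML b (nubar a b o).

Local Notation x k := (iterate r k).
Local Notation v k := (nstep r k).
Local Notation W k := (hess r k).
Local Notation D k := (Defs.radius r k).
Local Notation At k := (At_ P r k).
Local Notation ct k := (ct_ P r k).
Local Notation gt k := (gt_ P r k).
Local Notation pred k := (pred_at P r k (nu r k)).
Local Notation vp k := (vpred P r k).
Local Notation smin := (sigma_min o).
Local Notation G1 := (Gamma1 o).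
Local Notation G2 := (Gamma2 a r b o).
Local Notation nb := (nubar a b o).
Local Notation Mlb := (ML b (nubar a b o)).
Local Notation EH := (Eh a r b o).
Local Notation gb := (gammabar a r b o).
Local Notation eb := (epsbar a b o).
Local Notation Th := (Theta a r b o).
Local Notation rg k := (redgrad P r Ztilde k).
Local Notation hp k := (hpred P r k).
Local Notation inG k := (CgZI P a r b o k' Z (iterate r k)).

Lemma nu_le_nubar k : nu r k <= nb.
Proof.
by apply: le_trans (nu_bounded S Hsv Hgb k) _; rewrite ge_max Hinit lexx.
Qed.

Lemma nubar_gt0 : 0 < nb. Proof. exact: lt_le_trans (nu_gt0 S 0) (nu_le_nubar 0). Qed.

Lemma G2_gt0 : 0 < G2. Proof. exact: Gamma2_gt0 S Hsv Hgb. Qed.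
Lemma G2_le1 : G2 <= 1. Proof. exact: Gamma2_le1 S Hsv Hgb. Qed.
Lemma zc_gt0 : 0 < 1 - zeta a.
Proof. by rewrite subr_gt0; case/andP: (zeta_bounds S). Qed.
Lemma Gz_gt0 : 0 < G2 * (1 - zeta a). Proof. exact: mulr_gt0 G2_gt0 zc_gt0. Qed.

Lemma ML_geW : Lf b + MW b <= Mlb. Proof. by rewrite le_max lexx. Qed.
Lemma ML_geLc k : nu r k * Lc b <= Mlb.
Proof.
apply: (@le_trans _ _ (nb * Lc b)); last by rewrite le_max lexx orbT.
by rewrite ler_wpM2r ?(Lc_ge0 S) // nu_le_nubar.
Qed.

Lemma Theta_den_gt0 : 0 < 2 * tau a * xi a * Mlb.
Proof.
apply: mulr_gt0 HML; apply: mulr_gt0 (xi_gt0 S).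
by rewrite mulr_gt0 ?(tau_gt0 S).
Qed.

Lemma ThetaE : Th * (2 * tau a * xi a * Mlb) = pi0 a * G2 ^+ 2 * (1 - zeta a) ^+ 2.
Proof. by rewrite /Theta divfK // gt_eqF // Theta_den_gt0. Qed.

Lemma Theta_gt0 : 0 < Th.
Proof.
have /andP[p00 _] := pi0_bounds S.
apply: divr_gt0 Theta_den_gt0; apply: mulr_gt0; last by rewrite exprn_gt0 // zc_gt0.
by rewrite mulr_gt0 // exprn_gt0 // G2_gt0.
Qed.

Lemma EhE : EH * (G2 * (1 - zeta a)) = xi a * (epsg b + nb * epsA b).
Proof. by rewrite /Eh mulrAC divfK // gt_eqF // Gz_gt0. Qed.

Lemma gA_ge0 : 0 <= epsg b + nb * epsA b.
Proof. exact: addr_ge0 (epsg_ge0 S) (mulr_ge0 (ltW nubar_gt0) (epsA_ge0 S)). Qed.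

Lemma Eh_ge0 : 0 <= EH.
Proof. exact: mulr_ge0 (divr_ge0 (ltW (xi_gt0 S)) (ltW Gz_gt0)) gA_ge0. Qed.

Lemma eb_ge0 : 0 <= eb.
Proof. exact: addr_ge0 (epsf_ge0 S) (mulr_ge0 (ltW nubar_gt0) (epsc_ge0 S)). Qed.

Lemma eb_ge k : epsf a + nu r k * epsc a <= eb.
Proof. by rewrite lerD2l ler_wpM2r ?(epsc_ge0 S) // nu_le_nubar. Qed.

Lemma gammabar_root : 0 < gb /\ 2 * eb < Th * (gb * (gb + EH)).
Proof.
have T0 := Theta_gt0.
have K0 : 0 <= 2 * eb / Th := divr_ge0 (mulr_ge0 (ler0n R 2) eb_ge0) (ltW T0).
have := quadratic_threshold Eh_ge0 K0 Hmuhat.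
have -> : 4 * (2 * eb / Th) = 8 * (epsf a + nb * epsc a) / Th.
  by rewrite /epsbar; field; rewrite gt_eqF.
rewrite /= -/(gammabar a r b o) => -[g0]; rewrite ltr_pdivrMr // => h.
by split=> //; rewrite [X in _ < X]mulrC.
Qed.

Lemma gammabar_gt0 : 0 < gb. Proof. exact: gammabar_root.1. Qed.

(** The analogue of Dfeas: the largest radius at which model errors are dominated
    by the tangential decrease. *)
Definition Dopt : R := G2 * (1 - zeta a) / (xi a * Mlb) * gb.

Lemma xML_gt0 : 0 < xi a * Mlb. Proof. exact: mulr_gt0 (xi_gt0 S) HML. Qed.

Lemma DoptE : Dopt * (xi a * Mlb) = G2 * (1 - zeta a) * gb.
Proof. by rewrite /Dopt mulrAC divfK // gt_eqF // xML_gt0. Qed.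

Lemma Dopt_gt0 : 0 < Dopt.
Proof. exact: mulr_gt0 (divr_gt0 Gz_gt0 xML_gt0) gammabar_gt0. Qed.

Lemma dgZE : dgZ a r b o * (tau a - 1) = tau a * Dopt.
Proof.
have t1 : tau a - 1 != 0 by rewrite subr_eq0 gt_eqF // (tau_gt1 S).
have X0 := gt_eqF (xi_gt0 S); have M0 := gt_eqF HML.
rewrite /dgZ /Dopt; move: X0 M0 t1; move: (xi a) Mlb (tau a) G2 gb => X M t G g X0 M0 t1.
by field; rewrite t1 X0 M0.
Qed.

Definition opt_good k := EH + gb < rg k.

Lemma Dopt_M : Mlb * Dopt <= gb.
Proof.
have h := DoptE; have x2 := xi_gt2 S; have g0 := gammabar_gt0; have G1' := G2_le1.
have /andP[z0 z1] := zeta_bounds S; have z := Gz_gt0.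
have MD0 : 0 < Mlb * Dopt := mulr_gt0 HML Dopt_gt0.
have q1 : G2 * (1 - zeta a) * gb <= 1 * gb.
  by rewrite ler_wpM2r ?(ltW g0) //; have := G2_gt0; nra.
have : 1 * (Mlb * Dopt) <= xi a * (Mlb * Dopt) by rewrite ler_wpM2r ?(ltW MD0) //; lra.
by move: h q1; lra.
Qed.

Lemma opt_hpred k T : opt_good k -> 0 <= T -> T <= D k -> T <= Dopt ->
  (1 - zeta a) * T * rg k / 2 <= hp k.
Proof.
move=> gk T0 TD TF; have z := zc_gt0; have /andP[z0 _] := zeta_bounds S.
have MW0 := MW_ge0 S; have WM : MW b <= Mlb by have := ML_geW; have := Lf_ge0 S; lra.
have := hpred_cauchy S HZ (k := k) (T := (1 - zeta a) * T).
rewrite mulr_ge0 ?(ltW z) //= ler_wpM2l ?(ltW z) // => /(_ isT).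
suff hM : MW b * ((1 - zeta a) * T) <= rg k by move=> /(_ hM); lra.
have := Dopt_M; have E0 := Eh_ge0; have g0 := gammabar_gt0.
have h1 : (1 - zeta a) * T <= Dopt.
  by apply: le_trans TF; rewrite -[leRHS]mul1r ler_wpM2r //; lra.
have h2 : MW b * ((1 - zeta a) * T) <= Mlb * Dopt.
  by apply: ler_pM => //; rewrite mulr_ge0 // ltW.
by move: gk; rewrite /opt_good; lra.
Qed.

Lemma opt_gap_rate k : D k <= Dopt ->
  model_gap r b k <= (1 - pi0 a) * (G2 * ((1 - zeta a) * D k * (EH + gb) / 2)).
Proof.
move=> Dk; have D0 := radius_gt0 S k; have x0 := xi_gt0 S.
have h1 : xi a * Mlb * D k <= G2 * (1 - zeta a) * gb.
  by rewrite -DoptE mulrC ler_wpM2r // ltW // xML_gt0.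
have h2 := EhE; have xE := xiE S.
have c1 : (Lf b + MW b + nu r k * Lc b) / 2 <= Mlb.
  by have := ML_geW; have := ML_geLc k; lra.
have c2 : epsg b + nu r k * epsA b <= epsg b + nb * epsA b.
  by rewrite lerD2l ler_wpM2r ?(epsA_ge0 S) // nu_le_nubar.
have g1 : model_gap r b k <= Mlb * D k ^+ 2 + (epsg b + nb * epsA b) * D k.
  by rewrite lerD // ler_wpM2r ?sqr_ge0 // ltW.
apply: le_trans g1 _; rewrite -(ler_pM2l x0).
have -> : xi a * ((1 - pi0 a) * (G2 * ((1 - zeta a) * D k * (EH + gb) / 2)))
  = (EH * (G2 * (1 - zeta a)) + G2 * (1 - zeta a) * gb) * D k.
  transitivity (xi a * (1 - pi0 a) * (G2 * ((1 - zeta a) * D k * (EH + gb) / 2))).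
    by move: (xi a) (G2) (EH) gb => X G E0 g0; ring.
  by rewrite xE; move: G2 EH gb => G E0 g0; field.
rewrite h2; have := ler_wpM2r (ltW D0) h1; rewrite expr2; lra.
Qed.

Lemma opt_small k : opt_good k -> D k <= Dopt ->
  accepted P a r k /\
  phi P (x k.+1) (nu r k) <= phi P (x k) (nu r k) - pi0 a * pred k + nu r k * brace P r k.
Proof.
move=> gk Dk; have D0 := radius_gt0 S k; have z := zc_gt0.
have gap := opt_gap_rate Dk.
have hh := opt_hpred gk (ltW D0) (lexx _) Dk.
have ph := pred_ge_hpred S Hsv Hgb k.
have /andP[p00 p01] := pi0_bounds S; have p1 : 0 < 1 - pi0 a by lra.
have lt1 : (1 - zeta a) * D k * (EH + gb) / 2 < hp k.
  apply: lt_le_trans hh; rewrite ltr_pM2r ?invr_gt0 //.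
  by rewrite ltr_pM2l // mulr_gt0.
have lt2 : G2 * ((1 - zeta a) * D k * (EH + gb) / 2) < pred k.
  by apply: lt_le_trans ph; rewrite ltr_pM2l ?G2_gt0.
have lt3 : model_gap r b k < (1 - pi0 a) * pred k.
  by apply: le_lt_trans gap _; rewrite ltr_pM2l.
have acc : accepted P a r k := accept_of_gap S lt3.
split => //; have [-> _] := acceptedP S acc.
apply: le_trans (phi_step S k) _; lra.
Qed.

Definition eta_opt : R := Th * (gb * (gb + EH)) - 2 * eb.
Lemma eta_opt_gt0 : 0 < eta_opt.
Proof. by rewrite subr_gt0; exact: gammabar_root.2. Qed.

Lemma opt_large k : opt_good k -> Dopt / tau a <= D k -> accepted P a r k ->
  phitilde P (x k.+1) (nu r k) <= phitilde P (x k) (nu r k) - eta_opt.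
Proof.
move=> gk Dk acc; apply: le_trans (accepted_decrease S acc) _.
have t1 := tau_gt1 S; have t0 := tau_gt0 S; have er := eb_ge k.
have T0 : 0 <= Dopt / tau a := divr_ge0 (ltW Dopt_gt0) (ltW t0).
have TF : Dopt / tau a <= Dopt.
  by rewrite ler_pdivrMr // -[leLHS]mulr1 ler_wpM2l ?(ltW Dopt_gt0) // ltW.
have hh := opt_hpred gk T0 Dk TF; have ph := pred_ge_hpred S Hsv Hgb k.
have /andP[p00 p01] := pi0_bounds S; have g0 := gammabar_gt0; have E0 := Eh_ge0.
have z := zc_gt0; have gg := G2_gt0.
suff : Th * (gb * (gb + EH)) <= pi0 a * pred k by rewrite /eta_opt; lra.
apply: (@le_trans _ _ (pi0 a * (G2 * ((1 - zeta a) * (Dopt / tau a) * (EH + gb) / 2)))).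
  rewrite le_eqVlt; apply/orP; left; apply/eqP.
  have w0 := Theta_den_gt0.
  apply: (mulIf (lt0r_neq0 w0)).
  transitivity (Th * (2 * tau a * xi a * Mlb) * (gb * (gb + EH))); first by ring.
  rewrite ThetaE; transitivity (pi0 a * (G2 * ((1 - zeta a) * (Dopt * (xi a * Mlb)) * (EH + gb)))).
    by rewrite DoptE; ring.
  by field; rewrite gt_eqF.
rewrite ler_wpM2l ?(ltW p00) //; apply: le_trans ph; rewrite ler_wpM2l ?(ltW gg) //.
apply: le_trans hh; rewrite ler_wpM2r ?invr_ge0 // ler_wpM2l ?(ltW gk) //.
exact: mulr_ge0 (ltW z) T0.
Qed.

(** Splits the projected gradient into the reduced gradient, the curvature along
    the normal step, which is controlled by stationarity, and the noise in g and
    Z. *)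
Lemma gZnorm_le k :
  gZnorm P Z (x k) <= rg k + G1 * MW b / smin * cstat P r k
     + (epsg b + epsZ o * norm2 (g P (x k))).
Proof.
have [hz hzt hd] := HZ (x k); set Y := Z (x k) in hz hd *; set Yt := Ztilde (x k) in hzt hd *.
have -> : gZnorm P Z (x k) = norm2 (Y^T *m g P (x k)).
  by rewrite /gZnorm trmx_mul trmxK.
have -> : Y^T *m g P (x k) = Yt^T *m (gt k + W k *m v k) - Yt^T *m (W k *m v k)
   - Yt^T *m deltag P (x k) - (Yt - Y)^T *m g P (x k).
  have -> : (Yt - Y)^T = Yt^T - Y^T by apply/matrixP => i j; rewrite !mxE.
  rewrite mulmxBl mulmxDr /gt_ /gtilde mulmxDr.
  move: (Yt^T *m g _ _) (Yt^T *m deltag _ _) (Yt^T *m (_ *m _)) (Y^T *m _) => X1 X2 X3 X4.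
  by apply/colP => i; rewrite !mxE; ring.
set u1 := Yt^T *m (_ + _); set u2 := Yt^T *m (_ *m _).
set u3 := Yt^T *m _; set u4 := (_ - _)^T *m _.
have t1 := norm2B_le (u1 - u2 - u3) u4; have t2 := norm2B_le (u1 - u2) u3.
have t3 := norm2B_le u1 u2.
have b1 : norm2 u1 = rg k by [].
have b4 : norm2 u4 <= epsZ o * norm2 (g P (x k)) := opnorm_tr_le _ hd.
have b3 : norm2 u3 <= epsg b.
  by apply: le_trans (orthonormal_tr_le _ hzt) _; have [_ _ h _] := std_noise S (x k).
have b2 : norm2 u2 <= G1 * MW b / smin * cstat P r k.
  apply: le_trans (orthonormal_tr_le _ hzt) _.
  apply: le_trans (W_le S k _) _.
  have h1 := normal_step_le S Hsv Hgb k.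
  have h2 : vp k <= norm2 (ct k).
    by rewrite (vpredE S); have := norm2_ge0 (At k *m v k + ct k); lra.
  have h3 := stat_lower Hsv k; have s0 := smin_gt0 Hsv.
  have g10 := Gamma1_gt0 Hsv Hgb.
  have h4 : norm2 (v k) <= G1 * (cstat P r k / smin).
    apply: le_trans h1 _; rewrite ler_wpM2l ?(ltW g10) //; apply: le_trans h2 _.
    by rewrite ler_pdivlMr // mulrC.
  have := ler_wpM2l (MW_ge0 S) h4.
  by have -> : G1 * MW b / smin * cstat P r k = MW b * (G1 * (cstat P r k / smin)) by ring.
lra.
Qed.

Lemma in_CAcII_point k : in_CAcII P a r b k' k -> CAcII P a r b k' (x k).
Proof. by move=> h; exists k. Qed.

Lemma epsZ_ge0 : 0 <= epsZ o.
Proof. by have [_ _ h] := HZ (x 0); apply: le_trans (opnorm_ge0 _) h. Qed.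

Lemma opt_good_notC k : in_CAcII P a r b k' k -> ~ inG k -> opt_good k.
Proof.
move=> /in_CAcII_point hk /negP; rewrite -ltNge => hG.
have g10 := Gamma1_gt0 Hsv Hgb; have s0 := smin_gt0 Hsv.
have c0 : 0 <= G1 * MW b / smin := divr_ge0 (mulr_ge0 (ltW g10) (MW_ge0 S)) (ltW s0).
have h1 : ((cstat P r k)%:E <= calEAcII P a r b k')%E.
  by apply: ereal_sup_ubound; exists (x k).
have h2 : ((norm2 (g P (x k)))%:E <= GbarAcII P a r b k')%E.
  by apply: ereal_sup_ubound; exists (x k).
have h3 : ((epsg b + epsZ o * norm2 (g P (x k)) + epsg b * epsZ o)%:E
    <= eps_gZ P a r b o k')%E.
  rewrite /eps_gZ EFinD [X in (X + _ <= _)%E]EFinD EFinM.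
  apply: leeD => //; apply: leeD => //.
  by apply: lee_wpmul2l => //; rewrite lee_fin epsZ_ge0.
have h4 : ((EH + G1 * MW b / smin * cstat P r k
   + (epsg b + epsZ o * norm2 (g P (x k)) + epsg b * epsZ o) + gb)%:E
   <= EgZI P a r b o k')%E.
  rewrite /EgZI; move: EH gb => A0 B0.
  rewrite 3!EFinD; apply: leeD => //; apply: leeD => //.
  by apply: leeD => //; rewrite EFinM; apply: lee_wpmul2l => //; rewrite lee_fin.
have := le_lt_trans h4 hG; rewrite lte_fin => h5.
have := gZnorm_le k; have := mulr_ge0 (epsg_ge0 S) epsZ_ge0.
rewrite /opt_good; lra.
Qed.

Lemma eps_gZ_ge0 k : in_CAcII P a r b k' k -> (0 <= eps_gZ P a r b o k')%E.
Proof.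
move=> /in_CAcII_point hk.
have h2 : (0 <= GbarAcII P a r b k')%E.
  apply: (@le_trans _ _ (norm2 (g P (x k)))%:E); first by rewrite lee_fin norm2_ge0.
  by apply: ereal_sup_ubound; exists (x k).
rewrite /eps_gZ adde_ge0 ?adde_ge0 ?lee_fin ?(epsg_ge0 S) //.
  by rewrite mule_ge0 // lee_fin epsZ_ge0.
exact: mulr_ge0 (epsg_ge0 S) epsZ_ge0.
Qed.

(** Combines parts (i) and (ii), which keep the iterates in CAcII, with the same
    argument as in part (i). *)
Lemma opt_visits k'' : settled r k'' -> forall N, exists k,
  [/\ (N <= k)%N, inG k & ((gZnorm P Z (x k))%:E
                   <= EgZI P a r b o k' + eps_gZ P a r b o k')%E].
Proof.
move=> hset N.
have [K1 [kK1 CK1]] := feas_visits S k' Hmu k'.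
have inII k : (K1 <= k)%N -> in_CAcII P a r b k' k.
  exact: (CAcI_stays S Hmu (nu_mono S kK1) CK1).
suff [k [Nk Kk Gk]] : exists k, [/\ (N <= k)%N, (K1 <= k)%N & inG k].
  exists k; split => //; apply: le_trans Gk _.
  by rewrite leeDl //; apply: (@eps_gZ_ge0 k); exact: inII.
apply: contrapT => hno.
have out k : (maxn N K1 <= k)%N -> opt_good k.
  rewrite geq_max => /andP[Nk Kk]; apply: opt_good_notC; first exact: inII.
  by move=> hk; apply: hno; exists k.
apply: (@no_endless_decrease R (tau a) Dopt eta_opt (Defs.radius r)
  (fun k => phitilde P (x k) (nu r k'')) (accepted P a r) (maxn k'' (maxn N K1))).
- exact: tau_gt1 S.
- exact: Dopt_gt0.
- exact: eta_opt_gt0.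
- exact: radius_gt0 S.
- move=> k; exact: addr_ge0 (ltW (ft_gt0 S k)) (mulr_ge0 (nu_ge0 S k'') (norm2_ge0 _)).
- by move=> k /(acceptedP S) [].
- by move=> k /(rejectedP S) [].
- by move=> k; rewrite geq_max => /andP[_ /out gk] Dk; have [] := opt_small gk Dk.
- by move=> k _ rk; have [-> _] := rejectedP S rk.
- move=> k; rewrite geq_max => /andP[/hset kk /out gk] ak Dk.
  by have := opt_large gk Dk ak; rewrite kk.
Qed.

End OptimalityRegion.

(** * Windows of small steps *)

Section Window.
Variables (R : realType) (n m : nat).
Variables (P : noisy_problem R n m) (a : parameters R) (r : run R n m).
Variables (b : constants R) (o : opt_constants R).
Variables (q : 'cV[R]_n -> nat) (Z Ztilde : forall y : 'cV[R]_n, 'M[R]_(n, q y)).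
Hypothesis S : standing P a r b.
Hypothesis Hmuhat : 0 < muhat b.
Hypothesis Hsv : jacobians_bounded_below P r o.
Hypothesis HZ : kernel_bases P o Z Ztilde.
Hypothesis Hgb : gradient_and_singular_value_bounds P r o.
Hypothesis Hinit : nu_init r <= nubar a b o.
Hypothesis HML : 0 < ML b (nubar a b o).

Local Notation x k := (iterate r k).
Local Notation p k := (step r k).
Local Notation v k := (nstep r k).
Local Notation W k := (hess r k).
Local Notation D k := (Defs.radius r k).
Local Notation At k := (At_ P r k).
Local Notation ct k := (ct_ P r k).
Local Notation gt k := (gt_ P r k).
Local Notation cc k := (con P (iterate r k)).
Local Notation smin := (sigma_min o).
Local Notation G2 := (Gamma2 a r b o).
Local Notation nb := (nubar a b o).
Local Notation Mlb := (ML b (nubar a b o)).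
Local Notation EH := (Eh a r b o).
Local Notation gb := (gammabar a r b o).
Local Notation Dg := (Dopt a r b o).
Local Notation good k := (opt_good P a r b o Ztilde k).
Local Notation hp k := (hpred P r k).

(** The factor that turns Eh into the noise epsg + nubar epsA, and gammabar into
    the curvature term ML Dopt. *)
Definition rho_opt : R := G2 * (1 - zeta a) * (1 - pi0 a) / 2.
Local Notation ro := rho_opt.

Lemma rho_optE : ro * xi a = G2 * (1 - zeta a).
Proof.
have xE := xiE S; rewrite /rho_opt.
transitivity (G2 * (1 - zeta a) * (xi a * (1 - pi0 a)) / 2); last by rewrite xE; field.
by move: G2 (xi a) => G X; ring.
Qed.

Lemma rho_opt_ge0 : 0 <= ro.
Proof.
have z := zc_gt0 S; have g := G2_gt0 S Hsv Hgb.
have /andP[_ p01] := pi0_bounds S; have p1 : 0 < 1 - pi0 a by lra.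
exact: divr_ge0 (mulr_ge0 (mulr_ge0 (ltW g) (ltW z)) (ltW p1)) (ler0n R 2).
Qed.

Lemma rho_opt_le : ro <= (1 - zeta a) / 2.
Proof.
have z := zc_gt0 S; have g := G2_gt0 S Hsv Hgb; have g1 := G2_le1 S Hsv Hgb.
have /andP[p00 p01] := pi0_bounds S.
have h : G2 * (1 - pi0 a) <= 1 by nra.
by have := ler_wpM2l (ltW z) h; rewrite /rho_opt; lra.
Qed.

Lemma Eh_rho : EH * ro = epsg b + nb * epsA b.
Proof.
have h := EhE S Hsv Hgb; have x0 := xi_gt0 S.
apply: (mulIf (lt0r_neq0 x0)); by rewrite -[LHS]mulrA rho_optE h [LHS]mulrC.
Qed.

Lemma ML_rho : Mlb * Dg = ro * gb.
Proof.
have h := DoptE S HML; have x0 := xi_gt0 S.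
apply: (mulIf (lt0r_neq0 x0)).
transitivity (ro * xi a * gb); last by move: ro (xi a) gb => c1 c2 c3; ring.
by rewrite rho_optE -h [LHS]mulrC mulrCA mulrA [RHS]mulrC [xi a * _]mulrC.
Qed.

Lemma step_split_sq k :
  norm2 (v k) ^+ 2 + norm2 (p k - v k) ^+ 2 = norm2 (p k) ^+ 2.
Proof.
have [w vE] := v_range S k.
have h : dot (v k) (p k - v k) = 0.
  by rewrite {1}vE dot_tr trmxK mulmxBr (At_step S) subrr dot0r.
have := norm2D_sq (v k) (p k - v k).
by rewrite [v k + _]addrC subrK h mulr0 addr0 => ->.
Qed.

(** The tangential part of the step pays for all errors of the objective model, so
    that the objective changes at most by its linear part along the normal step. *)
Lemma opt_f_step k : accepted P a r k -> good k -> D k <= Dg ->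
  obj P (x k.+1) <= obj P (x k) + dot (g P (x k)) (v k).
Proof.
move=> ak gk Dk; have [-> _] := acceptedP S ak.
have D0 := radius_gt0 S k.
have h1 := f_taylor S (x k) (p k).
have [t tE] : exists t, t = p k - v k by eexists.
have pE : p k = v k + t by rewrite tE addrC subrK.
have sq := step_split_sq k; rewrite -tE in sq.
have sD : norm2 (p k) ^+ 2 <= D k ^+ 2.
  by rewrite ler_pXn2r ?nnegrE ?norm2_ge0 ?(ltW D0) // (step_le_radius S).
have t0 := norm2_ge0 t; have v0 := norm2_ge0 (v k).
have tD : norm2 t <= D k.
  rewrite -(@ler_pXn2r _ 2) ?nnegrE ?(ltW D0) //.
  by have := sqr_ge0 (norm2 (v k)); lra.
have vt : norm2 (v k) * norm2 t + norm2 t ^+ 2 / 2 <= D k ^+ 2.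
  by have := sqr_ge0 (norm2 (v k) - norm2 t); have := sqr_ge0 (norm2 (v k)); lra.
have [Ws _ _ _ _] := run_step S k.
have gp : dot (g P (x k)) (p k) = dot (g P (x k)) (v k) + dot (g P (x k)) t.
  by rewrite pE dotDr.
have gtt : dot (gt k) t = - hp k - dot t (W k *m v k) - dot t (W k *m t) / 2.
  have sym : dot (v k) (W k *m t) = dot t (W k *m v k) by rewrite [RHS]dotC dot_tr Ws.
  rewrite /hpred !(qmodelE P r k) pE mulmxDr; move: (gt k) => gg.
  by rewrite !dotDr !dotDl sym; field.
have gn : dot (gt k) t = dot (g P (x k)) t + dot (deltag P (x k)) t.
  by rewrite /gt_ /gtilde dotDl.
have c1 := cauchy_schwarzN (deltag P (x k)) t.
have [_ _ ng _] := std_noise S (x k).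
have c2 := cauchy_schwarzN t (W k *m v k); have c3 := cauchy_schwarzN t (W k *m t).
have MW0 := MW_ge0 S.
have d1 : norm2 (deltag P (x k)) * norm2 t <= epsg b * D k.
  by apply: ler_pM => //; exact: norm2_ge0.
have d2 : norm2 t * norm2 (W k *m v k) <= MW b * (norm2 (v k) * norm2 t).
  by have := ler_wpM2l t0 (W_le S k (v k)); lra.
have d3 : norm2 t * norm2 (W k *m t) <= MW b * norm2 t ^+ 2.
  by have := ler_wpM2l t0 (W_le S k t); rewrite expr2; lra.
have d4 := ler_wpM2l MW0 vt.
have d5 : Lf b / 2 * norm2 (p k) ^+ 2 <= Lf b / 2 * D k ^+ 2.
  by rewrite ler_wpM2l // divr_ge0 ?(Lf_ge0 S).
have hh := opt_hpred S Hmuhat Hsv HZ Hgb Hinit HML gk (ltW D0) (lexx _) Dk.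
have key : (Lf b / 2 + MW b) * D k ^+ 2 + epsg b * D k <= hp k.
  apply: le_trans hh.
  have MLW := ML_geW a b o; have Lf0 := Lf_ge0 S.
  have k1 : (Lf b / 2 + MW b) * D k <= Mlb * Dg.
    by apply: ler_pM => //; rewrite ?(ltW D0) //; lra.
  have k2 : epsg b <= EH * ro.
    by rewrite Eh_rho lerDl mulr_ge0 ?(epsA_ge0 S) // ltW // (nubar_gt0 S Hsv Hgb Hinit).
  have k3 : (Lf b / 2 + MW b) * D k + epsg b <= ro * (gb + EH).
    by rewrite ML_rho in k1; lra.
  have g0 := gammabar_gt0 S Hmuhat Hsv Hgb Hinit HML.
  have E0 := Eh_ge0 S Hsv Hgb Hinit.
  have k4 : ro * (gb + EH) <= (1 - zeta a) / 2 * (gb + EH).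
    by rewrite ler_wpM2r ?rho_opt_le //; lra.
  have k5 : (1 - zeta a) / 2 * (gb + EH) <= (1 - zeta a) / 2 * redgrad P r Ztilde k.
    by rewrite ler_wpM2l ?divr_ge0 ?(ltW (zc_gt0 S)) //; move: gk; rewrite /opt_good; lra.
  have := ler_wpM2r (ltW D0) (le_trans k3 (le_trans k4 k5)); rewrite expr2; lra.
by move: h1; rewrite gp; lra.
Qed.

(** On such steps the objective is controlled by opt_f_step. *)
Definition small_good_step l := [/\ accepted P a r l, good l & D l <= Dg].
Definition path_length i j : R := \sum_(i <= l < j) D l.

Lemma path_length_ge0 i j : 0 <= path_length i j.
Proof. by apply: sumr_ge0 => l _; exact: radius_ge0 S l. Qed.

Lemma path_length_cat i l j : (i <= l)%N -> (l <= j)%N -> path_length i j = path_length i l + path_length l j.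
Proof. by move=> il lj; rewrite /path_length (big_cat_nat il lj). Qed.

Lemma path_lengthSr i j : (i <= j)%N -> path_length i j.+1 = path_length i j + D j.
Proof. by move=> ij; rewrite /path_length big_nat_recr. Qed.

Lemma path_length_mono i i2 j2 j : (i <= i2)%N -> (i2 <= j2)%N -> (j2 <= j)%N ->
  path_length i2 j2 <= path_length i j.
Proof.
move=> h1 h2 h3; rewrite (path_length_cat (leq_trans h1 h2) h3) (path_length_cat h1 h2).
by have := path_length_ge0 i i2; have := path_length_ge0 j2 j; lra.
Qed.

Section OneWindow.
Variables (i j : nat).
Hypothesis Hij : (i <= j)%N.
Hypothesis Hw : forall l, (i <= l)%N -> (l < j)%N -> small_good_step l.
Let L := path_length i j.

Lemma x_dist k l : (i <= k)%N -> (k <= l)%N -> (l <= j)%N ->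
  norm2 (x l - x k) <= path_length k l.
Proof.
move=> ik; elim: l => [|l IH].
  rewrite leqn0 => /eqP -> _; rewrite subrr norm20; exact: path_length_ge0.
rewrite leq_eqVlt => /orP[/eqP <- _|]; first by rewrite subrr norm20 path_length_ge0.
rewrite ltnS => kl lj; rewrite path_lengthSr //.
have [al _ _] := Hw (leq_trans ik kl) lj.
have [-> _] := acceptedP S al.
have -> : x l + p l - x k = (x l - x k) + p l by rewrite addrAC.
apply: le_trans (norm2_triangle _ _) _; rewrite lerD ?(step_le_radius S) //.
by rewrite IH // ltnW.
Qed.

Lemma x_dist_le k l : (i <= k)%N -> (k <= j)%N -> (i <= l)%N -> (l <= j)%N ->
  norm2 (x l - x k) <= L.
Proof.
move=> ik kj il lj; have [kl|lk] := leqP k l.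
  by apply: le_trans (x_dist ik kl lj) _; exact: path_length_mono.
by rewrite norm2BC; apply: le_trans (x_dist il (ltnW lk) kj) _; apply: path_length_mono => //; exact: ltnW.
Qed.

Lemma At_diff k l : (i <= k)%N -> (k <= j)%N -> (i <= l)%N -> (l <= j)%N ->
  opnorm (A P (x l) - A P (x k)) <= Lc b * L.
Proof.
move=> ik kj il lj; case: (std_smooth S) => _ Lc0 _ [_ lc].
by apply: le_trans (lc _ _) _; rewrite ler_wpM2l // x_dist_le.
Qed.

Lemma At_diff_mul k l u : (i <= k)%N -> (k <= j)%N -> (i <= l)%N -> (l <= j)%N ->
  norm2 ((At l - At k) *m u) <= (2 * epsA b + Lc b * L) * norm2 u.
Proof.
move=> ik kj il lj.
have -> : (At l - At k) *m u = (A P (x l) - A P (x k)) *m u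
   + (deltaA P (x l) *m u - deltaA P (x k) *m u).
  rewrite -mulmxBl -mulmxDl; congr (_ *m _).
  by rewrite /At_ /Atilde opprD addrACA.
apply: le_trans (norm2_triangle _ _) _.
have := opnorm_le u (At_diff ik kj il lj).
have := norm2B_le (deltaA P (x l) *m u) (deltaA P (x k) *m u).
have := deltaA_le S (x l) u; have := deltaA_le S (x k) u; lra.
Qed.

(** Error of the linearized constraint over a step. *)
Definition cerr l : 'cV[R]_m := cc l.+1 - cc l - At l *m v l.
Definition cerr_bound l : R := epsA b * D l + Lc b / 2 * D l ^+ 2.

Lemma cerr_le l : (i <= l)%N -> (l < j)%N -> norm2 (cerr l) <= cerr_bound l.
Proof.
move=> il lj; have [al _ _] := Hw il lj; have [E1 _] := acceptedP S al.
rewrite /cerr E1 -(At_step S); apply: le_trans (c_step_error S l) _.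
have sD := step_le_radius S l; have s0 := norm2_ge0 (p l).
rewrite addrC lerD // ler_wpM2l ?(epsA_ge0 S) ?divr_ge0 ?(Lc_ge0 S) //.
by rewrite ler_pXn2r ?nnegrE ?(radius_ge0 S).
Qed.

Definition nsum l : 'cV[R]_n := \sum_(i <= k < l) v k.
Definition esum_bound l : R := \sum_(i <= k < l) cerr_bound k.
(** Bounds the effect on a sum of normal steps of replacing each Jacobian of a
    window by a single one. *)
Definition drift : R := (2 * epsA b + Lc b * L) * (zeta a * L).

Lemma nsumS l : (i <= l)%N -> nsum l.+1 = nsum l + v l.
Proof. by move=> il; rewrite /nsum big_nat_recr. Qed.

Lemma nsum_le l : (i <= l)%N -> norm2 (nsum l) <= zeta a * path_length i l.
Proof.
move=> il; apply: le_trans (norm2_sum _ _ _) _.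
rewrite /path_length mulr_sumr; apply: ler_sum => k _; exact: v_le_radius S k.
Qed.

Lemma slope_ge0 : 0 <= 2 * epsA b + Lc b * L.
Proof. by rewrite addr_ge0 ?mulr_ge0 ?(epsA_ge0 S) ?(Lc_ge0 S) ?path_length_ge0. Qed.

Lemma zeta_ge0 : 0 <= zeta a. Proof. by case/andP: (zeta_bounds S) => /ltW. Qed.

(** Summing the linearizations telescopes: one Jacobian maps the total normal
    displacement to a difference of constraint values. *)
Lemma At_nsum l t : (i <= l)%N -> (l <= j)%N -> (i <= t)%N -> (t <= j)%N ->
  exists2 h, norm2 h <= esum_bound l + drift &
    At t *m nsum l = cc l - cc i + h.
Proof.
move=> il lj it tj.
pose F := \sum_(i <= k < l) ((At t - At k) *m v k).
pose G := \sum_(i <= k < l) cerr k.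
exists (F - G).
  apply: le_trans (norm2B_le _ _) _; rewrite addrC lerD //.
    rewrite /G /esum_bound !big_seq; apply: le_trans (norm2_sum _ _ _) _.
    apply: ler_sum => k; rewrite mem_index_iota => /andP[ik kl].
    by apply: cerr_le => //; exact: leq_trans kl lj.
  apply: (@le_trans _ _ (\sum_(i <= k < l) (2 * epsA b + Lc b * L) * (zeta a * D k))).
    rewrite /F !big_seq; apply: le_trans (norm2_sum _ _ _) _.
    apply: ler_sum => k; rewrite mem_index_iota => /andP[ik kl].
    apply: le_trans (At_diff_mul _ _ _ _ _) _ => //; first exact: leq_trans (ltnW kl) lj.
    by rewrite ler_wpM2l ?slope_ge0 // (v_le_radius S).
  rewrite -!mulr_sumr ler_wpM2l ?slope_ge0 // ler_wpM2l ?zeta_ge0 //.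
  exact: path_length_mono.
have tele : cc l - cc i = \sum_(i <= k < l) (cc k.+1 - cc k) by rewrite telescope_sumr.
rewrite tele /F /G -sumrB -big_split /= /nsum mulmx_sumr; apply: eq_bigr => k _.
rewrite /cerr mulmxBl; move: (At t *m _) (At k *m _) => X1 X2.
by apply/colP => s; rewrite !mxE; ring.
Qed.

Lemma esum_boundS l : (i <= l)%N -> esum_bound l.+1 = esum_bound l + cerr_bound l.
Proof. by move=> il; rewrite /esum_bound big_nat_recr. Qed.

Lemma cerr_bound_ge0 l : 0 <= cerr_bound l.
Proof.
by rewrite /cerr_bound addr_ge0 ?mulr_ge0 ?(epsA_ge0 S) ?(radius_ge0 S) ?divr_ge0 ?(Lc_ge0 S).
Qed.

Lemma esum_bound_ge0 l : 0 <= esum_bound l.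
Proof. by apply: sumr_ge0 => k _; exact: cerr_bound_ge0. Qed.

Lemma drift_ge0 : 0 <= drift.
Proof. exact: mulr_ge0 slope_ge0 (mulr_ge0 zeta_ge0 (path_length_ge0 i j)). Qed.

(** Induction on l. The normal step at l competes with - theta u, where u is the
    sum of the previous normal steps; that competitor would bring the constraint
    value a fraction theta of the way back to its value at i. By the variational
    inequality the new value is within epsc, in squares, of that convex
    combination, so that B is stationary as soon as epsc^2 <= theta B^2. A bound
    that added epsc at each step would grow with the number of steps. *)
Lemma con_window (theta B : R) : 0 < theta <= 1 -> 0 <= B ->
  epsc a ^+ 2 <= theta * B ^+ 2 ->
  (forall l, (i <= l)%N -> (l < j)%N -> theta * path_length i l <= D l) ->
  forall l, (i <= l)%N -> (l <= j)%N ->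
  norm2 (cc l) <= norm2 (cc i) + drift + esum_bound l + B.
Proof.
move=> /andP[th0 th1] B0 hB hth; elim=> [|l IH].
  rewrite leqn0 => /eqP il _; rewrite -il.
  by have := drift_ge0; have := esum_bound_ge0 i; lra.
rewrite leq_eqVlt => /orP[/eqP <- _|].
  by have := drift_ge0; have := esum_bound_ge0 i; lra.
rewrite ltnS => il lj.
have XB := IH il (ltnW lj).
have [h hh hE] := At_nsum il (ltnW lj) il (ltnW lj).
have [_ hv _ _ _] := run_step S l.
have zl : norm2 (- theta *: nsum l) <= zeta a * D l.
  rewrite norm2Z normrN gtr0_norm //.
  have := ler_wpM2l (ltW th0) (nsum_le il).
  have := ler_wpM2l zeta_ge0 (hth l il lj); lra.
have vi := normal_variational hv zl.
pose C := cc l + At l *m v l.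
pose mm := (1 - theta) *: cc l + theta *: (cc i - h).
pose dl := ct l - cc l.
have dle : norm2 dl <= epsc a := ct_noise S l.
have sE : At l *m v l - At l *m (- theta *: nsum l) = C - mm.
  rewrite -scalemxAr hE /C /mm; move: (At l *m v l) (cc l) (cc i) => X1 X2 X3.
  by apply/colP => s; rewrite !mxE; ring.
have CE : At l *m v l + ct l = C + dl.
  rewrite /C /dl; move: (At l *m v l) (cc l) (ct l) => X1 X2 X3.
  by apply/colP => s; rewrite !mxE; ring.
rewrite sE CE dotDl in vi.
have cs := cauchy_schwarzN dl (C - mm).
have mC : norm2 mm ^+ 2 = norm2 C ^+ 2 - 2 * dot C (C - mm) + norm2 (C - mm) ^+ 2.
  have [sv svE] : exists sv, sv = C - mm by eexists.
  have mmE : mm = C + - sv by rewrite svE opprB addrC subrK.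
  by rewrite -svE {1}mmE norm2D_sq norm2N dotNr; ring.
set s := norm2 (C - mm) in cs mC; have s0 : 0 <= s := norm2_ge0 _.
have e1 : norm2 dl * s <= epsc a * s by rewrite ler_wpM2r.
have C2 : norm2 C ^+ 2 <= norm2 mm ^+ 2 + epsc a ^+ 2.
  by have := sqr_ge0 (s - epsc a); rewrite mC; lra.
set Nl := norm2 (cc i) + drift + esum_bound l.
have Nl0 : 0 <= Nl.
  by have := norm2_ge0 (cc i); have := drift_ge0; have := esum_bound_ge0 l; rewrite /Nl; lra.
have mN : norm2 mm <= Nl + (1 - theta) * B.
  apply: le_trans (norm2_triangle _ _) _.
  rewrite !norm2Z ger0_norm ?subr_ge0 // gtr0_norm //.
  have t1 : norm2 (cc i - h) <= Nl by have := norm2B_le (cc i) h; rewrite /Nl; lra.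
  have t2 : 0 <= 1 - theta by rewrite subr_ge0.
  have := ler_wpM2l (ltW th0) t1; have := ler_wpM2l t2 XB; rewrite -/Nl; lra.
have CN : norm2 C <= Nl + B.
  have q1 : 0 <= Nl + B by apply: addr_ge0.
  rewrite -(@ler_pXn2r _ 2) ?nnegrE ?norm2_ge0 //.
  apply: le_trans C2 _.
  have m2 : norm2 mm ^+ 2 <= (Nl + (1 - theta) * B) ^+ 2.
    have q0 : 0 <= Nl + (1 - theta) * B.
      by apply: addr_ge0 => //; apply: mulr_ge0 => //; rewrite subr_ge0.
    by rewrite ler_pXn2r ?nnegrE ?norm2_ge0.
  have : 0 <= theta * (Nl * B) by rewrite !mulr_ge0 // ltW.
  have : 0 <= theta * (1 - theta) * B ^+ 2.
    by rewrite !mulr_ge0 ?subr_ge0 ?sqr_ge0 // ltW.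
  rewrite !expr2 in m2 hB *; lra.
have cl := cerr_le il lj.
have -> : cc l.+1 = C + cerr l.
  by rewrite /C /cerr; move: (At l *m v l) => X1; apply/colP => t; rewrite !mxE; ring.
apply: le_trans (norm2_triangle _ _) _; rewrite esum_boundS //.
by move: CN; rewrite /Nl; lra.
Qed.

(** Split the sum u of normal steps along the range of (At i)^T and the kernel of
    At i. The former is controlled by At i u; the latter would vanish if all
    Jacobians of the window were equal, since each normal step lies in the range
    of its own transposed Jacobian. *)
Lemma nsum_norm : smin * norm2 (nsum j) <= norm2 (At i *m nsum j) + drift.
Proof.
have s0 := smin_gt0 Hsv.
set u := nsum j.
have un : At i *m (At i)^T \in unitmx.
  rewrite -row_free_unit; apply: inj_row_free => w hw.
  have hw2 : At i *m ((At i)^T *m w^T) = 0.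
    by apply: trmx_inj; rewrite mulmxA trmx_mul trmxK [(At i *m _)^T]trmx_mul trmxK hw trmx0.
  have h1 := range_lower Hsv i w^T; rewrite hw2 norm20 in h1.
  have h2 := At_lower Hsv i w^T.
  have h3 : norm2 w^T = 0.
    apply/eqP; rewrite eq_le norm2_ge0 andbT.
    have n1 := norm2_ge0 ((At i)^T *m w^T); have n2 := norm2_ge0 w^T.
    have n3 : norm2 ((At i)^T *m w^T) <= 0 by rewrite -(pmulr_rle0 _ s0).
    by rewrite -(pmulr_rle0 _ s0); lra.
  by apply: trmx_inj; rewrite trmx0; exact: norm2_eq0.
pose y := invmx (At i *m (At i)^T) *m (At i *m u).
pose u1 := (At i)^T *m y; pose u2 := u - u1.
have Au1 : At i *m u1 = At i *m u by rewrite /u1 /y mulmxA mulmxA mulmxV // mul1mx.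
have Au2 : At i *m u2 = 0 by rewrite /u2 mulmxBr Au1 subrr.
have b1 : smin * norm2 u1 <= norm2 (At i *m u) by rewrite -Au1; exact: range_lower.
have b2 : smin * norm2 u2 <= drift.
  have [h|h] := eqVneq (norm2 u2) 0; first by rewrite h mulr0 drift_ge0.
  have u20 : 0 < norm2 u2 by rewrite lt_def h norm2_ge0.
  rewrite -(ler_pM2r u20) -mulrA -expr2 norm2_sq.
  have -> : dot u2 u2 = dot u2 u.
    rewrite {2}/u2 dotBr /u1 [dot u2 (_ *m y)]dotC dot_tr trmxK Au2 dot0r subr0 //.
  rewrite /u /nsum dotC dot_suml mulr_sumr.
  apply: (@le_trans _ _ (\sum_(i <= k < j) (2 * epsA b + Lc b * L) * (zeta a * D k) * norm2 u2)).
    rewrite !big_seq; apply: ler_sum => k; rewrite mem_index_iota => /andP[ik kj].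
    have [z vz] := v_range S k.
    have -> : dot (v k) u2 = dot z ((At k - At i) *m u2).
      by rewrite vz dot_tr trmxK mulmxBl Au2 subr0.
    have zl : smin * norm2 z <= zeta a * D k.
      by apply: le_trans (v_le_radius S k); rewrite vz; exact: At_lower.
    have dl := At_diff_mul u2 (leqnn i) Hij ik (ltnW kj).
    apply: le_trans (ler_wpM2l (ltW s0) (cauchy_schwarz _ _)) _.
    have := ler_wpM2l (mulr_ge0 (ltW s0) (norm2_ge0 z)) dl.
    have := ler_wpM2r (mulr_ge0 slope_ge0 (norm2_ge0 u2)) zl; lra.
  by rewrite -mulr_suml -!mulr_sumr /drift.
have := norm2_triangle u1 u2; rewrite {1}/u2 addrC subrK => h.
have := ler_wpM2l (ltW s0) h; lra.
Qed.

(** Apply opt_f_step at each index, freeze the gradient at i, and bound the sum of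
    the normal steps by nsum_norm. *)
Lemma obj_window :
  obj P (x j) <= obj P (x i)
    + Mg o / smin * (norm2 (cc i) + norm2 (cc j) + esum_bound j + 2 * drift)
    + (Lf b * L + epsg b) * (zeta a * L).
Proof.
have s0 := smin_gt0 Hsv.
have st : forall l, (i <= l)%N -> (l <= j)%N -> obj P (x l) <= obj P (x i)
   + dot (gt i) (nsum l) + (Lf b * L + epsg b) * (zeta a * path_length i l).
  elim=> [|l IH].
    rewrite leqn0 => /eqP il _; rewrite -il /nsum /path_length !big_geq ?il // dot0r.
    by rewrite !mulr0 !addr0.
  rewrite leq_eqVlt => /orP[/eqP <- _|].
    by rewrite /nsum /path_length !big_geq // dot0r !mulr0 !addr0.
  rewrite ltnS => il lj; have h := IH il (ltnW lj).
  have [al gl Dl] := Hw il lj; have fs := opt_f_step al gl Dl.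
  rewrite nsumS // path_lengthSr // dotDr.
  have gE : dot (g P (x l)) (v l) = dot (gt i) (v l) + dot (g P (x l) - g P (x i)) (v l)
     - dot (deltag P (x i)) (v l).
    by rewrite /gt_ /gtilde !dotDl dotNl; ring.
  have vl := v_le_radius S l; have v0 := norm2_ge0 (v l).
  have c1 : dot (g P (x l) - g P (x i)) (v l) <= Lf b * L * (zeta a * D l).
    apply: le_trans (cauchy_schwarz _ _) _; apply: ler_pM => //; first exact: norm2_ge0.
    case: (std_smooth S) => Lf0 _ [_ lf] _; apply: le_trans (lf _ _) _.
    by rewrite ler_wpM2l // x_dist_le // ltnW.
  have c2 : - dot (deltag P (x i)) (v l) <= epsg b * (zeta a * D l).
    have := cauchy_schwarzN (deltag P (x i)) (v l).
    have [_ _ ng _] := std_noise S (x i).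
    have : norm2 (deltag P (x i)) * norm2 (v l) <= epsg b * (zeta a * D l).
      by apply: ler_pM => //; exact: norm2_ge0.
    lra.
  lra.
have h := st j Hij (leqnn _); rewrite -/L in h.
apply: le_trans h _; rewrite lerD2r lerD2l.
apply: le_trans (cauchy_schwarz _ _) _.
have nn := nsum_norm; have [e he hE] := At_nsum Hij (leqnn _) (leqnn _) Hij.
have b1 : norm2 (At i *m nsum j) <= norm2 (cc i) + norm2 (cc j) + (esum_bound j + drift).
  rewrite hE; apply: le_trans (norm2_triangle _ _) _.
  by have := norm2B_le (cc j) (cc i); lra.
have b2 : norm2 (nsum j) <= (norm2 (cc i) + norm2 (cc j) + esum_bound j + 2 * drift) / smin.
  by rewrite ler_pdivlMr // mulrC; lra.
have := gt_le Hgb i; have := ler_wpM2l (Mg_ge0 Hgb) b2.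
have : norm2 (gt i) * norm2 (nsum j) <= Mg o * norm2 (nsum j).
  by rewrite ler_wpM2r ?norm2_ge0 // gt_le.
have -> : Mg o / smin * (norm2 (cc i) + norm2 (cc j) + esum_bound j + 2 * drift)
  = Mg o * ((norm2 (cc i) + norm2 (cc j) + esum_bound j + 2 * drift) / smin) by ring.
lra.
Qed.

(** The value of nubar dominates Mg / sigma_min with a factor kappa^2, so that
    objective changes are small on the scale of nubar |c|. *)
Lemma Mg_smin : 4 * tau a * kappa o ^+ 2 * (Mg o / smin) <= (1 - pi1 a) * nb.
Proof.
have s0 := smin_gt0 Hsv; have gK := Gamma1_geK Hsv Hgb; have t0 := tau_gt0 S.
rewrite [leRHS]mulrC (nubarE o S) /Qnorm.
have m0 := Mg_ge0 Hgb; have G10 := Gamma1_gt0 Hsv Hgb.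
rewrite mulrA ler_pdivrMr //.
have q0 : 0 <= MW b * Mc b * Gamma1 o / 2.
  exact: divr_ge0 (mulr_ge0 (mulr_ge0 (MW_ge0 S) (ltW (std_Mc S))) (ltW G10)) (ler0n R 2).
have := ler_wpM2l (mulr_ge0 (ltW t0) m0) gK.
have := mulr_ge0 (mulr_ge0 (ltW t0) q0) (mulr_ge0 (ltW G10) (ltW s0)).
lra.
Qed.

(** The errors proportional to the window length L are dominated by Dopt (gammabar
    + Eh) through the definitions of Eh and Dopt; the factor 4 / 5 leaves room for
    the costs due to noise in c. *)
Lemma window (w theta B : R) : 0 <= w <= nb -> 1 <= kappa o -> L <= 2 * Dg ->
  0 < theta <= 1 -> 0 <= B -> epsc a ^+ 2 <= theta * B ^+ 2 ->
  (forall l, (i <= l)%N -> (l < j)%N -> theta * path_length i l <= D l) ->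
  phi P (x j) w <= phi P (x i) w + Mg o / smin * (norm2 (cc i) + norm2 (cc j))
    + 4 / 5 * ((1 - pi0 a) * G2) * (gb + EH) * L + nb * B.
Proof.
move=> /andP[w0 wn] kap1 LD hth B0 hB hthl.
have fo := obj_window; have cw := con_window hth B0 hB hthl Hij (leqnn _).
have nb0 := nubar_gt0 S Hsv Hgb Hinit.
have L0 : 0 <= L := path_length_ge0 i j.
have ro0 := rho_opt_ge0; have ER := Eh_rho; have MR := ML_rho.
have g0 := gammabar_gt0 S Hmuhat Hsv Hgb Hinit HML; have E0 := Eh_ge0 S Hsv Hgb Hinit.
have Dg0 := Dopt_gt0 S Hmuhat Hsv Hgb Hinit HML.
have [eg0 eA0 Lf0 Lc0] : [/\ 0 <= epsg b, 0 <= epsA b, 0 <= Lf b & 0 <= Lc b].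
  by rewrite (epsg_ge0 S) (epsA_ge0 S) (Lf_ge0 S) (Lc_ge0 S).
have z0 := zeta_ge0.
have LfM : Lf b * Dg <= ro * gb.
  rewrite -MR ler_wpM2r ?(ltW Dg0) //.
  by have := ML_geW a b o; have := MW_ge0 S; lra.
have LcM : nb * Lc b * Dg <= ro * gb.
  by rewrite -MR ler_wpM2r ?(ltW Dg0) // le_max lexx orbT.
have LLc : nb * Lc b * L <= 2 * (ro * gb).
  by have := ler_wpM2l (mulr_ge0 (ltW nb0) Lc0) LD; lra.
have LLf : Lf b * L <= 2 * (ro * gb) by have := ler_wpM2l Lf0 LD; lra.
(* the two error sums, scaled by nubar *)
have es : nb * esum_bound j <= (nb * epsA b + ro * gb / 2) * L.
  rewrite /L /path_length /esum_bound !mulr_sumr !big_seq; apply: ler_sum => l.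
  rewrite mem_index_iota => /andP[il lj]; have [_ _ Dl] := Hw il lj.
  have D0 := radius_ge0 S l.
  have := ler_wpM2l (mulr_ge0 (ltW nb0) Lc0) Dl => h1.
  have := ler_wpM2r D0 (le_trans h1 LcM).
  rewrite /cerr_bound expr2; lra.
have zL : 0 <= zeta a * L := mulr_ge0 z0 L0.
have dr : nb * drift <= (2 * (nb * epsA b) + 2 * (ro * gb)) * (zeta a * L).
  by have := ler_wpM2r zL LLc; rewrite /drift; lra.
have es0 := esum_bound_ge0 j; have dr0 := drift_ge0.
have cb : 4 * (Mg o / smin) <= nb.
  have h := Mg_smin; have t1 := tau_gt1 S; have /andP[p10 p11] := pi1_bounds S.
  have c0 : 0 <= Mg o / smin := divr_ge0 (Mg_ge0 Hgb) (ltW (smin_gt0 Hsv)).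
  have k2 : 1 <= kappa o ^+ 2 by rewrite expr_ge1 // (le_trans ler01).
  have q1 : 1 <= tau a * kappa o ^+ 2 by nra.
  have := ler_wpM2r c0 q1; have := mulr_ge0 (ltW p10) (ltW nb0); lra.
have cb2 : Mg o / smin * (esum_bound j + 2 * drift) <= nb * (esum_bound j + 2 * drift) / 4.
  have := ler_wpM2r (addr_ge0 es0 (mulr_ge0 (ler0n R 2) dr0)) cb; lra.
have cw2 : w * (norm2 (cc j) - norm2 (cc i)) <= nb * (drift + esum_bound j + B).
  apply: (@le_trans _ _ (w * (drift + esum_bound j + B))).
    by rewrite ler_wpM2l //; lra.
  by rewrite ler_wpM2r // !addr_ge0.
have ff : (Lf b * L + epsg b) * (zeta a * L) <= (2 * (ro * gb) + epsg b) * (zeta a * L).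
  by rewrite ler_wpM2r // lerD2r.
(* everything is at most rho (5/4 + 3 zeta) EH L + rho (5/8 + 5 zeta) gb L *)
have tot : nb * (esum_bound j + 2 * drift) / 4 + (Lf b * L + epsg b) * (zeta a * L)
   + nb * (drift + esum_bound j)
   <= EH * ro * (5 / 4 + 3 * zeta a) * L + ro * gb * (5 / 8 + 5 * zeta a) * L.
  have nA : 0 <= nb * epsA b := mulr_ge0 (ltW nb0) eA0.
  have e1 : 0 <= epsg b * L := mulr_ge0 eg0 L0.
  have e2 : 0 <= epsg b * (zeta a * L) := mulr_ge0 eg0 zL.
  rewrite ER; lra.
have q1 : ro * (5 / 4 + 3 * zeta a) <= 4 / 5 * ((1 - pi0 a) * G2).
  have /andP[_ p01] := pi0_bounds S.
  have pg : 0 <= (1 - pi0 a) * G2.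
    by rewrite mulr_ge0 ?subr_ge0 ?(ltW p01) // ltW // (G2_gt0 S Hsv Hgb).
  (* 7 / 24 maximizes the left-hand side *)
  have h : (1 - zeta a) * (5 / 4 + 3 * zeta a) / 2 <= 4 / 5.
    by have := sqr_ge0 (zeta a - 7 / 24); rewrite expr2; lra.
  have := ler_wpM2l pg h; rewrite /rho_opt; lra.
have q2 : ro * (5 / 8 + 5 * zeta a) <= 4 / 5 * ((1 - pi0 a) * G2).
  have /andP[_ p01] := pi0_bounds S.
  have pg : 0 <= (1 - pi0 a) * G2.
    by rewrite mulr_ge0 ?subr_ge0 ?(ltW p01) // ltW // (G2_gt0 S Hsv Hgb).
  (* 7 / 16 maximizes the left-hand side *)
  have h : (1 - zeta a) * (5 / 8 + 5 * zeta a) / 2 <= 4 / 5.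
    by have := sqr_ge0 (zeta a - 7 / 16); rewrite expr2; lra.
  have := ler_wpM2l pg h; rewrite /rho_opt; lra.
have q3 := ler_wpM2r L0 (ler_wpM2l E0 q1).
have q4 := ler_wpM2r L0 (ler_wpM2l (ltW g0) q2).
rewrite /phi; move: fo; rewrite -/L => fo.
lra.
Qed.

End OneWindow.

End Window.

(** * Phases of small steps *)

(** Comparison of a sum with an integral: windows of unit length cost 1 / sqrt
    (max 1 y) each, in total O(sqrt y). *)
Lemma sqrt_increment (R : realType) (y y2 : R) : 0 <= y -> y + 1 <= y2 ->
  (Num.sqrt (Num.max 1 y))^-1 <= 5 / 2 * (Num.sqrt y2 - Num.sqrt y).
Proof.
move=> y0 yy2; set Y := Num.max 1 y.
have Y1 : 1 <= Y by rewrite le_max lexx.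
have yY : y <= Y by rewrite le_max lexx orbT.
have Y0 : 0 <= Y := le_trans ler01 Y1.
have y20 : 0 <= y2 by lra.
have sY := sqr_sqrtr Y0; have sy := sqr_sqrtr y0; have sy2 := sqr_sqrtr y20.
have a1 := sqrtr_ge0 Y; have a2 := sqrtr_ge0 y; have a3 := sqrtr_ge0 y2.
have b1 : 1 <= Num.sqrt Y by rewrite -[X in X <= _]sqrtr1 ler_wsqrtr.
have b2 : Num.sqrt y <= Num.sqrt Y by rewrite ler_wsqrtr.
move: (Num.sqrt Y) (Num.sqrt y) (Num.sqrt y2) sY sy sy2 a1 a2 a3 b1 b2.
move=> p q q2 pE qE q2E p0 q0 q20 p1 qp.
have pp : 0 < p by lra.
rewrite -(ler_pM2l pp) mulfV ?gt_eqF //.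
(* if q2 + q <= 5 p / 2, use q2^2 >= q^2 + 1; otherwise q2 - q >= p / 2, as q <= p *)
have h1 : 1 <= (q2 - q) * (q2 + q).
  have -> : (q2 - q) * (q2 + q) = q2 ^+ 2 - q ^+ 2 by ring.
  by rewrite q2E qE; lra.
have [big|small] := leP (q2 + q) (5 / 2 * p).
  have d0 : 0 <= q2 - q by nra.
  by have := ler_wpM2l d0 big; lra.
have : q2 - q >= p / 2 by lra.
by nra.
Qed.

Section SmallPhase.
Variables (R : realType) (n m : nat).
Variables (P : noisy_problem R n m) (a : parameters R) (r : run R n m).
Variables (b : constants R) (o : opt_constants R).
Variables (q : 'cV[R]_n -> nat) (Z Ztilde : forall y : 'cV[R]_n, 'M[R]_(n, q y)).
Hypothesis S : standing P a r b.
Hypothesis Hmuhat : 0 < muhat b.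
Hypothesis Hsv : jacobians_bounded_below P r o.
Hypothesis HZ : kernel_bases P o Z Ztilde.
Hypothesis Hgb : gradient_and_singular_value_bounds P r o.
Hypothesis Hinit : nu_init r <= nubar a b o.
Hypothesis HML : 0 < ML b (nubar a b o).

Local Notation x k := (iterate r k).
Local Notation v k := (nstep r k).
Local Notation D k := (Defs.radius r k).
Local Notation ct k := (ct_ P r k).
Local Notation cc k := (con P (iterate r k)).
Local Notation vp k := (vpred P r k).
Local Notation smin := (sigma_min o).
Local Notation G2 := (Gamma2 a r b o).
Local Notation nb := (nubar a b o).
Local Notation EH := (Eh a r b o).
Local Notation gb := (gammabar a r b o).
Local Notation eb := (epsbar a b o).
Local Notation Dg := (Dopt a r b o).
Local Notation kap := (kappa o).
Local Notation a1 := (tau a - 1).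
Local Notation path_length := (path_length r).

(** The steps on which the noise in c may exceed the decrease that acceptance
    promises for the noiseless merit function. *)
Definition noisy_step l : bool := pi0 a * pi1 a * vp l < brace P r l.

(** If kappa < 1, the bounds on the singular values force m = 0, and then brace
    and vpred vanish. *)
Lemma noisy_step_kappa l : noisy_step l -> 1 <= kap.
Proof.
rewrite /noisy_step => hl; rewrite leNgt; apply/negP => k1.
have zero (w : 'cV[R]_m) : norm2 w = 0.
  have h1 := At_lower Hsv l w; have h2 := AtT_upper Hgb l w.
  rewrite -(kapE Hsv) in h2; have s0 := smin_gt0 Hsv; have w0 := norm2_ge0 w.
  have h3 : (1 - kap) * (smin * norm2 w) <= 0 by lra.
  have h4 : smin * norm2 w <= 0 by rewrite -(pmulr_rle0 _ (x := 1 - kap)) // subr_gt0.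
  by apply/eqP; rewrite eq_le w0 andbT -(pmulr_rle0 _ s0).
move: hl; rewrite /brace /vpred !zero; lra.
Qed.

Definition noisy_level : R := (8 * kap / (pi0 a * pi1 a) + 1) * epsc a / 2.

Lemma pp_gt0 : 0 < pi0 a * pi1 a.
Proof. by have /andP[? _] := pi0_bounds S; have /andP[? _] := pi1_bounds S; rewrite mulr_gt0. Qed.

(** By norm_change_noise, brace exceeds a fraction of vpred, hence of |At v| /
    kappa, only where c is of the size of its noise. *)
Lemma noisy_step_con l : noisy_step l -> norm2 (cc l) <= noisy_level.
Proof.
rewrite /noisy_step => hl; have w0 := pp_gt0; have p0 := vpred_ge0 S l.
have h4 := brace_le4 S l; rewrite (At_step S) in h4.
have h2 := Atv_le_vpred S Hsv Hgb l.
set X := norm2 (cc l) in h4 *; set Y := norm2 (ct l) in h4.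
have X0 : 0 <= X := norm2_ge0 _; have Y0 : 0 <= Y := norm2_ge0 _.
have ec := epsc_ge0 S; have kp := kap_gt0 Hsv Hgb.
have XY : X <= Y + epsc a.
  by have := norm2_leB (cc l) (ct l); rewrite norm2BC -/X -/Y; have := ct_noise S l; lra.
have br0 : 0 < brace P r l by apply: le_lt_trans hl; rewrite mulr_ge0 // ltW.
have h5 : brace P r l * (X + Y) <= 4 * epsc a * (2 * kap * vp l).
  by apply: le_trans h4 _; rewrite ler_wpM2l // mulr_ge0.
have s0 : 0 <= X + Y by lra.
have h6 : pi0 a * pi1 a * (X + Y) <= 8 * kap * epsc a.
  have [vz|vnz] := eqVneq (vp l) 0.
    rewrite vz !mulr0 pmulr_rle0 // in h5.
    have -> : X + Y = 0 by lra.
    rewrite mulr0; exact: mulr_ge0 (mulr_ge0 (ler0n R 8) (ltW kp)) ec.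
  have vp0 : 0 < vp l by rewrite lt_def vnz.
  rewrite -(ler_pM2r vp0).
  by have := ler_wpM2r s0 (ltW hl); lra.
have h7 : X + Y <= 8 * kap / (pi0 a * pi1 a) * epsc a.
  by rewrite mulrAC ler_pdivlMr // mulrC.
rewrite /noisy_level; lra.
Qed.

Definition rate_opt : R := 4 / 5 * ((1 - pi0 a) * G2) * (gb + EH).
Definition beta_opt : R := Mg o / smin * (2 * noisy_level).
Definition window_factor : R := (Num.sqrt (Num.min 1 a1))^-1.
(** Bound for the increase of the merit function over a path of length l between
    noisy steps: endpoint terms, a term for each of the at most 1 + l / (2 Dopt)
    windows, the rate of the lemma window, and the noise in |c| summed by
    sqrt_increment. *)
Definition phase_cost (l : R) : R :=
  beta_opt + (beta_opt + 2 * eb) * (l / (2 * Dg)) + rate_opt * l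
  + eb * window_factor * (1 + 5 / 2 * Num.sqrt (l / (2 * Dg))).

Lemma a1_gt0 : 0 < a1. Proof. by rewrite subr_gt0 (tau_gt1 S). Qed.
Lemma am_gt0 : 0 < Num.min 1 a1. Proof. by rewrite lt_min ltr01 a1_gt0. Qed.
Lemma am_le1 : Num.min 1 a1 <= 1. Proof. by rewrite ge_min lexx. Qed.
Lemma am_le : Num.min 1 a1 <= a1. Proof. by rewrite ge_min lexx orbT. Qed.
Lemma window_factor_gt0 : 0 < window_factor. Proof. by rewrite invr_gt0 sqrtr_gt0 am_gt0. Qed.
Lemma window_factor_sq : Num.min 1 a1 * window_factor ^+ 2 = 1.
Proof.
by rewrite /window_factor exprVn sqr_sqrtr ?(ltW am_gt0) // mulfV // gt_eqF // am_gt0.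
Qed.

Lemma noisy_level_ge0 : 0 <= noisy_level.
Proof.
have w0 := pp_gt0; have kp := kap_gt0 Hsv Hgb; have ec := epsc_ge0 S.
have h : 0 <= 8 * kap / (pi0 a * pi1 a).
  exact: divr_ge0 (mulr_ge0 (ler0n R 8) (ltW kp)) (ltW w0).
by rewrite /noisy_level divr_ge0 // mulr_ge0 // addr_ge0.
Qed.

Lemma Mgs_ge0 : 0 <= Mg o / smin.
Proof. exact: divr_ge0 (Mg_ge0 Hgb) (ltW (smin_gt0 Hsv)). Qed.

Lemma beta_opt_ge0 : 0 <= beta_opt.
Proof. exact: mulr_ge0 Mgs_ge0 (mulr_ge0 (ler0n R 2) noisy_level_ge0). Qed.

Lemma rate_opt_ge0 : 0 <= rate_opt.
Proof.
have /andP[_ p01] := pi0_bounds S; have g := G2_gt0 S Hsv Hgb.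
have g0 := gammabar_gt0 S Hmuhat Hsv Hgb Hinit HML; have E0 := Eh_ge0 S Hsv Hgb Hinit.
have p1 : 0 <= 1 - pi0 a by lra.
apply: mulr_ge0 (addr_ge0 (ltW g0) E0).
by apply: mulr_ge0 (mulr_ge0 p1 (ltW g)); lra.
Qed.

Section Phase.
Variables (s J : nat) (w : R).
Hypothesis Hph : forall l, (s <= l)%N -> (l < J)%N -> small_good_step P a r b o Ztilde l.
Hypothesis Hnu : forall l, (s <= l)%N -> nu r l = w.

(** Each accepted step multiplies the radius by tau, so the path length is a
    geometric sum. *)
Lemma path_length_geometric l : (s <= l)%N -> (l <= J)%N -> a1 * path_length s l = D l - D s.
Proof.
elim: l => [|l IH].
  by rewrite leqn0 => /eqP -> _; rewrite /path_length big_geq // mulr0 subrr.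
rewrite leq_eqVlt => /orP[/eqP <- _|]; first by rewrite /path_length big_geq // mulr0 subrr.
rewrite ltnS => sl lJ; rewrite path_lengthSr //; have [al _ _] := Hph sl lJ.
have [_ ->] := acceptedP S al; have := IH sl (ltnW lJ); lra.
Qed.

Lemma path_length_le_radius l : (s <= l)%N -> (l <= J)%N -> a1 * path_length s l <= D l.
Proof. by move=> sl lJ; rewrite path_length_geometric //; have := radius_gt0 S s; lra. Qed.

Lemma quiet_step l : (s <= l)%N -> (l < J)%N -> ~~ noisy_step l ->
  phi P (x l.+1) w <= phi P (x l) w.
Proof.
move=> sl lJ; rewrite /noisy_step -leNgt => hl; have [_ gl Dl] := Hph sl lJ.
have [_] := opt_small S Hmuhat Hsv HZ Hgb Hinit HML gl Dl; rewrite Hnu // => h.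
have pg := pred_gt S l; have n0 := nu_gt0 S l; rewrite Hnu // in n0 pg.
have /andP[p00 _] := pi0_bounds S.
have := ler_wpM2l (ltW n0) hl; have := ler_wpM2l (ltW p00) (ltW pg).
by lra.
Qed.

Lemma any_step l : (s <= l)%N -> (l < J)%N ->
  phi P (x l.+1) w <= phi P (x l) w + 2 * eb.
Proof.
move=> sl lJ; have [_ gl Dl] := Hph sl lJ.
have [_] := opt_small S Hmuhat Hsv HZ Hgb Hinit HML gl Dl; rewrite Hnu // => h.
have n0 := nu_gt0 S l; have br := ler_wpM2l (ltW n0) (brace_le2 S l).
have eg := eb_ge S Hsv Hgb Hinit l; rewrite Hnu // in n0 br eg.
have := epsf_ge0 S; have /andP[p00 _] := pi0_bounds S.
by have := mulr_ge0 (ltW p00) (ltW (pred_gt0 S l)); rewrite Hnu //; lra.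
Qed.

Lemma quiet_run k l : (s <= k)%N -> (k <= l)%N -> (l <= J)%N ->
  (forall t, (k <= t)%N -> (t < l)%N -> ~~ noisy_step t) ->
  phi P (x l) w <= phi P (x k) w.
Proof.
move=> sk; elim: l => [|l IH]; first by rewrite leqn0 => /eqP ->.
rewrite leq_eqVlt => /orP[/eqP -> //|]; rewrite ltnS => kl lJ hq.
apply: le_trans (quiet_step (leq_trans sk kl) lJ (hq _ kl (ltnSn _))) _.
by apply: IH => //; [exact: ltnW | move=> t kt tl; apply: hq => //; exact: ltnW].
Qed.

Lemma w_bounds : 0 <= w <= nb.
Proof. by rewrite -(Hnu (leqnn s)) (nu_ge0 S) (nu_le_nubar S Hsv Hgb Hinit). Qed.

(** Strong induction on the noisy index j. The window reaches back to the first
    noisy index i at distance at most 2 Dopt from j; the last noisy index i1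
    before i is then farther than 2 Dopt from j, which pays for the window in
    phase_cost. The steps between i1 and i are quiet, except for the one at i1. *)
Lemma noisy_bound j : (s <= j)%N -> (j < J)%N -> noisy_step j ->
  phi P (x j) w <= phi P (x s) w + phase_cost (path_length s j).
Proof.
have Dg0 := Dopt_gt0 S Hmuhat Hsv Hgb Hinit HML.
have D2 : 0 < 2 * Dg by lra.
have A00 := window_factor_gt0; have A2 := window_factor_sq; have am0 := am_gt0; have aml := am_le; have am1 := am_le1.
have be0 := beta_opt_ge0; have ra0 := rate_opt_ge0; have ebg := eb_ge0 S Hsv Hgb Hinit.
have ec := epsc_ge0 S; have nb0 := nubar_gt0 S Hsv Hgb Hinit.
have enb : nb * epsc a <= eb by rewrite /epsbar lerDr (epsf_ge0 S).
elim/ltn_ind: j => j IH sj jJ Sj.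
pose cand i := [&& (s <= i)%N, (i <= j)%N, noisy_step i & path_length i j <= 2 * Dg].
have candj : cand j.
  by rewrite /cand sj leqnn Sj /= /path_length big_geq // ltW.
have [i /and4P[si ij Si Lij] imin] := ex_minnP (ex_intro cand j candj).
have kap1 := noisy_step_kappa Si.
have Xi := noisy_step_con Si; have Xj := noisy_step_con Sj.
have Hwin : forall l, (i <= l)%N -> (l < j)%N -> small_good_step P a r b o Ztilde l.
  by move=> l il lj; apply: Hph; [exact: leq_trans si il | exact: ltn_trans lj jJ].
have Lsj := path_length_ge0 S s j; have Lij0 := path_length_ge0 S i j.
have cat_ij := path_length_cat r si ij.
have Lsi := path_length_ge0 S s i.
have mb : Mg o / smin * (norm2 (cc i) + norm2 (cc j)) <= beta_opt.
  by rewrite /beta_opt ler_wpM2l ?Mgs_ge0 //; lra.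
have thr l : (i <= l)%N -> (l < j)%N -> Num.min 1 a1 * path_length i l <= D l.
  move=> il lj; have sl := leq_trans si il; have lJ := ltnW (ltn_trans lj jJ).
  apply: le_trans (path_length_le_radius sl lJ).
  by apply: ler_pM; rewrite ?(ltW am0) ?(path_length_ge0 S) // (path_length_mono S).
have [hno|hyes] := pselect (forall t, (s <= t)%N -> (t < i)%N -> ~~ noisy_step t).
  have fi := quiet_run (leqnn s) si (ltnW (leq_ltn_trans ij jJ)) hno.
  have B0 : 0 <= epsc a * window_factor := mulr_ge0 ec (ltW A00).
  have hB : epsc a ^+ 2 <= Num.min 1 a1 * (epsc a * window_factor) ^+ 2.
    by rewrite exprMn mulrCA A2 mulr1.
  have th : 0 < Num.min 1 a1 <= 1 by rewrite am0 am1.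
  have := window S Hmuhat Hsv HZ Hgb Hinit HML ij Hwin w_bounds kap1 Lij th B0 hB thr.
  have y0 : 0 <= path_length s j / (2 * Dg) by rewrite divr_ge0 // ltW.
  have e1 := ler_wpM2r (ltW A00) enb.
  have e2 : 0 <= (beta_opt + 2 * eb) * (path_length s j / (2 * Dg)).
    by rewrite mulr_ge0 // addr_ge0 // mulr_ge0.
  have e3 : 0 <= eb * window_factor * (5 / 2 * Num.sqrt (path_length s j / (2 * Dg))).
    by rewrite mulr_ge0 ?(mulr_ge0 ebg) ?(ltW A00) // mulr_ge0 ?sqrtr_ge0.
  have e4 : rate_opt * path_length i j <= rate_opt * path_length s j by rewrite ler_wpM2l //; lra.
  rewrite -/rate_opt /phase_cost; lra.
(* the last noisy index before the window *)
have [i1 [si1 i1i Si1 i1max]] : exists i1, [/\ (s <= i1)%N, (i1 < i)%N, noisy_step i1 &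
    forall t, (i1 < t)%N -> (t < i)%N -> ~~ noisy_step t].
  pose c1 t := [&& (s <= t)%N, (t < i)%N & noisy_step t].
  have ex1 : exists t, c1 t.
    apply: contrapT => hn; apply: hyes => t st ti; apply/negP => nt.
    by apply: hn; exists t; rewrite /c1 st ti nt.
  have ub t : c1 t -> (t <= i)%N by move=> /and3P[_ /ltnW].
  have [t /and3P[st ti nt] tmax] := ex_maxnP ex1 ub.
  exists t; split => // t2 tt2 t2i; apply/negP => nt2.
  have : c1 t2 by rewrite /c1 t2i nt2 (leq_trans st (ltnW tt2)).
  by move/tmax; rewrite leqNgt tt2.
have i1j := leq_trans (ltnW i1i) ij.
have L1 : 2 * Dg < path_length i1 j.
  rewrite ltNge; apply/negP => hL.
  have : cand i1 by rewrite /cand si1 i1j Si1 hL.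
  by move/imin; rewrite leqNgt i1i.
have iJ := leq_ltn_trans ij jJ.
have fi : phi P (x i) w <= phi P (x i1) w + 2 * eb.
  apply: le_trans (quiet_run (leq_trans si1 (leqnSn _)) i1i (ltnW iJ) _) _.
    by move=> t; exact: i1max.
  exact: any_step si1 (ltn_trans i1i iJ).
have IH1 := IH i1 (leq_trans i1i ij) si1 (ltn_trans i1i iJ) Si1.
set l1 := path_length s i1 in IH1; have l10 : 0 <= l1 := path_length_ge0 S s i1.
have cat1 : path_length s j = l1 + path_length i1 j := path_length_cat r si1 i1j.
have catm := path_length_mono S (ltnW i1i) ij (leqnn j).
pose y := l1 / (2 * Dg); pose y2 := path_length s j / (2 * Dg).
have y0 : 0 <= y by rewrite divr_ge0 // ltW.
have yE : l1 = y * (2 * Dg) by rewrite /y divfK // gt_eqF.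
have y2E : path_length s j = y2 * (2 * Dg) by rewrite /y2 divfK // gt_eqF.
have yy2 : y + 1 <= y2.
  by rewrite -(ler_pM2r D2) mulrDl -yE -y2E cat1; lra.
have sq := sqrt_increment y0 yy2.
set Ym := Num.max 1 y in sq.
have Ym1 : 1 <= Ym by rewrite le_max lexx.
have Ym0 : 0 < Ym := lt_le_trans ltr01 Ym1.
(* every radius in the window is at least th times the length already covered *)
pose th := Num.min 1 a1 * Ym; pose B := epsc a * window_factor * (Num.sqrt Ym)^-1.
have sY0 : 0 < Num.sqrt Ym by rewrite sqrtr_gt0.
have sYi0 : 0 <= (Num.sqrt Ym)^-1 by rewrite invr_ge0 ltW.
have B0 : 0 <= B := mulr_ge0 (mulr_ge0 ec (ltW A00)) sYi0.
have hB : epsc a ^+ 2 <= th * B ^+ 2.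
  have -> : th * B ^+ 2 = Num.min 1 a1 * window_factor ^+ 2 * epsc a ^+ 2 * (Ym * (Num.sqrt Ym)^-1 ^+ 2).
    by rewrite /th /B; ring.
  by rewrite exprVn sqr_sqrtr ?(ltW Ym0) // mulfV ?gt_eqF // A2 mul1r mulr1.
have [_ _ Di1] := Hph si1 (ltn_trans i1i iJ).
have al1 : a1 * l1 <= D i1 := path_length_le_radius si1 (ltnW (ltn_trans i1i iJ)).
have a1p := a1_gt0.
have th01 : 0 < th <= 1.
  rewrite /th mulr_gt0 //=; rewrite /Ym; case: (leP 1 y) => y1; last by rewrite mulr1.
  apply: (@le_trans _ _ (a1 * y)); first by rewrite ler_wpM2r.
  rewrite -(ler_pM2r D2) -mulrA -yE mul1r; lra.
have thl l : (i <= l)%N -> (l < j)%N -> th * path_length i l <= D l.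
  move=> il lj; rewrite /th /Ym; case: (leP 1 y) => y1; last by rewrite mulr1; exact: thr.
  have sl := leq_trans si il; have lJ := ltnW (ltn_trans lj jJ).
  apply: le_trans (path_length_le_radius sl lJ).
  have h1 : path_length i l <= 2 * Dg.
    by apply: le_trans Lij; rewrite (path_length_mono S) // ltnW.
  have h2 : l1 <= path_length s l.
    by rewrite (path_length_mono S) //; apply: leq_trans il; exact: ltnW.
  have h3 : y * path_length i l <= l1 by rewrite yE ler_wpM2l.
  rewrite -mulrA; apply: ler_pM => //; first exact: ltW.
    by rewrite mulr_ge0 // (path_length_ge0 S).
  exact: le_trans h3 h2.
have := window S Hmuhat Hsv HZ Hgb Hinit HML ij Hwin w_bounds kap1 Lij th01 B0 hB thl.
have e1 : nb * B <= eb * window_factor * (Num.sqrt Ym)^-1.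
  by rewrite /B !mulrA ler_wpM2r ?invr_ge0 ?(ltW sY0) // ler_wpM2r // ltW.
have e2 := ler_wpM2l (mulr_ge0 ebg (ltW A00)) sq.
have e3 : (beta_opt + 2 * eb) * (y + 1) <= (beta_opt + 2 * eb) * y2.
  by rewrite ler_wpM2l // addr_ge0 // mulr_ge0.
have e4 : rate_opt * path_length i j <= rate_opt * (path_length s j - l1).
  by rewrite ler_wpM2l // cat1; lra.
rewrite -/rate_opt => win.
move: IH1; rewrite /phase_cost -/y -/y2 => IH1.
lra.
Qed.

Lemma phase_cost_mono l1 l2 : 0 <= l1 -> l1 <= l2 -> phase_cost l1 <= phase_cost l2.
Proof.
move=> l10 l12.
have Dg0 := Dopt_gt0 S Hmuhat Hsv Hgb Hinit HML.
have be0 := beta_opt_ge0; have ra0 := rate_opt_ge0; have ebg := eb_ge0 S Hsv Hgb Hinit.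
have y12 : l1 / (2 * Dg) <= l2 / (2 * Dg).
  by rewrite ler_wpM2r // invr_ge0 mulr_ge0 // ltW.
have s12 : Num.sqrt (l1 / (2 * Dg)) <= Num.sqrt (l2 / (2 * Dg)) by rewrite ler_wsqrtr.
have e1 : (beta_opt + 2 * eb) * (l1 / (2 * Dg)) <= (beta_opt + 2 * eb) * (l2 / (2 * Dg)).
  by rewrite ler_wpM2l // addr_ge0 // mulr_ge0.
have e2 : rate_opt * l1 <= rate_opt * l2 by rewrite ler_wpM2l.
have e3 := ler_wpM2l (mulr_ge0 ebg (ltW window_factor_gt0)) s12.
rewrite /phase_cost; lra.
Qed.

(** After the last noisy step nothing increases, and the whole phase has length at
    most Dopt / a1. *)
Lemma phase_bound t : (s <= t)%N -> (t <= J)%N ->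
  phi P (x t) w <= phi P (x s) w + phase_cost (Dg / a1) + 2 * eb.
Proof.
move=> st tJ.
have ebg := eb_ge0 S Hsv Hgb Hinit; have be0 := beta_opt_ge0; have ra0 := rate_opt_ge0.
have Dg0 := Dopt_gt0 S Hmuhat Hsv Hgb Hinit HML; have a1p := a1_gt0.
have [hno|hyes] := pselect (forall l, (s <= l)%N -> (l < t)%N -> ~~ noisy_step l).
  have h := quiet_run (leqnn s) st tJ hno.
  have D0 : 0 <= Dg / a1 by rewrite divr_ge0 // ltW.
  have := phase_cost_mono (lexx 0) D0.
  have : 0 <= phase_cost 0.
    rewrite /phase_cost mul0r !mulr0 sqrtr0 mulr0 !addr0 mulr1.
    exact: addr_ge0 be0 (mulr_ge0 ebg (ltW window_factor_gt0)).
  lra.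
pose c1 l := [&& (s <= l)%N, (l < t)%N & noisy_step l].
have ex1 : exists l, c1 l.
  apply: contrapT => hn; apply: hyes => l sl lt; apply/negP => nt.
  by apply: hn; exists l; rewrite /c1 sl lt nt.
have ub l : c1 l -> (l <= t)%N by move=> /and3P[_ /ltnW].
have [j /and3P[sj jt nj] jmax] := ex_maxnP ex1 ub.
have jJ := leq_trans jt tJ.
have h1 := noisy_bound sj jJ nj; have h2 := any_step sj jJ.
have h3 : phi P (x t) w <= phi P (x j.+1) w.
  apply: quiet_run (leq_trans sj (leqnSn _)) jt tJ _ => l jl lt; apply/negP => nl.
  have : c1 l by rewrite /c1 lt nl (leq_trans sj (ltnW jl)).
  by move/jmax; rewrite leqNgt jl.
have [_ _ Dj] := Hph sj jJ.
have h4 : path_length s j <= Dg / a1.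
  rewrite ler_pdivlMr // mulrC.
  by apply: le_trans (path_length_le_radius sj (ltnW jJ)) Dj.
have := phase_cost_mono (path_length_ge0 S s j) h4; lra.
Qed.

End Phase.

Local Notation Y := (Dg * (gb + EH)).

Lemma budget_gt0 : 0 < Y.
Proof.
have g0 := gammabar_gt0 S Hmuhat Hsv Hgb Hinit HML; have E0 := Eh_ge0 S Hsv Hgb Hinit.
have Dg0 := Dopt_gt0 S Hmuhat Hsv Hgb Hinit HML.
by rewrite mulr_gt0 // ltr_wpDr.
Qed.

(** Restates that gammabar is beyond the root of its quadratic, in terms of Dopt. *)
Lemma epsbar_le_budget : 4 * tau a * eb <= pi0 a * (G2 * (1 - zeta a)) * Y.
Proof.
have [g0 gr] := gammabar_root S Hmuhat Hsv Hgb Hinit HML.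
have tE := ThetaE S HML; have dE := DoptE S HML.
have X0 := xML_gt0 S HML; have t0 := tau_gt0 S.
have q1 := ler_wpM2l (ltW (mulr_gt0 t0 X0)) (ltW gr).
rewrite -(ler_pM2r X0).
have -> : pi0 a * (G2 * (1 - zeta a)) * Y * (xi a * ML b nb)
  = pi0 a * (G2 * (1 - zeta a)) * (Dg * (xi a * ML b nb)) * (gb + EH).
  by move: G2 gb EH Dg (xi a) (ML b nb) => c1 c2 c3 c4 c5 c6; ring.
rewrite dE.
have E2 : 2 * (tau a * (xi a * ML b nb) * (Theta a r b o * (gb * (gb + EH))))
  = pi0 a * G2 ^+ 2 * (1 - zeta a) ^+ 2 * (gb * (gb + EH)).
  by rewrite -tE; move: (Theta a r b o) gb EH (xi a) (ML b nb) => c1 c2 c3 c4 c5; ring.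
have E3 : pi0 a * (G2 * (1 - zeta a)) * (G2 * (1 - zeta a) * gb) * (gb + EH)
  = pi0 a * G2 ^+ 2 * (1 - zeta a) ^+ 2 * (gb * (gb + EH)).
  by move: G2 gb EH => c1 c2 c3; ring.
rewrite E3 -E2; move: q1.
by move: (Theta a r b o) gb EH (xi a) (ML b nb) eb => c1 c2 c3 c4 c5 c6; lra.
Qed.

(** If Gamma2 is close to 1 then Qnorm is small relative to pi1 nu_0; since nubar
    (1 - pi1) = tau Qnorm and nubar is at least nu_0, the factor 1 - pi1 must be
    small too. *)
Lemma Gamma2_pi1 : G2 * (1 - pi1 a) <= tau a * pi1 a * (1 - G2).
Proof.
have g := G2_gt0 S Hsv Hgb; have gi := Gamma2_inv a r b o.
have nb0 := nubar_gt0 S Hsv Hgb Hinit; have nE := nubarE o S; have t0 := tau_gt0 S.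
have /andP[p10 p11] := pi1_bounds S; have n0 := nu_gt0 S 0.
have nn := nu_le_nubar S Hsv Hgb Hinit 0.
have Q0 := Qnorm_ge0 S Hsv Hgb.
have gE : G2 * (1 + Qnorm b o / (pi1 a * nu r 0%N)) = 1 by rewrite -gi mulfV // gt_eqF.
have w0 : 0 < pi1 a * nu r 0%N by rewrite mulr_gt0.
have gE2 : G2 * Qnorm b o = (1 - G2) * (pi1 a * nu r 0%N).
  have -> : 1 - G2 = G2 * (Qnorm b o / (pi1 a * nu r 0%N)).
    by move: gE; rewrite mulrDr mulr1 => <-; rewrite addrC addKr.
  by rewrite -(mulrA G2) divfK // gt_eqF.
have G1 := G2_le1 S Hsv Hgb.
rewrite -(ler_pM2r nb0).
have -> : G2 * (1 - pi1 a) * nb = tau a * (G2 * Qnorm b o).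
  by rewrite [RHS]mulrCA -nE -mulrA (mulrC nb).
rewrite gE2.
have : 0 <= tau a * pi1 a * (1 - G2) by rewrite !mulr_ge0 ?subr_ge0 // ltW.
by move=> h; have := ler_wpM2l h nn; move: G2 nb => c1 c2; lra.
Qed.

(** The pure inequality behind beta_le_budget, where the cost at the end points of
    a window is split between 1 - Gamma2 and the noise. *)
Lemma beta_arith (t z u v c k Yv g e nbv s : R) :
  1 < t -> 0 < z <= 1 -> 0 < u -> 0 < v < 1 -> 0 <= c -> 0 <= s -> 1 <= k ->
  0 <= Yv -> g <= 1 ->
  4 * t * k ^+ 2 * c <= (1 - v) * nbv -> nbv * s <= e ->
  4 * t * e <= u * (g * z) * Yv -> g * (1 - v) <= t * v * (1 - g) ->
  c * (2 * ((8 * k / (u * v) + 1) * s / 2)) <= (1 - g) * Yv / (2 * t) + e / 4.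
Proof.
move=> t1 /andP[z0 z1] u0 /andP[v0 v1] c0 s0 k1 Y0 g1 h hs hY hg.
have t0 : 0 < t by lra.
have uv0 : 0 < u * v by rewrite mulr_gt0.
have cs0 : 0 <= c * s by rewrite mulr_ge0.
have kk : k <= k ^+ 2 by rewrite expr2 ler_peMl //; lra.
have e0 : 4 * t * k ^+ 2 * (c * s) <= (1 - v) * e.
  have h1 := ler_wpM2r s0 h; have h2 := ler_wpM2l (ltW (_ : 0 < 1 - v)) hs.
  have {}h2 : (1 - v) * (nbv * s) <= (1 - v) * e by apply: h2; lra.
  lra.
have ts0 : 0 <= t * (c * s) by rewrite mulr_ge0 // ltW.
have tk : t * (c * s) * k <= t * (c * s) * k ^+ 2 by rewrite ler_wpM2l.
have tk1 : t * (c * s) <= t * (c * s) * k by rewrite ler_peMr.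
have cse : c * s <= t * (c * s) by rewrite ler_peMl // ltW.
have ee : 0 <= e by nra.
have ve : 0 <= v * e by rewrite mulr_ge0 // ltW.
have b2 : c * s <= e / 4 by lra.
have b1 : c * (8 * k / (u * v) * s) <= (1 - g) * Yv / (2 * t).
  have -> : c * (8 * k / (u * v) * s) = (8 * (t * (c * s) * k)) / (t * (u * v)).
    by field; rewrite !gt_eqF.
  rewrite ler_pdivrMr ?mulr_gt0 //.
  have -> : (1 - g) * Yv / (2 * t) * (t * (u * v)) = (1 - g) * Yv * (u * v) / 2.
    by field; rewrite gt_eqF.
  have q1 : 8 * (t * (c * s) * k) <= 2 * ((1 - v) * e) by lra.
  (* e <= u g z Y / (4 t), then g (1 - v) <= t v (1 - g) *)
  rewrite -(ler_pM2l t0).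
  have v10 : 0 <= 1 - v by lra.
  have q2 := ler_wpM2l v10 hY.
  have zuY : 0 <= z * u * Yv by rewrite !mulr_ge0 // ltW.
  have q3 := ler_wpM2l zuY hg.
  have tt : 0 <= t * v * (1 - g) * u * Yv.
    by rewrite !mulr_ge0 ?subr_ge0 // ltW.
  have q4 := ler_wpM2l tt z1.
  have q5 := ler_wpM2l (ltW t0) q1.
  lra.
lra.
Qed.

Lemma beta_le_budget : 1 <= kap -> beta_opt <= (1 - G2) * Y / (2 * tau a) + eb / 4.
Proof.
move=> k1; have h := Mg_smin S Hsv Hgb; have cb := Mgs_ge0; have ec := epsc_ge0 S.
have enb : nb * epsc a <= eb by rewrite /epsbar lerDr (epsf_ge0 S).
have zz : 0 < 1 - zeta a <= 1 by have /andP[z0 z1] := zeta_bounds S; lra.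
have /andP[p00 p01] := pi0_bounds S.
exact: beta_arith (tau_gt1 S) zz p00 (pi1_bounds S) cb ec k1 (ltW budget_gt0)
  (G2_le1 S Hsv Hgb) h enb epsbar_le_budget Gamma2_pi1.
Qed.

(** The budget tau Y / (tau - 1) is shared in proportions u g (noise), (1 - u) g
    (rate) and 1 - g (end points), where u stands for pi0 and g for Gamma2. *)
Lemma budget_arith (t u g Yv e be : R) :
  1 < t -> 0 < u < 1 -> 0 < g <= 1 -> 0 <= Yv -> 0 <= e -> 0 <= be ->
  4 * t * e <= u * g * Yv -> be <= (1 - g) * Yv / (2 * t) + e / 4 ->
  8 * e + (be + (be + 2 * e) * (1 / (2 * (t - 1)))
    + 4 / 5 * ((1 - u) * g) * (Yv / (t - 1))
    + e * (Num.sqrt (Num.min 1 (t - 1)))^-1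
      * (1 + 5 / 2 * Num.sqrt (1 / (2 * (t - 1))))) <= t * (Yv / (t - 1)).
Proof.
move=> t1 /andP[u0 u1] /andP[g0 g1] Y0 e0 be0 he hb.
have c0 : 0 < t - 1 by lra.
set c := t - 1 in c0 *; have tE : t = c + 1 by rewrite /c; ring.
set q0 := (Num.sqrt (Num.min 1 c))^-1; set q1 := Num.sqrt (1 / (2 * c)).
have q10 : 0 <= q1 by rewrite sqrtr_ge0.
have d0 : 0 <= 1 / (2 * c) by rewrite divr_ge0 // mulr_ge0 // ltW.
have q1E : 2 * c * q1 ^+ 2 = 1.
  by rewrite sqr_sqrtr // div1r mulfV // gt_eqF // mulr_gt0.
have key : 8 * c + (c + 1 / 2) / 4 + 1 + c * q0 * (1 + 5 / 2 * q1) <= 4 * t ^+ 2.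
  rewrite /q0; have [c1|c1] := leP 1 c.
    have q1c : q1 <= 3 / 4 by nra.
    rewrite sqrtr1 invr1 mulr1 tE.
    have := ler_wpM2l (ltW c0) q1c; have := sqr_ge0 (c - 1); nra.
  have s0 : 0 < Num.sqrt c by rewrite sqrtr_gt0.
  have sE := sqr_sqrtr (ltW c0).
  set s := Num.sqrt c in s0 sE *.
  have -> : c * s^-1 = s by rewrite -sE expr2 mulfK // gt_eqF.
  (* s q1 = 1 / sqrt 2 *)
  have sq : s * q1 <= 3 / 4.
    have : 2 * (s * q1) ^+ 2 = 1 by rewrite exprMn sE mulrA.
    have : 0 <= s * q1 by rewrite mulr_ge0 // ltW.
    move: (s * q1) => z z0 z2; nra.
  have s2 : s <= (1 + c) / 2 by have := sqr_ge0 (s - 1); rewrite -sE; lra.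
  by rewrite tE; have := sqr_ge0 (c - 1 / 8); nra.
have Q0 : 0 <= c * q0 * (1 + 5 / 2 * q1).
  by rewrite mulr_ge0 // ?addr_ge0 ?mulr_ge0 ?invr_ge0 ?sqrtr_ge0 // ltW.
have t0 : 0 < t by lra.
rewrite -(ler_pM2r c0).
have -> : t * (Yv / c) * c = t * Yv by rewrite -mulrA divfK // gt_eqF.
have -> : (8 * e + (be + (be + 2 * e) * (1 / (2 * c)) + 4 / 5 * ((1 - u) * g) * (Yv / c)
    + e * q0 * (1 + 5 / 2 * q1))) * c
  = 8 * c * e + (c + 1 / 2) * be + e + 4 / 5 * ((1 - u) * g) * Yv
    + e * (c * q0 * (1 + 5 / 2 * q1)).
  by field; rewrite gt_eqF.
set X := c * q0 * _ in key Q0 *.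
have h1 : (c + 1 / 2) * be <= (c + 1 / 2) * ((1 - g) * Yv / (2 * t) + e / 4).
  by rewrite ler_wpM2l //; lra.
have gY : 0 <= (1 - g) * Yv by rewrite mulr_ge0 // subr_ge0.
have h2 : (c + 1 / 2) * ((1 - g) * Yv / (2 * t)) <= t * ((1 - g) * Yv).
  rewrite mulrA ler_pdivrMr ?mulr_gt0 //.
  have : (c + 1 / 2) <= t * (2 * t) by rewrite tE; nra.
  by move/(ler_wpM2r gY); lra.
have h3 : e * (8 * c + (c + 1 / 2) / 4 + 1 + X) <= t * (u * g * Yv).
  apply: le_trans (ler_wpM2l e0 key) _.
  have := ler_wpM2l (ltW t0) he; lra.
have ug : 0 <= (1 - u) * g * Yv by rewrite !mulr_ge0 ?subr_ge0 // ltW.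
have h4 : 4 / 5 * ((1 - u) * g) * Yv <= t * ((1 - u) * g * Yv).
  have : 4 / 5 <= t by lra.
  by move/(ler_wpM2r ug); lra.
lra.
Qed.

Lemma epsbar_le_increase : 16 * eb <= tau a * (Y / a1).
Proof.
have eY := epsbar_le_budget; have ebg := eb_ge0 S Hsv Hgb Hinit; have y0 := budget_gt0.
have a1p := a1_gt0; have t0 := tau_gt0 S.
have /andP[z0 z1] := zeta_bounds S; have /andP[p0 p1] := pi0_bounds S.
have /andP[g0 g1] : 0 < G2 <= 1 by rewrite (G2_gt0 S Hsv Hgb) (G2_le1 S Hsv Hgb).
have w1 : pi0 a * (G2 * (1 - zeta a)) <= 1.
  by rewrite mulr_ile1 ?mulr_ile1 ?mulr_ge0 // ?(ltW p0) ?(ltW g0) //; lra.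
rewrite mulrA ler_pdivlMr //.
have := ler_wpM2r (ltW y0) w1; rewrite mul1r => h; have {}h := le_trans eY h.
have := ler_wpM2l (ltW t0) h; have := ler_wpM2r ebg (sqr_ge0 (tau a - 2)).
by rewrite mul0r; lra.
Qed.

(** The step that leaves the region costs at most 4 epsbar, the rest of the phase
    is phase_bound, and 2 epsbar are left over. *)
Lemma phase_total k0 J t :
  settled r k0 -> accepted P a r k0 ->
  (forall l, (k0 < l)%N -> (l < J)%N -> small_good_step P a r b o Ztilde l) ->
  (k0 < t)%N -> (t <= J)%N ->
  phi P (x t) (nu r k0) + 2 * eb <= phi P (x k0) (nu r k0) + tau a * (Y / a1).
Proof.
move=> Hset acc Hph kt tJ.
have ebg := eb_ge0 S Hsv Hgb Hinit; have Dg0 := Dopt_gt0 S Hmuhat Hsv Hgb Hinit HML.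
have a1p := a1_gt0; have t1 := tau_gt1 S; have y0 := budget_gt0.
have h1 := accepted_phi_le S acc; have h2 := eb_ge S Hsv Hgb Hinit k0.
have Hnu l : (k0.+1 <= l)%N -> nu r l = nu r k0 by move=> kl; apply: Hset; exact: ltnW.
have g01 : 0 < G2 <= 1 by rewrite (G2_gt0 S Hsv Hgb) (G2_le1 S Hsv Hgb).
have eY : 4 * tau a * eb <= pi0 a * G2 * Y.
  apply: le_trans epsbar_le_budget _; rewrite ler_wpM2r ?(ltW y0) //.
  have /andP[z0 z1] := zeta_bounds S; have /andP[p0 p1] := pi0_bounds S.
  rewrite ler_wpM2l ?(ltW p0) // ler_piMr ?(G2_gt0 S Hsv Hgb) //; last by lra.
  by case/andP: g01 => /ltW.
have [k1|k1] := leP 1 kap; last first.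
  have hq l : (k0.+1 <= l)%N -> (l < t)%N -> ~~ noisy_step l.
    by move=> _ _; apply/negP => /noisy_step_kappa; rewrite leNgt k1.
  have h3 := quiet_run Hph Hnu (leqnn _) kt tJ hq.
  by have := epsbar_le_increase; lra.
have h3 := phase_bound Hph Hnu kt tJ.
have h4 := budget_arith t1 (pi0_bounds S) g01 (ltW y0) ebg beta_opt_ge0 eY (beta_le_budget k1).
have KE : phase_cost (Dg / a1) = beta_opt + (beta_opt + 2 * eb) * (1 / (2 * a1))
    + 4 / 5 * ((1 - pi0 a) * G2) * (Y / a1)
    + eb * (Num.sqrt (Num.min 1 a1))^-1 * (1 + 5 / 2 * Num.sqrt (1 / (2 * a1))).
  have dE : Dg / a1 / (2 * Dg) = 1 / (2 * a1).
    by move: Dg Dg0 a1p => d d0 c0; field; rewrite !gt_eqF.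
  rewrite /phase_cost /window_factor /rate_opt dE; congr (_ + _ + _).
  by rewrite (mulrC Dg (gb + EH)) !mulrA.
rewrite KE in h3; lra.
Qed.

End SmallPhase.

(** * Excursions from the optimality region *)

Lemma lipschitz_intermediate (R : realType) (h : R -> R) (L v : R) : 0 <= L ->
  (forall s t, `|h s - h t| <= L * `|s - t|) -> h 0 <= v <= h 1 ->
  exists t, h t = v.
Proof.
move=> L0 hL hv.
have hcont : {within `[0, 1]%classic, continuous h}.
  apply: continuous_subspaceT => t; apply/cvgrPdist_le => e e0.
  have L1 : 0 < L + 1 by rewrite ltr_wpDl.
  near=> s; apply: le_trans (hL t s) _.
  have hs : `|t - s| <= e / (L + 1).
    near: s; apply: (@cvgr_dist_le _ _ _ (nbhs t) _ id t) => //.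
    by rewrite divr_gt0.
  apply: le_trans (ler_wpM2l L0 hs) _.
  by rewrite mulrA ler_pdivrMr // mulrC ler_wpM2l ?(ltW e0) // lerDl.
have h01 : h 0 <= h 1 by case/andP: hv => /le_trans; apply.
have [|t _ <-] := @IVT R h 0 1 v ler01 hcont; last by exists t.
by move: hv; rewrite (min_idPl h01) (max_idPr h01).
Unshelve. all: by end_near. Qed.

Section OptimalityStays.
Variables (R : realType) (n m : nat).
Variables (P : noisy_problem R n m) (a : parameters R) (r : run R n m).
Variables (b : constants R) (o : opt_constants R).
Variables (q : 'cV[R]_n -> nat) (Z Ztilde : forall y : 'cV[R]_n, 'M[R]_(n, q y)).
Variables k' k'' K0 : nat.
Hypothesis S : standing P a r b.
Hypothesis Hmu : 0 < mu b.
Hypothesis Hmuhat : 0 < muhat b.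
Hypothesis Hsv : jacobians_bounded_below P r o.
Hypothesis HZ : kernel_bases P o Z Ztilde.
Hypothesis Hgb : gradient_and_singular_value_bounds P r o.
Hypothesis Hinit : nu_init r <= nubar a b o.
Hypothesis HML : 0 < ML b (nubar a b o).
Hypothesis Hset : settled r k''.
Hypothesis HK0 : in_CAcII P a r b k' K0.

Local Notation x k := (iterate r k).
Local Notation D k := (Defs.radius r k).
Local Notation EH := (Eh a r b o).
Local Notation gb := (gammabar a r b o).
Local Notation eb := (epsbar a b o).
Local Notation Dg := (Dopt a r b o).
Local Notation Y := (Dg * (gb + EH)).
Local Notation a1 := (tau a - 1).
Local Notation w := (nu r k'').
Local Notation inG k := (CgZI P a r b o k' Z (iterate r k)).
Local Notation EgI := (EgZI P a r b o k').
Local Notation Gbar := (GbargZI P a r b o k' Z).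
Local Notation good k := (opt_good P a r b o Ztilde k).

Lemma calEAcII_ge0 : (0 <= calEAcII P a r b k')%E.
Proof.
apply: (@le_trans _ _ (cstat P r K0)%:E); first by rewrite lee_fin norm2_ge0.
by apply: ereal_sup_ubound; exists (x K0) => //; exact: in_CAcII_point.
Qed.

Lemma EgZI_ge : ((EH + gb)%:E <= EgI)%E.
Proof.
have c0 := calEAcII_ge0; have e0 := eps_gZ_ge0 S HZ HK0.
have g10 := Gamma1_gt0 Hsv Hgb; have s0 := smin_gt0 Hsv.
have c1 : 0 <= Gamma1 o * MW b / sigma_min o.
  exact: divr_ge0 (mulr_ge0 (ltW g10) (MW_ge0 S)) (ltW s0).
rewrite /EgZI; move: EH gb => u v; rewrite EFinD; apply: leeD => //.
by rewrite -addeA leeDl // adde_ge0 // mule_ge0 // lee_fin.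
Qed.

Lemma gZnorm_le_grad y : gZnorm P Z y <= norm2 (g P y).
Proof.
rewrite /gZnorm trmx_mul trmxK; have [hY _ _] := HZ y; exact: orthonormal_tr_le hY.
Qed.

(** A point whose gradient norm is at most EgZI belongs to the region, as the
    projected gradient is no longer than the gradient. On the segment between the
    two iterates the gradient norm is continuous, so it takes a value at least
    EgZI inside the region. *)
Lemma exit_gradient k : inG k -> ~ inG k.+1 -> ((gb + EH)%:E <= Gbar)%E.
Proof.
move=> Gk nG; have EgE := EgZI_ge.
have lt1 : (EgI < (gZnorm P Z (x k.+1))%:E)%E by rewrite ltNge; apply/negP.
have [e eE] : exists e, EgI = e%:E.
  case: EgI lt1 EgE => [e _ _|//|//]; by exists e.
rewrite eE lte_fin in lt1; rewrite addrC; apply: le_trans EgE _; rewrite eE.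
have hub y : CgZI P a r b o k' Z y -> ((norm2 (g P y))%:E <= Gbar)%E.
  by move=> hy; apply: ereal_sup_ubound; exists y.
have [big|small] := leP e (norm2 (g P (x k))).
  by apply: le_trans (hub _ Gk); rewrite lee_fin.
pose d := x k.+1 - x k; pose h t := norm2 (g P (x k + t *: d)).
case: (std_smooth S) => L0 _ [_ gl] _.
have hL s t : `|h s - h t| <= (Lf b * norm2 d) * `|s - t|.
  have lip : norm2 (g P (x k + s *: d) - g P (x k + t *: d)) <= Lf b * norm2 d * `|s - t|.
    apply: le_trans (gl _ _) _; rewrite -mulrA ler_wpM2l //.
    by rewrite opprD addrACA subrr add0r -scalerBl norm2Z mulrC.
  rewrite ler_norml; have := norm2_leB (g P (x k + s *: d)) (g P (x k + t *: d)).
  have := norm2_leB (g P (x k + t *: d)) (g P (x k + s *: d)).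
  rewrite [norm2 (g P (x k + t *: d) - _)]norm2BC -/(h s) -/(h t) => h1 h2.
  by apply/andP; split; lra.
have h0 : h 0 = norm2 (g P (x k)) by rewrite /h scale0r addr0.
have h1 : h 1 = norm2 (g P (x k.+1)) by rewrite /h scale1r addrC subrK.
have [|t ht] := lipschitz_intermediate (mulr_ge0 L0 (norm2_ge0 d)) hL (v := e).
  rewrite h0 h1 (ltW small) /=; apply: ltW; apply: lt_le_trans lt1 _; exact: gZnorm_le_grad.
rewrite -ht; apply: hub; rewrite /CgZI /= eE lee_fin -ht; exact: gZnorm_le_grad.
Qed.

Lemma dgZ_gt0 : 0 < dgZ a r b o.
Proof.
have a10 := a1_gt0 S; rewrite -(pmulr_lgt0 _ a10) (dgZE S HML).
exact: mulr_gt0 (tau_gt0 S) (Dopt_gt0 S Hmuhat Hsv Hgb Hinit HML).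
Qed.

Lemma PgZII_ge k : inG k -> ~ inG k.+1 ->
  ((tau a * (Y / a1))%:E <= PgZII P a r b o k' k'' Z)%E.
Proof.
move=> Gk nG; have d0 := dgZ_gt0.
have -> : tau a * (Y / a1) = (gb + EH) * dgZ a r b o.
  have a10 : a1 != 0 by rewrite gt_eqF // (a1_gt0 S).
  apply: (mulIf a10); rewrite -[RHS]mulrA (dgZE S HML) -[LHS]mulrA divfK //.
  by rewrite [RHS]mulrCA (mulrC Dg).
rewrite EFinM; apply: lee_wpmul2r; first by rewrite lee_fin ltW.
apply: le_trans (exit_gradient Gk nG) _; rewrite -addeA leeDl //.
apply: adde_ge0; last by rewrite lee_fin ltW.
by rewrite mule_ge0 ?calEAcII_ge0 // lee_fin (nu_ge0 S).
Qed.

Section Bound.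
Variables (K : nat) (pb Q : R).
Hypothesis HK : (k'' <= K)%N.
Hypothesis HpbG : forall k, (K <= k)%N -> inG k -> phi P (x k) w <= pb.
Hypothesis HQ : tau a * (Y / a1) <= Q.
Hypothesis GK : inG K.

Lemma nu_settled k : (K <= k)%N -> nu r k = w.
Proof. by move=> Kk; apply: Hset; exact: leq_trans HK Kk. Qed.

Lemma anchor_le k : (K <= k)%N -> nu r k' <= nu r k.
Proof.
move=> Kk; have [h|h] := leqP k' k; first exact: (nu_mono S h).
have k2 := leq_trans (leq_trans HK Kk) (ltnW h).
by rewrite (nu_settled Kk) (Hset k2).
Qed.

Lemma settled_phitilde_close k y : (K <= k)%N -> `|phitilde P y w - phi P y w| <= eb.
Proof.
move=> Kk; apply: le_trans (phitilde_close S y (nu_ge0 S k'')) _.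
exact: eb_ge S Hsv Hgb Hinit k''.
Qed.

(** The second case is a radius that has become large, so that the noisy merit
    function decreases; the third one is a phase of small steps since a visit at
    k0. *)
Definition phase_state k :=
  [\/ inG k,
      phitilde P (x k) w <= pb + Q - eb /\ Dg / tau a < D k |
      exists k0, [/\ (K <= k0)%N, (k0 < k)%N, inG k0, accepted P a r k0 &
        forall l, (k0 < l)%N -> (l < k)%N -> small_good_step P a r b o Ztilde l]].

Lemma epsbar_le_Q : 16 * eb <= Q.
Proof. exact: le_trans (epsbar_le_increase S Hmuhat Hsv Hgb Hinit HML) HQ. Qed.

Lemma phase_state_bound k : (K <= k)%N -> phase_state k -> phi P (x k) w <= pb + Q.
Proof.
have ebg := eb_ge0 S Hsv Hgb Hinit; have q16 := epsbar_le_Q.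
move=> Kk [Gk|[ht _]|[k0 [Kk0 k0k Gk0 ak0 hph]]].
- by have := HpbG Kk Gk; lra.
- by have := settled_phitilde_close (x k) Kk; rewrite ler_norml => /andP[? ?]; lra.
have hs : settled r k0.
  by move=> l kl; rewrite !nu_settled // (leq_trans Kk0).
have := phase_total S Hmuhat Hsv HZ Hgb Hinit HML hs ak0 hph k0k (leqnn _).
by rewrite nu_settled //; have := HpbG Kk0 Gk0; have := HQ; move: (tau a * (_ / _)) => c; lra.
Qed.

Lemma phase_state_next k : (K <= k)%N ->
  (phi P (x k) w <= pb + Q -> in_CAcII P a r b k' k) ->
  phase_state k -> phase_state k.+1.
Proof.
move=> Kk hII st; have hb := phase_state_bound Kk st; have kII := hII hb.
have Dg0 := Dopt_gt0 S Hmuhat Hsv Hgb Hinit HML; have t1 := tau_gt1 S; have t0 := tau_gt0 S.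
have [G1|nG1] := pselect (inG k.+1); first by apply: Or31.
have [Gk|nGk] := pselect (inG k).
  apply: Or33; exists k; split => //; last by move=> l kl; rewrite ltnS leqNgt kl.
  apply: contrapT => /negP rk; apply: nG1; by have [-> _] := rejectedP S rk.
have gk : good k := opt_good_notC S Hsv HZ Hgb kII nGk.
have [nk kk] := (nu_settled Kk, nu_settled (leqW Kk)).
have large : phitilde P (x k) w <= pb + Q - eb -> Dg / tau a < D k ->
    phase_state k.+1.
  move=> ht hD; apply: Or32.
  have [ak|rk] := boolP (accepted P a r k).
    have := opt_large S Hmuhat Hsv HZ Hgb Hinit HML gk (ltW hD) ak; rewrite nk => h.
    have e0 := eta_opt_gt0 S Hmuhat Hsv Hgb Hinit HML; split; first by lra.
    have [_ ->] := acceptedP S ak; apply: lt_le_trans hD _.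
    by rewrite ler_peMl ?(radius_ge0 S) // ltW.
  have [-> ->] := rejectedP S rk; split => //.
  rewrite ltr_pM2r ?invr_gt0 // ltNge; apply: contra rk => Dk.
  by have [] := opt_small S Hmuhat Hsv HZ Hgb Hinit HML gk Dk.
case: st => [//|[ht hD]|[k0 [Kk0 k0k Gk0 ak0 hph]]]; first exact: large.
have [Dk|Dk] := leP (D k) Dg.
  have [ak _] := opt_small S Hmuhat Hsv HZ Hgb Hinit HML gk Dk.
  apply: Or33; exists k0; split => //; first exact: ltnW.
  move=> l k0l; rewrite ltnS leq_eqVlt => /orP[/eqP ->|]; last exact: hph.
  by split.
apply: large.
  have hs : settled r k0.
    by move=> l kl; rewrite !nu_settled // (leq_trans Kk0).
  have := phase_total S Hmuhat Hsv HZ Hgb Hinit HML hs ak0 hph k0k (leqnn _).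
  rewrite nu_settled //; have := HpbG Kk0 Gk0.
  have := HQ; move: (tau a * (_ / _)) => c.
  by have := settled_phitilde_close (x k) Kk; rewrite ler_norml => /andP[? ?]; lra.
by apply: le_lt_trans Dk; rewrite ler_pdivrMr // ler_peMr ?(ltW Dg0) // ltW.
Qed.

(** Applies when EAcII lies below the merit bound. An iterate outside CAcI then
    satisfies the excursion invariant of part (ii) with the threshold max(E2, pb /
    nu), up to noise, whether or not it is in CAcII. *)
Lemma excursion_bound E2 :
  (forall k, in_CAcII P a r b k' k -> Phi P (x k) (nu r k) <= E2) ->
  w * E2 <= pb + Q ->
  forall k, (K <= k)%N -> phi P (x k) w <= pb + Q + 2 * eb.
Proof.
move=> hE2 hE; have ebg := eb_ge0 S Hsv Hgb Hinit; have q16 := epsbar_le_Q.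
have w0 := nu_gt0 S k''.
pose T := Num.max E2 (pb / w) + (w^-1 * epsf a + epsc a).
have ew : w * (w^-1 * epsf a + epsc a) <= eb.
  by rewrite -noise_scaled //; exact: eb_ge S Hsv Hgb Hinit k''.
have wM : w * Num.max E2 (pb / w) <= pb + Q.
  rewrite maxr_pMr ?(ltW w0) // ge_max hE /= mulrC divfK ?gt_eqF //; lra.
have of_phi k : (K <= k)%N -> Phi P (x k) w <= Num.max E2 (pb / w) ->
    out_state P a r b k' T k.
  by move=> Kk h; apply: (out_state_of_PhiP S); rewrite nu_settled // PhiPE lerD2r.
suff inv k : (K <= k)%N -> in_CAcII P a r b k' k \/ out_state P a r b k' T k.
  move=> k Kk; case: (inv k Kk) => [kII|[hT _]].
    have := hE2 _ kII; rewrite nu_settled // => h; rewrite -PhiE //.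
    by have := ler_wpM2l (ltW w0) h; lra.
  rewrite nu_settled // in hT; have := PhiT_close S (x k) w0; rewrite ler_norml => /andP[h1 h2].
  rewrite -PhiE //.
  have h3 : Phi P (x k) w <= Num.max E2 (pb / w) + 2 * (w^-1 * epsf a + epsc a).
    by move: hT; rewrite /T; lra.
  by have := ler_wpM2l (ltW w0) h3; rewrite mulrDr; lra.
elim: k => [|k IH] Kk.
  right; apply: of_phi => //; rewrite le_max ler_pdivlMr // mulrC PhiE //.
  by apply/orP; right; apply: HpbG => //; rewrite -(eqP (_ : K == 0)%N) // -leqn0.
move: Kk; rewrite leq_eqVlt => /orP[/eqP KE|].
  right; apply: of_phi; rewrite -KE // le_max ler_pdivlMr // mulrC PhiE //.
  by apply/orP; right; apply: HpbG.
rewrite ltnS => Kk; have hk := anchor_le Kk.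
have [Ck|nCk] := pselect (CAcI P a r b k' (x k)).
  left; exact: (CAcI_stays S Hmu hk Ck (leqnSn k)).
right; apply: (out_step S Hmu hk nCk); case: (IH Kk) => // kII.
by apply: of_phi => //; rewrite le_max -(nu_settled Kk) (hE2 _ kII).
Qed.

(** Either every iterate below the merit level is in CAcII, so that the phase
    analysis applies throughout, or some iterate is not, which places EAcII below
    the merit level. *)
Lemma merit_bound k : (K <= k)%N -> phi P (x k) w <= pb + Q + 2 * eb.
Proof.
have ebg := eb_ge0 S Hsv Hgb Hinit.
have [all_in|] := pselect (forall l, (K <= l)%N -> phi P (x l) w <= pb + Q ->
    in_CAcII P a r b k' l).
  move=> Kk; suff st : phase_state k by have := phase_state_bound Kk st; lra.
  elim: k Kk => [|k IH] Kk.
    by apply: Or31; rewrite -(eqP (_ : K == 0)%N) // -leqn0.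
  move: Kk; rewrite leq_eqVlt => /orP[/eqP <-|]; first exact: Or31.
  rewrite ltnS => Kk; apply: phase_state_next (IH Kk) => //; exact: all_in.
move=> hno; have [l [Kl hl nl]] : exists l, [/\ (K <= l)%N, phi P (x l) w <= pb + Q &
    ~ in_CAcII P a r b k' l].
  apply: contrapT => hn; apply: hno => l Kl hl; apply: contrapT => nl.
  by apply: hn; exists l.
move/negP: nl; rewrite /in_CAcII -ltNge nu_settled // => hlt.
have [E2 EE] : exists E2, EAcII P a r b k' = E2%:E.
  move: HK0; rewrite /in_CAcII; case: (EAcII _ _ _ _ _) hlt => [e _ _|//|//].
  by exists e.
apply: (excursion_bound (E2 := E2)).
  by move=> j; rewrite /in_CAcII EE lee_fin.
rewrite EE lte_fin in hlt; apply: le_trans hl; rewrite -PhiE ?(nu_gt0 S) //.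
by rewrite ler_wpM2l ?(nu_ge0 S) // ltW.
Qed.

End Bound.

(** If the iterates never leave CgZI there is nothing to prove; otherwise
    exit_gradient makes PgZII large enough. *)
Lemma CgZI_stays K : (k'' <= K)%N -> inG K ->
  forall k, (K <= k)%N -> in_CgZII P a r b o k' k'' Z k.
Proof.
move=> HK GK k Kk; rewrite /in_CgZII (Hset (leq_trans HK Kk)).
set PB := phibargZI P a r b o k' k'' Z; set Pg := PgZII P a r b o k' k'' Z.
have ebg := eb_ge0 S Hsv Hgb Hinit.
have PBge j : inG j -> ((phi P (x j) w)%:E <= PB)%E.
  by move=> Gj; apply: ereal_sup_ubound; exists (x j).
have EE : EgZII P a r b o k' k'' Z = (PB + (Order.max Pg (2 * eb)%:E + (2 * eb)%:E))%E.
  by rewrite addeA.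
have m0 : (0 <= Order.max Pg (2 * eb)%:E + (2 * eb)%:E)%E.
  rewrite adde_ge0 ?lee_fin ?mulr_ge0 // le_max lee_fin mulr_ge0 ?orbT //.
rewrite EE.
have [exit|stay] := pselect (exists2 j, (K <= j)%N & inG j /\ ~ inG j.+1); last first.
  have Gk : inG k.
    elim: k Kk => [|k IH] Kk; first by rewrite -(eqP (_ : K == 0)%N) // -leqn0.
    move: Kk; rewrite leq_eqVlt => /orP[/eqP <- //|]; rewrite ltnS => Kk.
    by apply: contrapT => nG; apply: stay; exists k => //; split => //; exact: IH.
  by apply: le_trans (PBge k Gk) _; rewrite leeDl.
have [j _ [Gj nGj]] := exit; have PgY : (_ <= Pg)%E := PgZII_ge Gj nGj.
have mP : (Pg <= Order.max Pg (2 * eb)%:E)%E by rewrite le_max lexx.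
have pK := PBge K GK.
case PBE : PB pK => [pb| |] // pK; last first.
  by rewrite addye ?leey // gt_eqF // (lt_le_trans _ m0) // ltNy0.
case PgE : Pg PgY mP => [Q| |] // PgY mP; last first.
  by move: mP; rewrite leye_eq => /eqP ->; rewrite addye // addey // leey.
rewrite lee_fin in PgY.
apply: le_trans (_ : _ <= (pb%:E + (Q%:E + (2 * eb)%:E))%E)%E _; last first.
  by apply: leeD => //; apply: leeD.
rewrite -!EFinD lee_fin addrA; apply: (merit_bound HK _ PgY GK Kk) => l Kl Gl.
by rewrite -lee_fin -PBE; exact: PBge.
Qed.

End OptimalityStays.

(** * The theorem *)

Theorem theorem2 (R : realType) (n m : nat)
    (P : noisy_problem R n m) (a : parameters R) (r : run R n m)
    (b : constants R) (o : opt_constants R)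
    (q : 'cV[R]_n -> nat) (Z Ztilde : forall x : 'cV[R]_n, 'M[R]_(n, q x))
    (k' : nat)
    (Ha : valid_parameters a) (Hr : generated P a r)
    (Hmu : 0 < mu b) (Hmuhat : 0 < muhat b)
    (HMc : 0 < Mc b) (HM : 0 < Mbig r b)
    (H1 : smoothness P b) (H2 : iterate_bounds P r b) (H3 : noise_bounds P a b) :
  [/\ (* (i) *)
      forall N : nat, exists k : nat, (N <= k)%N /\ CAcI P a r b k' (iterate r k),
      (* (ii) *)
      forall K : nat, (k' <= K)%N -> CAcI P a r b k' (iterate r K) ->
        forall k : nat, (K <= k)%N -> in_CAcII P a r b k' k
    & jacobians_bounded_below P r o -> kernel_bases P o Z Ztilde ->
      gradient_and_singular_value_bounds P r o ->
      (exists B : R, forall k : nat, nu r k <= B) /\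
      (nu_init r <= nubar a b o -> 0 < ML b (nubar a b o) ->
       forall k'' : nat, settled r k'' ->
       forall K0 : nat, in_CAcII P a r b k' K0 ->
         (* (iii) *)
         (forall N : nat, exists k : nat,
            [/\ (N <= k)%N, (K0 <= k)%N,
                CgZI P a r b o k' Z (iterate r k)
              & ((gZnorm P Z (iterate r k))%:E
                   <= EgZI P a r b o k' + eps_gZ P a r b o k')%E]) /\
         (* (iv) *)
         (forall K : nat, (K0 <= K)%N -> (k'' <= K)%N ->
            CgZI P a r b o k' Z (iterate r K) ->
            forall k : nat, (K <= k)%N -> in_CgZII P a r b o k' k'' Z k))].
Proof.
have S : standing P a r b := Standing Ha Hr HMc HM H1 H2 H3.
split=> [N|K kK CK k Kk|Hsv HZ Hgb].
- exact: (feas_visits S k' Hmu N).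
- exact: (CAcI_stays S Hmu (nu_mono S kK) CK Kk).
split; first by exists (Num.max (nu_init r) (nubar a b o)); exact: (nu_bounded S Hsv Hgb).
move=> Hinit HML k'' Hset K0 HK0; split=> [N|K _ kK GK k Kk].
  have [k [hk Gk gk]] := opt_visits k' S Hmu Hmuhat Hsv HZ Hgb Hinit HML Hset (maxn N K0).
  by move: hk; rewrite geq_max => /andP[Nk Kk]; exists k.
exact: (CgZI_stays S Hmu Hmuhat Hsv HZ Hgb Hinit HML Hset HK0 kK GK Kk).
Qed.
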